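(* Let $H=\bigoplus_{n\in\mathbb{N}}H_n$ be an arbitrary graded connected cocommutative Hopf algebra over a field $\mathbb{K}$ of characteristic zero, let $\hat H:=\prod_{n\in\mathbb{N}}H_n$, let $G(H)$ be the (pro-unipotent) group of group-like elements of $\hat H$ and let $Prim(H)$ be the (pro-nilpotent) Lie algebra of primitive elements of $\hat H$. Then any Lie idempotent series $\gamma=(\gamma_n)_{n\geq 1}$ induces, through its natural action on $\hat H$, an isomorphism (a bijection) $G(H)\to Prim(H)$. When the series is the Eulerian idempotent series, this bijection is the logarithm $g\mapsto \log(g)$, with inverse the exponential $Prim(H)\to G(H)$. For the Dynkin series, i.e. for the map $g\mapsto D(g)=(S\star Y)(g)$ from $G(H)$ to $Prim(H)$, the inverse map is $\Gamma:Prim(H)\to G(H)$ sending $h=\sum_{n\ge 0}h_n$ (with $h_n\in H_n$) to $$\Gamma(h)=\sum_{n\ge 0}\ \sum_{\substack{i_1+\cdots+i_k=n\\ i_j>0}}\frac{h_{i_1}\cdots h_{i_k}}{i_1(i_1+i_2)\cdots(i_1+\cdots+i_k)},$$ where the $n=0$ term is $1$.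
   Context: Let $X$ be a countably infinite set and $T(X)=\bigoplus_n T_n(X)$ the tensor algebra over $\mathbb{K}$ (noncommutative polynomials in $X$), a graded connected cocommutative Hopf algebra in which the elements of $X$ are primitive. $Lie_n(X)\subset T_n(X)$ is the degree $n$ component of the free Lie algebra over $X$. For a Hopf algebra with product $\pi$ and coproduct $\Delta$, the convolution product of endomorphisms is $f\star g:=\pi\circ(f\otimes g)\circ\Delta$. The descent algebra $\mathcal{D}=\bigoplus_n\mathcal{D}_n$ is the convolution subalgebra of $\mathrm{End}(T(X))$ generated by the graded projections $p_n:T(X)\to T_n(X)$; it is a free associative algebra on the $p_n$, $n\ge 1$, with $p_n$ of degree $n$ (and $p_0$ is the unit for convolution). It acts on any graded connected cocommutative Hopf algebra $H$ via the convolution algebra morphism $\mathcal{D}\to\mathrm{End}(H)$ sending $p_n$ to the graded projection $H\to H_n$; elements of $\mathcal{D}_n$ act on $H_n$ and vanish on $H_m$, $m\neq n$. A Lie idempotent of degree $n$ is an element of $\mathcal{D}_n$ which is a projector from $T_n(X)$ onto $Lie_n(X)$. A Lie idempotent series is a sequence $\gamma=(\gamma_n)_{n\geq1}$ with $\gamma_n$ a Lie idempotent of degree $n$; it acts on $\hat H$ by $\sum_n g_n\mapsto \sum_{n\ge 1}\gamma_n(g_n)$. The Eulerian idempotent series consists of the graded components of the convolution logarithm $\log(\mathrm{Id}_{T(X)})$. The Dynkin operator on $H$ is $D=S\star Y$, where $S$ is the antipode and $Y$ is multiplication by $n$ on $H_n$; the Dynkin idempotent series is $(D_n/n)_{n\ge1}$,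 with $D_n$ the restriction of $D$ to degree $n$ (on $T(X)$, $D$ is the left-to-right iterated bracketing $y_1\cdots y_n\mapsto[\dots[[y_1,y_2],y_3]\dots,y_n]$). *)

(* Defs.v *)
From HB Require Import structures.
From mathcomp Require Import all_boot ssralg generic_quotient ring_quotient.
From mathcomp Require Import finmap.
From mathcomp Require Import boolp classical_sets functions cardinality fsbigop.
From mathcomp.multinomials Require Import monalg.

Set Implicit Arguments.
Unset Strict Implicit.
Unset Printing Implicit Defensive.

Import GRing.Theory.

Local Open Scope quotient_scope.
Local Open Scope classical_set_scope.
Local Open Scope ring_scope.

Section LinearExtension.
Context {R : nzRingType} {I : choiceType} {M : lmodType R}.

Definition mlift (f : I -> M) (u : {malg R[I]}) : M :=
  \sum_(k <- msupp u) u@_k *: f k.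

Lemma mliftEw (f : I -> M) (d : {fset I}) u : (msupp u `<=` d)%fset ->
  mlift f u = \sum_(k <- d) u@_k *: f k.
Proof.
move=> le; rewrite /mlift; apply/big_fset_incl => // k _.
by move/mcoeff_outdom => ->; rewrite scale0r.
Qed.

Lemma mlift_linear f : linear (mlift f).
Proof.
move=> a u v; pose d := (msupp u `|` msupp v)%fset.
have hu : (msupp u `<=` d)%fset by apply: fsubsetUl.
have hv : (msupp v `<=` d)%fset by apply: fsubsetUr.
have hw : (msupp (a *: u + v) `<=` d)%fset.
  apply: fsubset_trans (msuppD_le _ _) _; apply: fsetUSS => //.
  exact: msuppZ_le.
rewrite (mliftEw _ hu) (mliftEw _ hv) (mliftEw _ hw) scaler_sumr -big_split /=.
by apply: eq_bigr => k _; rewrite mcoeffD mcoeffZ scalerDl scalerA.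
Qed.

HB.instance Definition _ f :=
  GRing.isLinear.Build R {malg R[I]} M *:%R (mlift f) (mlift_linear f).

Lemma mliftU f k : mlift f << k >> = f k.
Proof.
rewrite (mliftEw _ msuppU_le) big_seq_fset1.
by rewrite mcoeffUU scale1r.
Qed.

End LinearExtension.

Section Tensor.
Context (K : fieldType) (V W : lmodType K).

(* V (x) W is the quotient of the free module on V * W by the submodule tnull
   generated by the bilinearity relations. *)
Inductive tnull : {malg K[(V * W)%type]} -> Prop :=
| tnull0 : tnull 0
| tnullD u v : tnull u -> tnull v -> tnull (u + v)
| tnullZ a u : tnull u -> tnull (a *: u)
| tnull_l a v v' w :
    tnull (<< (a *: v + v', w) >> - (a *: << (v, w) >> + << (v', w) >>))
| tnull_r a v w w' :
    tnull (<< (v, a *: w + w') >> - (a *: << (v, w) >> + << (v, w') >>)).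

Definition tens_null : {pred {malg K[(V * W)%type]}} := fun u => `[< tnull u >].

Fact tens_null_zmod : zmod_closed tens_null.
Proof.
split; first exact/asboolP/tnull0.
move=> u v /asboolP hu /asboolP hv; apply/asboolP; apply: tnullD => //.
by rewrite -scaleN1r; apply: tnullZ.
Qed.

HB.instance Definition _ :=
  GRing.isZmodClosed.Build {malg K[(V * W)%type]} tens_null tens_null_zmod.

Definition tensor : Type := Quotient.quot tens_null.
HB.instance Definition _ := GRing.Zmodule.on tensor.

(* tpi, trepr, tens and tlift are locked, because unification that unfolds
   them is very slow. *)
Fact tensor_key : unit. Proof. exact: tt. Qed.

Definition tpi : {malg K[(V * W)%type]} -> tensor :=
  locked_with tensor_key (fun u => \pi_(Quotient.quot tens_null) u).
Canonical tpi_unlockable := [unlockable of tpi].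

Definition trepr : tensor -> {malg K[(V * W)%type]} :=
  locked_with tensor_key (fun t => repr (t : Quotient.quot tens_null)).
Canonical trepr_unlockable := [unlockable of trepr].

Fact treprK t : tpi (trepr t) = t.
Proof.
by rewrite [tpi]unlock [trepr]unlock (reprK (t : Quotient.quot tens_null)).
Qed.

Fact tpiD u v : tpi (u + v) = tpi u + tpi v.
Proof.
by rewrite [tpi]unlock; exact: (raddfD \pi_(Quotient.quot tens_null)).
Qed.

Fact tpiP u v : tpi u = tpi v <-> tnull (u - v).
Proof.
have h : tens_null (u - v) = (tpi u == tpi v).
  by rewrite [tpi]unlock; exact: (Quotient.idealrBE tens_null u v).
split=> [/eqP|uv]; first by rewrite -h => /asboolP.
by apply/eqP; rewrite -h; apply/asboolP.
Qed.

Definition tensor_scale (a : K) (t : tensor) : tensor := tpi (a *: trepr t).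

Fact tpiZ a u : tpi (a *: u) = tensor_scale a (tpi u).
Proof. by apply/tpiP; rewrite -scalerBr; apply/tnullZ/tpiP; rewrite treprK. Qed.

Fact tensor_scalerA a b t :
  tensor_scale a (tensor_scale b t) = tensor_scale (a * b) t.
Proof. by rewrite -[t]treprK -!tpiZ scalerA. Qed.

Fact tensor_scale1r : left_id 1 tensor_scale.
Proof. by move=> t; rewrite -[t]treprK -tpiZ scale1r. Qed.

Fact tensor_scalerDr : right_distributive tensor_scale +%R.
Proof.
by move=> a s t; rewrite -[s]treprK -[t]treprK -tpiD -!tpiZ scalerDr tpiD.
Qed.

Fact tensor_scalerDl t : {morph tensor_scale^~ t : a b / a + b}.
Proof. by move=> a b; rewrite -[t]treprK -!tpiZ scalerDl tpiD. Qed.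

HB.instance Definition _ := GRing.Zmodule_isLmodule.Build K tensor
  tensor_scalerA tensor_scale1r tensor_scalerDr tensor_scalerDl.

Fact tpi_linear : linear tpi.
Proof. by move=> a u v; rewrite tpiD tpiZ. Qed.

Definition tens : V -> W -> tensor :=
  locked_with tensor_key (fun v w => tpi << (v, w) >>).
Canonical tens_unlockable := [unlockable of tens].

Fact tensE v w : tens v w = tpi << (v, w) >>.
Proof. by rewrite unlock. Qed.

(* The linear map on V (x) W induced by f; only meaningful for bilinear f,
   see tliftE. *)
Definition tlift (U : lmodType K) : (V -> W -> U) -> tensor -> U :=
  locked_with tensor_key (fun f t => mlift (fun k => f k.1 k.2) (trepr t)).
Canonical tlift_unlockable U := [unlockable of @tlift U].

Fact tlift_pi (U : lmodType K) (f : V -> W -> U) u :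
  (forall v, linear (f v)) -> (forall w, linear (f^~ w)) ->
  tlift f (tpi u) = mlift (fun k => f k.1 k.2) u.
Proof.
move=> fr fl; rewrite unlock; apply/eqP; rewrite -subr_eq0 -linearB; apply/eqP.
suff h x : tnull x -> mlift (fun k => f k.1 k.2) x = 0.
  by apply: h; apply/tpiP; rewrite treprK.
elim=> {x} [|x y _ hx _ hy|a x _ hx|a v v' w|a v w w'].
- exact: linear0.
- by rewrite linearD /= hx hy addr0.
- by rewrite linearZ /= hx scaler0.
- by rewrite linearB linearD linearZ /= !mliftU /= fl subrr.
- by rewrite linearB linearD linearZ /= !mliftU /= fr subrr.
Qed.

Lemma tliftE (U : lmodType K) (f : V -> W -> U) v w :
  (forall v, linear (f v)) -> (forall w, linear (f^~ w)) ->
  tlift f (tens v w) = f v w.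
Proof. by move=> fr fl; rewrite tensE tlift_pi // mliftU. Qed.

Lemma tlift_linear (U : lmodType K) (f : V -> W -> U) :
  (forall v, linear (f v)) -> (forall w, linear (f^~ w)) -> linear (tlift f).
Proof.
move=> fr fl a s t; rewrite -[s]treprK -[t]treprK.
by rewrite -tpi_linear !tlift_pi // linearP.
Qed.

Lemma tens_linear_l w : linear (tens^~ w).
Proof.
move=> a v v'; rewrite !tensE -tpi_linear.
by apply/tpiP/tnull_l.
Qed.

Lemma tens_linear_r v : linear (tens v).
Proof.
move=> a w w'; rewrite !tensE -tpi_linear.
by apply/tpiP/tnull_r.
Qed.

End Tensor.

Arguments tens {K V W}.
Arguments tlift {K V W U} f t : rename.

Section TensorMaps.
Context {K : fieldType}.

Definition tmap {V V' W W' : lmodType K} (f : V -> V') (g : W -> W')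
    : tensor V W -> tensor V' W' :=
  tlift (fun v w => tens (f v) (g w)).

Definition tswap {V W : lmodType K} : tensor V W -> tensor W V :=
  tlift (fun v w => tens w v).

Definition tassoc {U V W : lmodType K}
    : tensor (tensor U V) W -> tensor U (tensor V W) :=
  tlift (fun t w => tlift (fun u v => tens u (tens v w)) t).

Definition tmul {A B : algType K} (s t : tensor A B) : tensor A B :=
  tlift (fun (a : A) (b : B) => tlift (fun (a' : A) (b' : B) =>
    tens (a * a' : A) (b * b' : B)) t) s.

End TensorMaps.

(* hproj n is the projection onto the component of degree n. *)
Record hopfData (K : fieldType) := HopfData {
  hcar :> algType K;
  hproj : nat -> {linear hcar -> hcar};
  hcop : {linear hcar -> tensor hcar hcar};
  hcounit : {linear hcar -> K^o};
  hanti : {linear hcar -> hcar}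
}.

Section Convolution.
Context {K : fieldType} (H : hopfData K).
Implicit Types f g : H -> H.

Definition conv f g : H -> H := fun x =>
  tlift (fun a b : H => f a * g b : H) (hcop H x).

Definition conv1 : H -> H := fun x => (hcounit H x)%:A.

Definition convX f (k : nat) : H -> H := iter k (conv f) conv1.

Definition degree_op : H -> H :=
  fun x => \sum_(n \in [set: nat]) hproj H n x *+ n.

Definition dynkin_op : H -> H := conv (hanti H) degree_op.

(* On a connected H the sum is finite at each x. *)
Definition conv_log_id : H -> H := fun x =>
  \sum_(k \in [set k | (0 < k)%N])
    ((-1) ^+ k.-1 / k%:R) *: convX (fun y => y - conv1 y) k x.

End Convolution.

Arguments conv1 {K} H x.
Arguments degree_op {K} H x.
Arguments dynkin_op {K} H x.
Arguments conv_log_id {K} H x.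

Record graded_conn_cocomm_hopf (K : fieldType) (H : hopfData K) : Prop := {
  proj_proj : forall m n (x : H),
    hproj H m (hproj H n x) = if m == n then hproj H n x else 0;
  proj_finite : forall x : H, finite_set [set n | hproj H n x != 0];
  proj_sum : forall x : H, x = \sum_(n \in [set: nat]) hproj H n x;
  proj_one : hproj H 0%N 1 = 1;
  proj_mul : forall m n (x y : H),
    hproj H (m + n)%N (hproj H m x * hproj H n y) = hproj H m x * hproj H n y;
  proj_connected : forall x : H, exists c : K, hproj H 0%N x = c%:A;
  cop_one : hcop H 1 = tens (1 : H) (1 : H);
  cop_mul : forall x y : H, hcop H (x * y) = tmul (hcop H x) (hcop H y);
  counit_one : hcounit H 1 = 1;
  counit_mul : forall x y : H, hcounit H (x * y) = hcounit H x * hcounit H y;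
  cop_assoc : forall x : H,
    tassoc (tmap (hcop H) id (hcop H x)) = tmap id (hcop H) (hcop H x);
  cop_counit_l : forall x : H,
    tlift (fun a b : H => hcounit H a *: b : H) (hcop H x) = x;
  cop_counit_r : forall x : H,
    tlift (fun a b : H => hcounit H b *: a : H) (hcop H x) = x;
  cop_comm : forall x : H, tswap (hcop H x) = hcop H x;
  cop_graded : forall n (x : H),
    hcop H (hproj H n x) =
    \sum_(i < n.+1) tmap (hproj H i) (hproj H (n - i)%N) (hcop H x);
  counit_graded : forall n (x : H), (0 < n)%N -> hcounit H (hproj H n x) = 0;
  anti_graded : forall n (x : H),
    hproj H n (hanti H (hproj H n x)) = hanti H (hproj H n x);
  anti_l : conv (hanti H) id = conv1 H;
  anti_r : conv id (hanti H) = conv1 H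
}.

(* Elements of the completions of H and of H (x) H are represented by the
   sequences of their homogeneous components (for the total degree on
   H (x) H). *)
Section Completion.
Context {K : fieldType} (H : hopfData K).
Implicit Types f g h : nat -> H.

Definition hat : set (nat -> H) := [set f | forall n, hproj H n (f n) = f n].

Definition hat_one : nat -> H := fun n => if n == 0%N then 1 : H else 0.

Definition hat_mul f g : nat -> H := fun n => \sum_(i < n.+1) f i * g (n - i)%N.

Definition hat_pow f (k : nat) : nat -> H := iter k (hat_mul f) hat_one.

Definition hat_cop f : nat -> tensor H H := fun n => hcop H (f n).

Definition hat_tens f g : nat -> tensor H H :=
  fun n => \sum_(i < n.+1) tens (f i) (g (n - i)%N).

Definition grouplike : set (nat -> H) :=
  [set g | [/\ hat g, hcounit H (g 0%N) = 1 & hat_cop g = hat_tens g g]].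

Definition primitive : set (nat -> H) :=
  [set h | hat h /\
    hat_cop h = (fun n => hat_tens h hat_one n + hat_tens hat_one h n)].

(* In each degree, only finitely many terms are nonzero when f has constant
   term 1 (for hat_log) or 0 (for hat_exp). *)
Definition hat_log f : nat -> H := fun n =>
  \sum_(k \in [set k | (0 < k)%N])
    ((-1) ^+ k.-1 / k%:R) *: hat_pow (fun m => f m - hat_one m) k n.

Definition hat_exp f : nat -> H := fun n =>
  \sum_(k \in [set: nat]) (k`!%:R)^-1 *: hat_pow f k n.

Definition hat_dynkin f : nat -> H := fun n => dynkin_op H (f n).

(* Compositions of n have at most n parts, each at most n. *)
Definition hat_Gamma h : nat -> H := fun n =>
  \sum_(k < n.+1)
    \sum_(i : {ffun 'I_k -> 'I_n.+1} |
          [forall j, (0 < i j)%N] && (\sum_j i j == n)%N)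
      (\prod_(j < k) (\sum_(l < k | (l <= j)%N) i l)%N%:R)^-1 *:
      \prod_(j < k) h (i j).

End Completion.

Arguments hat {K} H.
Arguments hat_one {K} H n.
Arguments grouplike {K} H.
Arguments primitive {K} H.
Arguments hat_log {K} H f n.
Arguments hat_exp {K} H f n.
Arguments hat_dynkin {K} H f n.
Arguments hat_Gamma {K} H h n.

Section TensorAlgebra.
Context (K : fieldType) (X : choiceType).

Definition free_type : Type := {malg K[{fmonom X}]}.
HB.instance Definition _ := GRing.Lalgebra.on free_type.

Fact free_scalerAr (a : K) (x y : free_type) : a *: (x * y) = x * (a *: y).
Proof.
rewrite -!mul_malgC !mulrA; congr (_ * y).
rewrite mul_malgC malgZ_def malgM_def fgmulgU.
by apply: eq_bigr => k _; rewrite mulm1 mulrC.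
Qed.

HB.instance Definition _ :=
  GRing.Lalgebra_isAlgebra.Build K free_type free_scalerAr.

Definition free_alg : algType K := free_type.

Definition letter (x : X) : free_alg := << fmu x >>.

Definition word (w : seq X) : free_alg := \prod_(x <- w) letter x.

(* The algebra morphism for which the letters are primitive, on words. *)
Definition word_cop (w : seq X) : tensor free_alg free_alg :=
  let one : free_alg := 1 in
  foldr (fun x t => tmul (tens (letter x) one + tens one (letter x)) t)
    (tens one one) w.

Definition tensor_alg : hopfData K := {|
  hcar := free_alg;
  hproj := fun n =>
    mlift (fun w : {fmonom X} => if size w == n then << w >> else 0);
  hcop := mlift (fun w : {fmonom X} => word_cop w);
  hcounit := mlift (fun w : {fmonom X} => (size w == 0%N)%:R : K^o);
  hanti := mlift (fun w : {fmonom X} => (-1) ^+ size w *: word (rev w)) |}.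

(* The free Lie algebra over X, as the Lie subalgebra of T(X) generated by X. *)
Inductive lie_elt : free_alg -> Prop :=
| lie_letter x : lie_elt (letter x)
| lie_0 : lie_elt 0
| lie_add u v : lie_elt u -> lie_elt v -> lie_elt (u + v)
| lie_scale a u : lie_elt u -> lie_elt (a *: u)
| lie_bracket u v : lie_elt u -> lie_elt v -> lie_elt (u * v - v * u).

Definition Lie (n : nat) : set tensor_alg :=
  [set u | lie_elt u /\ hproj tensor_alg n u = u].

End TensorAlgebra.

(* The letter i of a noncommutative polynomial P stands for the graded
   projection p_i; P is evaluated in End(H) with the convolution product. *)
Definition descent_eval (K : fieldType) (H : hopfData K)
    (P : {malg K[{fmonom nat}]}) : H -> H := fun x =>
  \sum_(w <- msupp P)
    P@_w *: foldr (fun n f => conv (hproj H n) f) (conv1 H) w x.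

Arguments descent_eval {K} H P x.

Section Descent.
Context (K : fieldType) (X : choiceType).
Local Notation T := (tensor_alg K X).

Definition descent_component (n : nat) : set (T -> T) :=
  [set f | exists2 P : {malg K[{fmonom nat}]},
    (forall w, w \in msupp P -> sumn w = n) & f = descent_eval T P].

(* The image of f under the algebra morphism from the descent algebra to
   End(H) that sends p_n to p_n.  For infinite X the result does not depend on
   the choice of P, because the p_n with n > 0 are free generators of the
   descent algebra and p_0 is its unit, as it is in End(H). *)
Definition descent_act (H : hopfData K) (f : T -> T) : H -> H :=
  descent_eval H (xget 0 [set P | f = descent_eval T P]).

Definition lie_idempotent (n : nat) (f : T -> T) : Prop :=
  [/\ descent_component n f,
      forall u, hproj T n u = u -> f (f u) = f u
    & f @` [set u | hproj T n u = u] = Lie n].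

Definition lie_idempotent_series (gamma : nat -> T -> T) : Prop :=
  forall n, (0 < n)%N -> lie_idempotent n (gamma n).

Definition series_act (H : hopfData K) (gamma : nat -> T -> T) (g : nat -> H)
    : nat -> H :=
  fun n => if n == 0%N then 0 else descent_act (gamma n) (g n).

Definition eulerian_series : nat -> T -> T :=
  fun n u => conv_log_id T (hproj T n u).

Definition dynkin_series : nat -> T -> T :=
  fun n u => n%:R^-1 *: dynkin_op T (hproj T n u).

End Descent.

Arguments descent_act {K X} H f x.
Arguments series_act {K X} H gamma g n.
Arguments eulerian_series K X n u : clear implicits.
Arguments dynkin_series K X n u : clear implicits.

Definition inverse_bij {A B : Type} (P : set A) (Q : set B) (f : A -> B)
    (g : B -> A) : Prop :=
  [/\ set_bij P Q f, forall y, Q y -> P (g y),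
      forall x, P x -> g (f x) = x & forall y, Q y -> f (g y) = y].

(* Main.v *)
(* Sequences with values in an algebra are treated as formal power series under
   the Cauchy product.  For a group-like series g the series h = D(g) is the
   solution of g h = Y(g); this equation determines g from h by the recursion
   n g_n = sum_(i < n) g_i h_(n-i), whose solution is Gamma(h): this gives the
   Dynkin case.  For the Eulerian case, Log of a group-like series is primitive
   because Log (a b) = Log a + Log b for commuting a and b.

   A descent element given by a noncommutative polynomial P in the p_n acts on
   a group-like g by substituting the g_n for the p_n.  Writing g = Gamma(h)
   turns P(g) into a polynomial Q in the components of the primitive series h,
   and Q is read off from the action on T(X) by taking for h a series of free
   generators of a free Lie subalgebra, which exists as X is infinite.  Hence
   the action does not depend on the choice of P, and Q is primitive if P maps
   T(X) to Lie elements.  If P is moreover a Lie idempotent of degree n, the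
   coefficient of p_n in P is 1, so P_n(g) = g_n + (terms in lower degrees):
   a triangular system with a unique solution.

   That the Eulerian idempotents map T(X) to Lie elements follows from the
   theory of Log in the convolution algebra Hom(T(X), T(X)), where the sequence
   of the p_n is itself group-like, and from the Dynkin operator, which maps
   T(X) to Lie elements and is multiplication by n on primitives of degree n. *)

Require Import Defs.
From HB Require Import structures.
From mathcomp Require Import all_boot ssralg poly.
From mathcomp Require Import finmap.
From mathcomp Require Import boolp classical_sets functions cardinality fsbigop.
From mathcomp.multinomials Require Import monalg.

Set Implicit Arguments.
Unset Strict Implicit.
Unset Printing Implicit Defensive.

Import GRing.Theory.

Local Open Scope ring_scope.

(** * Formal power series over an algebra *)

(** Group-like series are not closed under addition, so a triangular system cannot be solved by
    correcting a group-like series directly. The corrections are made on the primitive series h with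
    g = Gamma(h): adding a primitive v of degree n to h changes Gamma(h) by v/n in degree n and by
    nothing below. The polynomial P that represents a descent element is obtained by choice, so it
    may be inhomogeneous and contain the letter 0. Independence of this choice is established on
    group-like series only, by comparison on the single group-like series Gamma(l) of T(X), with l
    the series of free generators; freeness is used through a linear left inverse of the evaluation
    at l. The coefficient of p_n in P is detected on primitive elements: a convolution product of
    two projections of positive degree vanishes there, so P acts on primitives of degree n by a
    scalar. A Lie idempotent fixes a nonzero Lie element of degree n, which forces this scalar to be
    1. *)

Section Series.
Context {K : fieldType}.

(* The alias keeps the Cauchy product apart from the pointwise product, which is
   the canonical ring structure on [nat -> R]. *)
Definition ser (R : algType K) : Type := nat -> R.
HB.instance Definition _ (R : algType K) :=
  GRing.Lmodule.copy (ser R) (nat -> R).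

Section Ring.
Context {R : algType K}.
Implicit Types f g h u : ser R.

Definition ser_one : ser R := fun n => (n == 0)%:R.
Definition ser_mul f g : ser R := fun n => \sum_(i < n.+1) f i * g (n - i)%N.

(** The coefficients of a Cauchy product up to degree n see only truncations, so associativity can
    be inherited from polynomials over [R]. *)
Lemma ser_mul_poly f g n m : (n < m)%N ->
  ser_mul f g n = ((\poly_(i < m) f i) * (\poly_(i < m) g i))`_n.
Proof.
move=> nm; rewrite coefM; apply: eq_bigr => i _; rewrite !coef_poly.
by rewrite (leq_ltn_trans _ nm) ?(leq_ltn_trans _ nm) ?leq_subr // -ltnS.
Qed.

Lemma ser_mulA : associative ser_mul.
Proof.
move=> f g h; apply/funext => n.
pose p (f : ser R) := \poly_(i < n.+1) f i.
have pM u v i : (i < n.+1)%N -> (p (ser_mul u v))`_i = (p u * p v)`_i.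
  by move=> ni; rewrite coef_poly ni (ser_mul_poly _ _ ni).
rewrite !(@ser_mul_poly _ _ n n.+1) //.
transitivity ((p f * (p g * p h))`_n); last first.
  rewrite mulrA coefM [RHS]coefM; apply: eq_bigr => i _; congr (_ * _).
  by rewrite pM // ltn_ord.
rewrite coefM [RHS]coefM; apply: eq_bigr => i _; congr (_ * _).
by rewrite pM // ltnS leq_subr.
Qed.

Lemma ser_mul1 : left_id ser_one ser_mul.
Proof.
move=> f; apply/funext => n; rewrite /ser_mul big_ord_recl /= subn0 mul1r.
by rewrite big1 ?addr0 // => i _; rewrite mul0r.
Qed.

Lemma ser_mulr1 : right_id ser_one ser_mul.
Proof.
move=> f; apply/funext => n; rewrite /ser_mul big_ord_recr /= subnn mulr1.
rewrite big1 ?add0r // => i _; rewrite /ser_one subn_eq0 leqNgt ltn_ord.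
by rewrite mulr0.
Qed.

Lemma ser_mulDl : left_distributive ser_mul +%R.
Proof.
move=> f g h; apply/funext => n; apply: etrans (big_split _ _ _ _ _).
by apply: eq_bigr => i _; exact: mulrDl.
Qed.

Lemma ser_mulDr : right_distributive ser_mul +%R.
Proof.
move=> f g h; apply/funext => n; apply: etrans (big_split _ _ _ _ _).
by apply: eq_bigr => i _; exact: mulrDr.
Qed.

Lemma ser_one_neq0 : ser_one != 0.
Proof. by apply/eqP => /(congr1 (@^~ 0%N)) /eqP; rewrite /= oner_eq0. Qed.

HB.instance Definition _ := GRing.Zmodule_isNzRing.Build (ser R)
  ser_mulA ser_mul1 ser_mulr1 ser_mulDl ser_mulDr ser_one_neq0.

Lemma ser_scalerAl (a : K) f g : a *: (f * g) = (a *: f) * g.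
Proof.
apply/funext => n; rewrite [LHS]scaler_sumr.
by apply: eq_bigr => i _; rewrite -scalerAl.
Qed.

HB.instance Definition _ :=
  GRing.Lmodule_isLalgebra.Build K (ser R) ser_scalerAl.

Lemma ser_scalerAr (a : K) f g : a *: (f * g) = f * (a *: g).
Proof.
apply/funext => n; rewrite [LHS]scaler_sumr.
by apply: eq_bigr => i _; rewrite -scalerAr.
Qed.

HB.instance Definition _ :=
  GRing.Lalgebra_isAlgebra.Build K (ser R) ser_scalerAr.

Lemma serD f g n : (f + g) n = f n + g n. Proof. by []. Qed.

Lemma serB f g n : (f - g) n = f n - g n. Proof. by []. Qed.

Lemma serZ a f n : (a *: f) n = a *: f n. Proof. by []. Qed.

Lemma ser1 n : (1 : ser R) n = (n == 0)%:R. Proof. by []. Qed.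

Lemma serM f g n : (f * g) n = \sum_(i < n.+1) f i * g (n - i)%N.
Proof. by []. Qed.

Lemma serM0 f g : (f * g) 0%N = f 0%N * g 0%N.
Proof. by rewrite serM big_ord1. Qed.

Lemma serMn f m n : (f *+ m) n = f n *+ m.
Proof. by elim: m => // m IH; rewrite !mulrS serD IH. Qed.

Lemma ser_sum I (r : seq I) (P : pred I) (F : I -> ser R) n :
  (\sum_(i <- r | P i) F i) n = \sum_(i <- r | P i) F i n.
Proof. by elim/big_rec2: _ => // i y z _ <-. Qed.

Lemma ser_comm f g : (forall i j, GRing.comm (f i) (g j)) -> GRing.comm f g.
Proof.
move=> fg; apply/funext => n; rewrite serM [RHS]serM.
rewrite (reindex_inj rev_ord_inj) /=; apply: eq_bigr => i _.
by rewrite subSS subKn -1?ltnS // fg.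
Qed.

Definition ord_ge k f := forall n, (n < k)%N -> f n = 0.

Lemma ord_geM k l f g : ord_ge k f -> ord_ge l g -> ord_ge (k + l)%N (f * g).
Proof.
move=> fk gl n nkl; rewrite serM big1 // => i _.
have [/fk ->|ki] := ltnP i k; first by rewrite mul0r.
rewrite gl ?mulr0 // ltn_subLR; last by rewrite -ltnS.
by rewrite (leq_trans nkl) // leq_add2r.
Qed.

Lemma ord_geX (u : ser R) k : u 0%N = 0 -> ord_ge k (u ^+ k).
Proof.
move=> u0; elim: k => [|k IH]; first by [].
by rewrite exprS; apply: (@ord_geM 1 k) => // -[].
Qed.

(** The Euler derivation t d/dt rather than d/dt: it preserves degrees, and on a series of
    homogeneous components it is the operator Y. *)
Definition der f : ser R := fun n => f n *+ n.

Lemma derD f g : der (f + g) = der f + der g.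
Proof. by apply/funext => n; exact: mulrnDl. Qed.

Lemma derB f g : der (f - g) = der f - der g.
Proof. by apply/funext => n; exact: mulrnBl. Qed.

Lemma der1 : der 1 = 0.
Proof. by apply/funext => -[|n] //; rewrite /der ser1 mul0rn. Qed.

Lemma derM f g : der (f * g) = der f * g + f * der g.
Proof.
apply/funext => n; rewrite serD /der !serM -sumrMnl -big_split /=.
apply: eq_bigr => i _; rewrite mulrnAl mulrnAr -mulrnDr subnKC //.
by rewrite -ltnS.
Qed.

Lemma derX u k : GRing.comm u (der u) -> der (u ^+ k) = u ^+ k.-1 * der u *+ k.
Proof.
move=> cu; elim: k => [|k IH]; first by rewrite der1 mulr0n.
rewrite exprSr derM IH /= mulrnAl -mulrA -cu mulrA mulrS addrC; congr (_ + _).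
by case: k {IH} => [|k]; rewrite ?mulr0n //= -exprSr.
Qed.

End Ring.

Section CharZero.
Hypothesis charK : [pchar K] =i pred0.

Lemma natK n : (n.+1%:R : K) != 0.
Proof. by rewrite (proj1 (pcharf0P _) charK). Qed.

Lemma mulrn_lmod_inj (V : lmodType K) (x y : V) n :
  (0 < n)%N -> x *+ n = y *+ n -> x = y.
Proof.
case: n => // n _ xy.
have h (z : V) : z = n.+1%:R^-1 *: (z *+ n.+1).
  by rewrite -scaler_nat scalerA mulVf ?natK // scale1r.
by rewrite [x]h xy -h.
Qed.

Section DiffEq.
Context {R : algType K}.
Implicit Types f g h u : ser R.

Lemma der_inj f g : f 0%N = g 0%N -> der f = der g -> f = g.
Proof.
move=> fg0 fg; apply/funext => -[//|n].
by apply: (@mulrn_lmod_inj _ _ _ n.+1) => //; exact: (congr1 (@^~ n.+1) fg).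
Qed.

(** In degree n + 1 the term with f_(n+1) on the right is multiplied by h_0 = 0, so the equation
    expresses (n + 1) f_(n+1) through lower coefficients. This uniqueness yields exp(log(1 + z)) = 1
    + z, the group-likeness of Gamma(h), and Gamma(D(g)) = g. *)
Lemma ode_unique f g h : h 0%N = 0 -> f 0%N = g 0%N ->
  der f = f * h -> der g = g * h -> f = g.
Proof.
move=> h0 fg0 ef eg; apply/funext; elim/ltn_ind => -[//|n] IH.
apply: (@mulrn_lmod_inj _ _ _ n.+1) => //.
have := congr1 (@^~ n.+1) ef; have := congr1 (@^~ n.+1) eg.
rewrite /der !serM => -> ->; rewrite big_ord_recr [RHS]big_ord_recr /=.
rewrite subnn h0 !mulr0; congr (_ + _); apply: eq_bigr => i _.
by rewrite IH.
Qed.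

(* The terms with [k] factors of the degree [n] part of Gamma(h), grouped by the
   degree [n - i] of their last factor. *)
Fixpoint gamk h k n : R :=
  if k is k'.+1 then n%:R^-1 *: \sum_(i < n) gamk h k' i * h (n - i)%N
  else (n == 0%N)%:R.
Arguments gamk : simpl never.

Lemma gamkS h k n :
  gamk h k.+1 n = n%:R^-1 *: \sum_(i < n) gamk h k i * h (n - i)%N.
Proof. by []. Qed.

Definition gam h : ser R := fun n => \sum_(k < n.+1) gamk h k n.

Lemma gamk_gt h k n : (n < k)%N -> gamk h k n = 0.
Proof.
elim: k n => // k IH n; rewrite ltnS => nk.
by rewrite gamkS big1 ?scaler0 // => i _; rewrite IH ?mul0r // (leq_trans _ nk).
Qed.

Lemma gamE h n N : (n < N)%N -> gam h n = \sum_(k < N) gamk h k n.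
Proof.
move=> nN; rewrite -(subnKC nN) big_split_ord /= [X in _ + X]big1 ?addr0 // => i
  _.
by rewrite gamk_gt //= ltn_addr.
Qed.

Lemma gam0 h : gam h 0%N = 1. Proof. by rewrite /gam big_ord1. Qed.

(** Multiplication by the degree cancels the last denominator i_1 + ... + i_k of each term; what
    remains is a shorter term times its last factor. *)
Lemma der_gam h : h 0%N = 0 -> der (gam h) = gam h * h.
Proof.
move=> h0; apply/funext => -[|n]; first by rewrite serM0 h0 mulr0 /der mulr0n.
rewrite serM big_ord_recr /= subnn h0 mulr0 addr0 /der {1}/gam.
rewrite big_ord_recl [gamk _ _ _]/= add0r -scaler_nat scaler_sumr.
transitivity (\sum_(k < n.+1) \sum_(i < n.+1) gamk h k i * h (n.+1 - i)%N).
  apply: eq_bigr => k _; rewrite lift0 gamkS scalerA divff ?scale1r //.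
  exact: natK.
rewrite exchange_big /=; apply: eq_bigr => i _.
by rewrite (gamE _ (ltn_ord i)) mulr_suml.
Qed.

Lemma ser_lreg g h h' : g 0%N = 1 -> g * h = g * h' -> h = h'.
Proof.
move=> g0 e; apply/funext; elim/ltn_ind => n IH.
have := congr1 (@^~ n) e; rewrite /= !serM !big_ord_recl /= subn0 g0 !mul1r.
rewrite (eq_bigr (fun i : 'I_n => g (lift ord0 i) * h' (n - lift ord0 i)%N)).
  by move/addIr.
by move=> i _; rewrite IH //= ltn_subrL /= (leq_ltn_trans _ (ltn_ord i)).
Qed.

End DiffEq.

End CharZero.

Section Compose.
Context {R : algType K}.
Implicit Types (c d : ser K^o) (u v : ser R) (A B : nat -> ser R).

(* Meaningful when [A k] has order at least [k] for all [k]. *)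
Definition ssum A : ser R := fun n => (\sum_(k < n.+1) A k) n.

Lemma ssumE A n N : (forall k, ord_ge k (A k)) -> (n < N)%N ->
  ssum A n = (\sum_(k < N) A k) n.
Proof.
move=> hA nN; rewrite -(subnKC nN) big_split_ord /= serD [X in _ + X]ser_sum.
by rewrite [X in _ + X]big1 ?addr0 // => i _; rewrite hA //= ltn_addr.
Qed.

(** The families are regarded as polynomials with coefficients in [ser R], truncated at index n and
    evaluated at 1. The product of the truncations also has coefficients of index above n, but these
    have order above n and vanish in degree n. *)
Lemma ssumM A B : (forall k, ord_ge k (A k)) -> (forall k, ord_ge k (B k)) ->
  ssum A * ssum B = ssum (fun k => \sum_(j < k.+1) A j * B (k - j)%N).
Proof.
move=> hA hB; apply/funext => n.
pose p (A : nat -> ser R) := \poly_(i < n.+1) A i.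
have p1 (A' : nat -> ser R) : (p A').[1] = \sum_(k < n.+1) A' k.
  by rewrite horner_poly; apply: eq_bigr => i _; rewrite expr1n mulr1.
transitivity ((p A * p B).[1] n).
  rewrite hornerM_comm ?p1; last by rewrite /comm_poly mul1r mulr1.
  rewrite !serM; apply: eq_bigr => i _.
  by rewrite (ssumE hA (ltn_ord i)) (@ssumE _ _ n.+1) // ltnS leq_subr.
have sz : (size (p A * p B)%R <= n.+1 + n.+1)%N.
  apply: leq_trans (size_polyMleq _ _) _; apply: leq_trans (leq_pred _) _.
  by rewrite leq_add // size_poly.
rewrite (horner_coef_wide _ sz) big_split_ord /= serD !ser_sum.
rewrite [X in _ + X]big1 ?addr0.
  rewrite /ssum ser_sum; apply: eq_bigr => k _.
  rewrite expr1n mulr1 coefM; congr (_ n); apply: eq_bigr => j _.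
  rewrite !coef_poly (leq_trans (ltn_ord j) (ltn_ord k)).
  by rewrite (leq_ltn_trans (leq_subr _ _) (ltn_ord k)).
move=> k _; rewrite expr1n mulr1 coefM ser_sum big1 // => j _.
rewrite !coef_poly; case: ifP => _; last by rewrite mul0r.
case: ifP => _; last by rewrite mulr0.
apply: (ord_geM (hA _) (hB _)); rewrite subnKC -1?ltnS //.
by rewrite ltnS ltn_addr.
Qed.

(** Substitution of u, without constant term, in the scalar series c. For fixed u it is an algebra
    morphism from K[[z]] to [ser R], so the identities between exp and log are proved in K[[z]] and
    transported. *)
Definition scomp c u : ser R := ssum (fun k => c k *: u ^+ k).

Lemma scomp_ord c u : u 0%N = 0 -> forall k, ord_ge k (c k *: u ^+ k).
Proof. by move=> u0 k n nk; rewrite serZ ord_geX ?scaler0. Qed.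

Lemma scompE c u n N : u 0%N = 0 -> (n < N)%N ->
  scomp c u n = \sum_(k < N) c k *: (u ^+ k) n.
Proof.
by move=> u0 nN; rewrite /scomp (ssumE (scomp_ord _ u0) nN) ser_sum.
Qed.

Lemma scomp_mul c u v n N : u 0%N = 0 -> (n < N)%N ->
  (scomp c u * v) n = \sum_(k < N) c k *: (u ^+ k * v) n.
Proof.
move=> u0 nN; rewrite serM; transitivity
    (\sum_(i < n.+1) (\sum_(k < N) c k *: u ^+ k) i * v (n - i)%N).
  apply: eq_bigr => i _; rewrite (scompE _ u0 (leq_trans (ltn_ord i) nN)).
  by rewrite ser_sum.
rewrite -serM mulr_suml ser_sum; apply: eq_bigr => k _.
by rewrite -scalerAl.
Qed.

Lemma mul_scomp c u v n N : u 0%N = 0 -> (n < N)%N ->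
  (v * scomp c u) n = \sum_(k < N) c k *: (v * u ^+ k) n.
Proof.
move=> u0 nN; rewrite serM; transitivity
    (\sum_(i < n.+1) v i * (\sum_(k < N) c k *: u ^+ k) (n - i)%N).
  apply: eq_bigr => i _; rewrite (@scompE _ _ _ N) ?ser_sum //.
  exact: leq_ltn_trans (leq_subr _ _) nN.
rewrite -serM mulr_sumr ser_sum; apply: eq_bigr => k _.
by rewrite -scalerAr.
Qed.

Lemma comm_scomp c u v : u 0%N = 0 -> GRing.comm u v ->
  GRing.comm (scomp c u) v.
Proof.
move=> u0 uv; apply/funext => n; rewrite (scomp_mul _ _ u0 (ltnSn n)).
rewrite (mul_scomp _ _ u0 (ltnSn n)); apply: eq_bigr => k _; congr (_ *: _ n).
exact: (commr_sym (commrX k (commr_sym uv))).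
Qed.

Lemma scompD c d u : scomp (c + d) u = scomp c u + scomp d u.
Proof.
apply/funext => n; rewrite serD /scomp /ssum !ser_sum -big_split /=.
by apply: eq_bigr => k _; rewrite -scalerDl.
Qed.

Lemma scompN c u : scomp (- c) u = - scomp c u.
Proof.
apply/funext => n; rewrite -[RHS]/(- (scomp c u n)) /scomp /ssum !ser_sum
  -sumrN.
by apply: eq_bigr => k _; rewrite -scaleNr.
Qed.

Lemma scompM c d u : u 0%N = 0 -> scomp (c * d) u = scomp c u * scomp d u.
Proof.
move=> u0; rewrite ssumM; try exact: scomp_ord.
congr ssum; apply/funext => k; rewrite serM scaler_suml; apply: eq_bigr => j _.
by rewrite -scalerAl -scalerAr scalerA -exprD subnKC // -ltnS.
Qed.

Lemma scomp1 u : scomp 1 u = 1.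
Proof.
apply/funext => n; rewrite /scomp /ssum big_ord_recl big1 ?addr0 //.
  by rewrite ser1 scale1r expr0.
by move=> i _; rewrite ser1 scale0r.
Qed.

Definition zvar : ser K^o := fun n => (n == 1%N)%:R.

Lemma scomp_zvar u : u 0%N = 0 -> scomp zvar u = u.
Proof.
move=> u0; apply/funext => n; rewrite (@scompE _ _ _ n.+2) //.
rewrite !big_ord_recl big1 ?addr0; last by move=> i _; rewrite scale0r.
by rewrite scale0r add0r scale1r expr1.
Qed.

Lemma scompX c u k : u 0%N = 0 -> scomp (c ^+ k) u = scomp c u ^+ k.
Proof.
move=> u0; elim: k => [|k IH]; first by rewrite !expr0 scomp1.
by rewrite !exprS scompM // IH.
Qed.

Lemma scomp_at0 c u : scomp c u 0%N = (c 0%N)%:A.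
Proof. by rewrite /scomp /ssum big_ord1. Qed.

(** Chain rule: [der] is z d/dz, but the outer factor is the ordinary derivative of c, whence the
    shifted coefficients. Commutation of u with its derivative is what gives the derivative of a
    power its usual form. *)
Lemma der_scomp c u : u 0%N = 0 -> GRing.comm u (der u) ->
  der (scomp c u) = scomp (fun k => c k.+1 *+ k.+1) u * der u.
Proof.
move=> u0 cu; apply/funext => n; rewrite (scomp_mul _ _ u0 (ltnSn n)).
have -> : der (scomp c u) n = \sum_(k < n.+2) c k *: der (u ^+ k) n.
  rewrite {1}/der (@scompE _ _ _ n.+2) // -sumrMnl.
  by apply: eq_bigr => k _; rewrite /der scalerMnr.
rewrite big_ord_recl expr0 der1 scaler0 add0r; apply: eq_bigr => k _.
by rewrite derX // serMn -scalerMnr -scalerMnl.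
Qed.

End Compose.

Definition expc : ser K^o := fun n => (n`!%:R)^-1.
(** The series of log(1 + z). *)
Definition logc : ser K^o :=
  fun n => if n == 0%N then 0 else (-1) ^+ n.-1 / n%:R.

Lemma scomp_scomp (R : algType K) (c d : ser K^o) (u : ser R) :
  u 0%N = 0 -> d 0%N = 0 -> scomp (scomp c d) u = scomp c (scomp d u).
Proof.
move=> u0 d0; have du0 : scomp d u 0%N = 0 by rewrite scomp_at0 d0 scale0r.
apply/funext => n; rewrite (scompE _ u0 (ltnSn n)) (scompE _ du0 (ltnSn n)).
under eq_bigr => k _ do rewrite (scompE _ d0 (ltn_ord k)) scaler_suml.
rewrite exchange_big /=; apply: eq_bigr => k _.
rewrite -scompX // (scompE _ u0 (ltnSn n)) scaler_sumr; apply: eq_bigr => j _.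
by rewrite scalerA.
Qed.

Lemma mulrC_scalar (f g : ser K^o) : f * g = g * f.
Proof. by apply: ser_comm => i j; exact: mulrC. Qed.

Section Exponential.
Hypothesis charK : [pchar K] =i pred0.
Implicit Types (R : algType K).

Local Notation z := (zvar : ser K^o).

Lemma natKV n : (n.+1%:R : K) / n.+1%:R = 1.
Proof. by rewrite divff // natK. Qed.

Lemma der_expc_shift : (fun k => expc k.+1 *+ k.+1 : K^o) = expc.
Proof.
apply/funext => k; rewrite /expc factS natrM invfM -mulrnAl -mulr_natl natKV.
by rewrite mul1r.
Qed.

(** The ordinary derivative of log(1 + z) is the alternating geometric series, the inverse of 1 +
    z. *)
Lemma der_logc_shift :
  ((fun k => logc k.+1 *+ k.+1 : K^o) : ser K^o) * (1 + z) = 1.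
Proof.
have e k : logc k.+1 *+ k.+1 = (-1) ^+ k :> K.
  rewrite /logc -[LHS]/((-1) ^+ k / k.+1%:R *+ k.+1 : K).
  by rewrite -mulr_natr divfK ?natK.
apply/funext => -[|n]; first by rewrite serM0 e serD mul1r addr0.
rewrite serM big_ord_recr big_ord_recr big1 => [|[i ni] _]; last first.
  rewrite serD !ser1 /zvar /= subn_eq0 leqNgt.
  rewrite (leq_trans ni) // -(eqn_add2r i) subnK; last by rewrite ltnW // ltnW.
  by rewrite eqn_leq ltnNge add1n ni /= add0r mulr0.
rewrite !serD !ser1 /zvar /= subnn subSnn !e /= add0r addr0 exprS.
by rewrite add0r !mulr1 mulN1r subrr.
Qed.

Lemma zvar_mul (f : ser K^o) n : (z * f) n = if n is n'.+1 then f n' else 0.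
Proof.
case: n => [|n]; first by rewrite serM0 mul0r.
rewrite serM !big_ord_recl big1 => [|i _]; last by rewrite mul0r.
by rewrite mul0r mul1r add0r addr0 subSS subn0.
Qed.

Lemma der_logc : der (logc : ser K^o) * (1 + z) = z.
Proof.
have -> : der (logc : ser K^o) = z * (fun k => logc k.+1 *+ k.+1 : K^o).
  by apply/funext => n; rewrite zvar_mul; case: n.
by rewrite -mulrA der_logc_shift mulr1.
Qed.

Lemma der_expc : der (expc : ser K^o) = z * expc.
Proof.
by apply/funext => -[|n]; rewrite zvar_mul // -{2}der_expc_shift.
Qed.

Lemma der_zvar : der z = z.
Proof. by apply/funext => -[|[|n]]; rewrite /der ?mul0rn. Qed.

(** Both sides have constant term 1 and the same logarithmic derivative, that of 1 + z. *)
Lemma scomp_expc_logc : scomp expc logc = 1 + z.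
Proof.
apply: (@ode_unique charK _ _ _ (der (logc : ser K^o))) => //.
- by rewrite scomp_at0 /expc invr1 scale1r serD addr0.
- by rewrite der_scomp // ?der_expc_shift //; exact: mulrC_scalar.
- by rewrite derD der1 add0r der_zvar mulrC_scalar der_logc.
Qed.

Lemma scomp_logc_expc : scomp logc (expc - 1 : ser K^o) = z.
Proof.
have p0 : (expc - 1 : ser K^o) 0%N = 0 by rewrite serB /expc invr1 subrr.
apply: (der_inj charK); first by rewrite scomp_at0 scale0r.
rewrite der_scomp //; last exact: mulrC_scalar.
rewrite derB der1 subr0 der_expc der_zvar [z * _]mulrC_scalar mulrA.
(* The factor [expc] is recognised as 1 + z with [expc - 1] substituted for z, so that
   [der_logc_shift], transported by substitution, cancels it against the derivative of the
   logarithm. *)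
rewrite -[X in _ * X * _](addrNK 1) [X in _ * X * _]addrC.
rewrite -{2}(scomp_zvar p0) -[X in _ * (X + _) * _](scomp1 (expc - 1)).
by rewrite -scompD -scompM // der_logc_shift scomp1 mul1r.
Qed.

Definition Exp R (u : ser R) : ser R := scomp expc u.
Definition Log R (g : ser R) : ser R := scomp logc (g - 1).

Section Algebra.
Context {R : algType K}.
Implicit Types (u v : ser R) (a b g : ser R).

Lemma subr1_at0 g : g 0%N = 1 -> (g - 1) 0%N = 0.
Proof. by move=> g0; rewrite serB g0 subrr. Qed.

Lemma Log0 g : Log g 0%N = 0.
Proof. by rewrite /Log scomp_at0 scale0r. Qed.

Lemma Exp0 u : Exp u 0%N = 1.
Proof. by rewrite /Exp scomp_at0 /expc invr1 scale1r. Qed.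

Lemma LogK g : g 0%N = 1 -> Exp (Log g) = g.
Proof.
move=> g0; rewrite /Exp /Log -scomp_scomp ?subr1_at0 // scomp_expc_logc.
by rewrite scompD scomp1 scomp_zvar ?subr1_at0 // addrC subrK.
Qed.

Lemma ExpK u : u 0%N = 0 -> Log (Exp u) = u.
Proof.
move=> u0; rewrite /Log /Exp -(scomp1 u) -scompN -scompD -scomp_scomp //.
  by rewrite scomp_logc_expc scomp_zvar.
by rewrite serD /expc invr1 -[X in _ + X]/(- 1 : K) subrr.
Qed.

Lemma ExpD u v : u 0%N = 0 -> v 0%N = 0 -> GRing.comm u v ->
  Exp (u + v) = Exp u * Exp v.
Proof.
move=> u0 v0 uv; rewrite /Exp ssumM; try exact: scomp_ord.
congr ssum; apply/funext => k; rewrite exprDn_comm // scaler_sumr.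
rewrite (reindex_inj rev_ord_inj) /=; apply: eq_bigr => j _.
have jk : (j <= k)%N by rewrite -ltnS.
rewrite subSS subKn // -scalerAl -scalerAr scalerA -scaler_nat scalerA.
rewrite bin_sub //; congr (_ *: _).
have fK n : (n`!%:R : K) != 0 by case: n`! (fact_gt0 n) => // m _; exact: natK.
apply: (mulfI (fK k)); rewrite mulrA /expc divff // mul1r.
rewrite -(bin_fact jk) !natrM -[RHS]mulrA; apply/esym.
by rewrite mulrACA !divff // !mulr1.
Qed.

(** Reduces to [ExpD]: the logarithms of a and b commute, being series in the commuting a - 1 and b
    - 1. *)
Lemma LogM a b : a 0%N = 1 -> b 0%N = 1 -> GRing.comm a b ->
  Log (a * b) = Log a + Log b.
Proof.
move=> a0 b0 ab; rewrite -{1}(LogK a0) -{1}(LogK b0) -ExpD ?Log0 //.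
  by rewrite ExpK // serD !Log0 addr0.
have cB (x y : ser R) : GRing.comm x y -> GRing.comm (x - 1) y.
  by move=> xy; rewrite /GRing.comm mulrBl mulrBr xy mul1r mulr1.
apply: comm_scomp; rewrite ?subr1_at0 //; apply/commr_sym.
by apply: comm_scomp; rewrite ?subr1_at0 //; apply/cB/commr_sym/cB.
Qed.

End Algebra.
End Exponential.

Section Map.
Context {R S : algType K} (phi : {lrmorphism R -> S}).
Implicit Types f g u : ser R.

Definition smap f : ser S := fun n => phi (f n).

Let smapZ (a : K) (x : R) : phi (a *: x) = a *: phi x.
Proof. exact: linearZ. Qed.

Lemma smapB f g : smap (f - g) = smap f - smap g.
Proof. by apply/funext => n; exact: rmorphB. Qed.

Lemma smap1 : smap 1 = 1.
Proof. by apply/funext => n; rewrite /smap ser1 rmorph_nat. Qed.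

Lemma smapM f g : smap (f * g) = smap f * smap g.
Proof.
apply/funext => n; rewrite /smap !serM rmorph_sum.
by apply: eq_bigr => i _; rewrite rmorphM.
Qed.

Lemma smapX f k : smap (f ^+ k) = smap f ^+ k.
Proof.
by elim: k => [|k IH]; rewrite ?expr0 ?smap1 // !exprS smapM IH.
Qed.

Lemma smap_der f : smap (der f) = der (smap f).
Proof. by apply/funext => n; exact: rmorphMn. Qed.

Lemma smap_scomp c u : u 0%N = 0 -> smap (scomp c u) = scomp c (smap u).
Proof.
move=> u0; have su0 : smap u 0%N = 0 by rewrite /smap u0 raddf0.
apply/funext => n; rewrite /smap (scompE _ u0 (ltnSn n)) (scompE _ su0 (ltnSn
  n)).
by rewrite rmorph_sum; apply: eq_bigr => k _; rewrite /= smapZ -smapX.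
Qed.

Lemma smap_Exp u : u 0%N = 0 -> smap (Exp u) = Exp (smap u).
Proof. exact: smap_scomp. Qed.

Lemma smap_Log g : g 0%N = 1 -> smap (Log g) = Log (smap g).
Proof. by move=> g0; rewrite /Log smap_scomp ?subr1_at0 // smapB smap1. Qed.

Lemma smap_gamk u k n : phi (gamk u k n) = gamk (smap u) k n.
Proof.
elim: k n => [|k IH] n; first exact: rmorph_nat.
rewrite !gamkS smapZ rmorph_sum; congr (_ *: _); apply: eq_bigr => i _.
by rewrite rmorphM /= IH.
Qed.

Lemma smap_gam u : smap (gam u) = gam (smap u).
Proof.
apply/funext => n; rewrite /smap /gam rmorph_sum.
by apply: eq_bigr => k _; exact: smap_gamk.
Qed.

End Map.

(* Used with [delta] the coproduct, [i1 x = x (x) 1] and [i2 x = 1 (x) x], both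
   on [H] itself and, by composition, on the convolution algebra Hom(H, H). *)
Section Grouplike.
Hypothesis charK : [pchar K] =i pred0.
Context {R S : algType K} (delta i1 i2 : {lrmorphism R -> S}).
Hypothesis i12 : forall x y, GRing.comm (i1 x) (i2 y).
Implicit Types f g h : ser R.

Definition glike g := g 0%N = 1 /\ smap delta g = smap i1 g * smap i2 g.
Definition prim h := h 0%N = 0 /\ smap delta h = smap i1 h + smap i2 h.

Let comm12 f g : GRing.comm (smap i1 f) (smap i2 g).
Proof. by apply: ser_comm => i j; exact: i12. Qed.

Lemma glike_Exp h : prim h -> glike (Exp h).
Proof.
move=> [h0 hd]; split; first exact: Exp0.
rewrite !smap_Exp // hd (ExpD charK) //.
- by rewrite /smap h0 raddf0.
- by rewrite /smap h0 raddf0.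
Qed.

Lemma prim_Log g : glike g -> prim (Log g).
Proof.
move=> [g0 gd]; split; first exact: Log0.
rewrite !smap_Log // gd (LogM charK) //.
- by rewrite /smap g0 rmorph1.
- by rewrite /smap g0 rmorph1.
Qed.

Let der12 g h : der g = g * h ->
  der (smap i1 g * smap i2 g) =
  smap i1 g * smap i2 g * (smap i1 h + smap i2 h).
Proof.
move=> gh; rewrite derM -!smap_der gh !smapM -[LHS]addrC mulrDr addrC.
by rewrite -!mulrA; congr (_ * _ + _); rewrite comm12.
Qed.

(** With g = Gamma(h), both the coproduct of g and the product of its two images under [i1] and [i2]
    solve f' = f * delta(h) with constant term 1; for the product this uses that h is primitive and
    that the two images commute. *)
Lemma glike_gam h : prim h -> glike (gam h).
Proof.
move=> [h0 hd]; split; first exact: gam0.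
apply: (@ode_unique charK _ _ _ (smap delta h)).
- by rewrite /smap h0 raddf0.
- by rewrite serM0 /smap gam0 !rmorph1 mulr1.
- by rewrite -smap_der der_gam // smapM.
- by rewrite hd; apply: der12; rewrite der_gam.
Qed.

(** Deriving the group-like equation of g in two ways gives delta(g) times delta(h) on one side and
    delta(g) times i1(h) + i2(h) on the other; delta(g) has constant term 1 and is cancelled. *)
Lemma prim_ode g h : h 0%N = 0 -> der g = g * h -> glike g -> prim h.
Proof.
move=> h0 gh [g0 gd]; split=> //; apply: (@ser_lreg _ (smap delta g)).
  by rewrite /smap g0 rmorph1.
by rewrite -smapM -gh smap_der {2}gd -der12 // gd.
Qed.

End Grouplike.
End Series.

Arguments gamk {K R} h k n : simpl never.

(** * Tensor products *)

Section LinearPredicate.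
Context {K : fieldType} {U V : lmodType K} (f : U -> V).
Hypothesis lf : linear f.

Lemma linD x y : f (x + y) = f x + f y.
Proof. by have := lf 1 x y; rewrite !scale1r. Qed.

Lemma lin0 : f 0 = 0.
Proof. by apply: (addrI (f 0)); rewrite -linD !addr0. Qed.

Lemma linZ a x : f (a *: x) = a *: f x.
Proof. by have := lf a x 0; rewrite lin0 !addr0. Qed.

Lemma linN x : f (- x) = - f x.
Proof. by rewrite -scaleN1r linZ scaleN1r. Qed.

Lemma linB x y : f (x - y) = f x - f y.
Proof. by rewrite linD linN. Qed.

Lemma lin_sum I (r : seq I) (P : pred I) (F : I -> U) :
  f (\sum_(i <- r | P i) F i) = \sum_(i <- r | P i) f (F i).
Proof. by apply: big_morph; [exact: linD | exact: lin0]. Qed.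

End LinearPredicate.

Section LinearClosure.
Context {K : fieldType}.
Implicit Types U V W : lmodType K.

Lemma lin_id U : linear (@id U). Proof. by []. Qed.

Lemma lin_comp U V W (f : V -> W) (g : U -> V) :
  linear f -> linear g -> linear (fun x => f (g x)).
Proof. by move=> lf lg a x y; rewrite lg lf. Qed.

Lemma lin_cst0 U V : linear (fun _ : U => 0 : V).
Proof. by move=> a x y; rewrite scaler0 addr0. Qed.

Lemma lin_add U V (f g : U -> V) :
  linear f -> linear g -> linear (fun x => f x + g x).
Proof. by move=> lf lg a x y; rewrite lf lg scalerDr addrACA. Qed.

Lemma lin_opp U V (f : U -> V) : linear f -> linear (fun x => - f x).
Proof. by move=> lf a x y; rewrite lf opprD scalerN. Qed.

Lemma lin_scale U V c (f : U -> V) : linear f -> linear (fun x => c *: f x).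
Proof. by move=> lf a x y; rewrite lf scalerDr !scalerA mulrC. Qed.

Lemma lin_scalel U V (f : U -> K^o) (v : V) :
  linear f -> linear (fun x => f x *: v).
Proof. by move=> lf a x y; rewrite lf scalerDl scalerA. Qed.

Lemma lin_bigsum U V I (r : seq I) (P : pred I) (F : I -> U -> V) :
  (forall i, linear (F i)) -> linear (fun x => \sum_(i <- r | P i) F i x).
Proof.
move=> lF a x y; rewrite scaler_sumr -big_split.
by apply: eq_bigr => i _; exact: lF.
Qed.

Lemma lin_mull U (A : algType K) (c : A) (f : U -> A) :
  linear f -> linear (fun x => c * f x).
Proof. by move=> lf a x y; rewrite lf mulrDr scalerAr. Qed.

Lemma lin_mulr U (A : algType K) (c : A) (f : U -> A) :
  linear f -> linear (fun x => f x * c).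
Proof. by move=> lf a x y; rewrite lf mulrDl scalerAl. Qed.

Lemma lin_tensl U V W (w : W) (f : U -> V) :
  linear f -> linear (fun x => tens (f x) w).
Proof. by move=> lf a x y; rewrite lf tens_linear_l. Qed.

Lemma lin_tensr U V W (v : V) (f : U -> W) :
  linear f -> linear (fun x => tens v (f x)).
Proof. by move=> lf a x y; rewrite lf tens_linear_r. Qed.

Definition bilin U V W (f : U -> V -> W) :=
  (forall u, linear (f u)) /\ (forall v, linear (f^~ v)).

Lemma malgUZ (I : choiceType) (a : K) (k : I) :
  << a *g k >> = a *: << k >> :> {malg K[I]}.
Proof.
by apply/malgP => j; rewrite mcoeffZ !mcoeffU -mulr_natr -[in RHS]mulr_natr
  mul1r.
Qed.

Lemma malg_ext (I : choiceType) (V : lmodType K) (f g : {malg K[I]} -> V) :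
  linear f -> linear g -> (forall k, f << k >> = g << k >>) -> f =1 g.
Proof.
move=> lf lg fg u; rewrite (monalgE u) (lin_sum lf) (lin_sum lg).
by apply: eq_bigr => k _; rewrite malgUZ (linZ lf) (linZ lg) fg.
Qed.

(** Scalars are absorbed in the second factor and 0 is the pure tensor of 0 and 0, so pure tensors
    and sums exhaust the tensor product. *)
Lemma tensor_ind V W (P : tensor V W -> Prop) :
  (forall v w, P (tens v w)) -> (forall s t, P s -> P t -> P (s + t)) ->
  forall t, P t.
Proof.
move=> Pt PD t; rewrite -[t]treprK (monalgE (trepr t)).
rewrite (lin_sum (@tpi_linear _ _ _)); elim/big_rec: _ => [|k s _ Ps].
  by have := Pt 0 0; rewrite (lin0 (tens_linear_r _)).
apply: PD => //; rewrite malgUZ (linZ (@tpi_linear _ _ _)).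
by case: k => v w; rewrite -tensE -(linZ (tens_linear_r _)).
Qed.

Lemma tensor_ext U V W (f g : tensor V W -> U) : linear f -> linear g ->
  (forall v w, f (tens v w) = g (tens v w)) -> f =1 g.
Proof.
move=> lf lg fg; elim/tensor_ind=> [//|s t fs ft].
by rewrite (linD lf) (linD lg) fs ft.
Qed.

Lemma tliftT U V W (f : V -> W -> U) v w :
  bilin f -> tlift f (tens v w) = f v w.
Proof. by case=> f1 f2; exact: tliftE. Qed.

Lemma lin_tlift U V W (f : V -> W -> U) : bilin f -> linear (tlift f).
Proof. by case=> f1 f2; exact: tlift_linear. Qed.

Section Map.
Context {V V' W W' : lmodType K} (f : V -> V') (g : W -> W').
Hypotheses (lf : linear f) (lg : linear g).

Lemma bilin_tmap : bilin (fun v w => tens (f v) (g w)).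
Proof. by split=> v; [exact: lin_tensr | exact: lin_tensl]. Qed.

Lemma tmapT v w : tmap f g (tens v w) = tens (f v) (g w).
Proof. exact/tliftT/bilin_tmap. Qed.

Lemma lin_tmap : linear (tmap f g).
Proof. exact/lin_tlift/bilin_tmap. Qed.

End Map.

Lemma bilin_tswap V W : bilin (fun (v : V) (w : W) => tens w v).
Proof. by split=> v; [exact: tens_linear_l | exact: tens_linear_r]. Qed.

Lemma tswapT V W (v : V) (w : W) : tswap (tens v w) = tens w v.
Proof. exact/tliftT/bilin_tswap. Qed.

Lemma lin_tswap V W : linear (@tswap K V W).
Proof. exact/lin_tlift/bilin_tswap. Qed.

(** Linearity in a parameter of the bilinear map, for the nested [tlift] of [tassoc] and [tmul]. *)
Lemma lin_tlift_param U V V' W (F : V' -> U -> V -> W) :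
  (forall c, bilin (F c)) -> (forall u v, linear (fun c => F c u v)) ->
  forall t, linear (fun c => tlift (F c) t).
Proof.
move=> bF lF t a x y; move: t; apply: tensor_ext.
- exact: lin_tlift.
- by apply: lin_add; [apply: lin_scale|]; exact: lin_tlift.
- by move=> u v; rewrite !tliftT //; exact: lF.
Qed.

Lemma bilin_tassoc_in U V W (w : W) :
  bilin (fun (u : U) (v : V) => tens u (tens v w)).
Proof.
split=> v; last exact: tens_linear_l.
by apply: lin_tensr; exact: tens_linear_l.
Qed.

Lemma bilin_tassoc U V W :
  bilin (fun (t : tensor U V) (w : W) =>
    tlift (fun u v => tens u (tens v w)) t).
Proof.
split=> [t|w]; last exact/lin_tlift/bilin_tassoc_in.
apply: lin_tlift_param => [w|u v]; first exact: bilin_tassoc_in.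
by apply: lin_tensr; exact: tens_linear_r.
Qed.

Lemma tassocT U V W (u : U) (v : V) (w : W) :
  tassoc (tens (tens u v) w) = tens u (tens v w).
Proof.
by rewrite /tassoc tliftT ?tliftT //;
  [exact: bilin_tassoc_in | exact: bilin_tassoc].
Qed.

Lemma lin_tassoc U V W : linear (@tassoc K U V W).
Proof. exact/lin_tlift/bilin_tassoc. Qed.

End LinearClosure.

Section TensorMul.
Context {K : fieldType} {A B : algType K}.
Implicit Types (a : A) (b : B) (s t : tensor A B).

Lemma bilin_tmul_in a b :
  bilin (fun (a' : A) (b' : B) => tens (a * a' : A) (b * b' : B)).
Proof.
by split=> x; [apply/lin_tensr/lin_mull | apply/lin_tensl/lin_mull].
Qed.

Lemma bilin_tmul_out t :
  bilin (fun (a : A) (b : B) => tlift (fun (a' : A) (b' : B) =>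
    tens (a * a' : A) (b * b' : B)) t).
Proof.
split=> x; apply: lin_tlift_param => [y|u v]; try exact: bilin_tmul_in.
  exact/lin_tensr/lin_mulr.
exact/lin_tensl/lin_mulr.
Qed.

Lemma bilin_tmul : bilin (@tmul K A B).
Proof.
split=> s; last exact/lin_tlift/bilin_tmul_out.
apply: lin_tlift_param => [t|a b]; first exact: bilin_tmul_out.
exact/lin_tlift/bilin_tmul_in.
Qed.

Lemma lin_tmulr s : linear (tmul s). Proof. exact: (proj1 bilin_tmul). Qed.

Lemma lin_tmull t : linear (tmul^~ t). Proof. exact: (proj2 bilin_tmul). Qed.

Lemma tmulT a b a' b' :
  tmul (tens a b) (tens a' b') = tens (a * a') (b * b').
Proof.
by rewrite /tmul tliftT ?tliftT //;
  [exact: bilin_tmul_in | exact: bilin_tmul_out].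
Qed.

Lemma tmulA : associative (@tmul K A B).
Proof.
move=> r s t; elim/(@tensor_ind K A B): r => [a b|r r' IH IH']; last first.
  by rewrite !(linD (lin_tmull _)) IH IH'.
elim/(@tensor_ind K A B): s => [a' b'|s s' IH IH']; last first.
  by rewrite (linD (lin_tmull _)) !(linD (lin_tmulr _)) (linD (lin_tmull _)) IH
    IH'.
elim/(@tensor_ind K A B): t => [a'' b''|t t' IH IH']; last first.
  by rewrite !(linD (lin_tmulr _)) IH IH'.
by rewrite !tmulT !mulrA.
Qed.

Lemma tmul1 : left_id (tens (1 : A) (1 : B)) (@tmul K A B).
Proof.
elim/(@tensor_ind K A B)=> [a b|s t IH IH'];
  last by rewrite (linD (lin_tmulr _)) IH IH'.
by rewrite tmulT !mul1r.
Qed.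

Lemma tmulr1 : right_id (tens (1 : A) (1 : B)) (@tmul K A B).
Proof.
elim/(@tensor_ind K A B)=> [a b|s t IH IH'];
  last by rewrite (linD (lin_tmull _)) IH IH'.
by rewrite tmulT !mulr1.
Qed.

Lemma tmulZl c s t : c *: tmul s t = tmul (c *: s) t.
Proof. by rewrite (linZ (lin_tmull _)). Qed.

Lemma tmulZr c s t : c *: tmul s t = tmul s (c *: t).
Proof. by rewrite (linZ (lin_tmulr _)). Qed.

Lemma tmulDl : left_distributive (@tmul K A B) +%R.
Proof. by move=> s s' t; exact: (linD (lin_tmull _)). Qed.

Lemma tmulDr : right_distributive (@tmul K A B) +%R.
Proof. by move=> s t t'; exact: (linD (lin_tmulr _)). Qed.

End TensorMul.

Section HopfSquare.
Context {K : fieldType} {H : hopfData K}.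

Lemma bilin_counit : bilin (fun a b : H => hcounit H a * hcounit H b : K^o).
Proof.
split=> x a u v; first by rewrite linearP mulrDr mulrCA.
by rewrite linearP mulrDl -mulrA.
Qed.

Lemma tens11_neq0 (hH : graded_conn_cocomm_hopf H) :
  tens (1 : H) (1 : H) != 0.
Proof.
apply/eqP => /(congr1 (tlift (fun a b : H => hcounit H a * hcounit H b : K^o))).
rewrite tliftT; last exact: bilin_counit.
rewrite (lin0 (lin_tlift bilin_counit)) (counit_one hH) mulr1.
by move/eqP; rewrite oner_eq0.
Qed.

(* The parameter [hH] provides 1 (x) 1 != 0, which holds for any two algebras
   over a field but is easiest to see with the counit. *)
Definition tensor2 of graded_conn_cocomm_hopf H : Type := tensor H H.
HB.instance Definition _ hH := GRing.Lmodule.copy (tensor2 hH) (tensor H H).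
HB.instance Definition _ hH := GRing.Zmodule_isNzRing.Build (tensor2 hH)
  (@tmulA K H H) (@tmul1 K H H) (@tmulr1 K H H) (@tmulDl K H H) (@tmulDr K H H)
  (tens11_neq0 hH).
HB.instance Definition _ hH :=
  GRing.Lmodule_isLalgebra.Build K (tensor2 hH) (@tmulZl K H H).
HB.instance Definition _ hH :=
  GRing.Lalgebra_isAlgebra.Build K (tensor2 hH) (@tmulZr K H H).

Variable hH : graded_conn_cocomm_hopf H.

Definition cop2 : H -> tensor2 hH := hcop H.
Definition inl2 (x : H) : tensor2 hH := tens x (1 : H).
Definition inr2 (x : H) : tensor2 hH := tens (1 : H) x.

Fact cop2_linear : linear cop2. Proof. exact: linearP. Qed.

Fact cop2_monoid : monoid_morphism cop2.
Proof. by split; [exact: cop_one hH | exact: cop_mul hH]. Qed.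

HB.instance Definition _ := GRing.isLinear.Build K H (tensor2 hH) _ cop2
  cop2_linear.
HB.instance Definition _ := GRing.isMonoidMorphism.Build H (tensor2 hH) cop2
  cop2_monoid.

Fact inl2_linear : linear inl2. Proof. exact: tens_linear_l. Qed.

Fact inl2_monoid : monoid_morphism inl2.
Proof. by split=> // x y; rewrite -[RHS]/(tmul _ _) tmulT mulr1. Qed.

HB.instance Definition _ := GRing.isLinear.Build K H (tensor2 hH) _ inl2
  inl2_linear.
HB.instance Definition _ := GRing.isMonoidMorphism.Build H (tensor2 hH) inl2
  inl2_monoid.

Fact inr2_linear : linear inr2. Proof. exact: tens_linear_r. Qed.

Fact inr2_monoid : monoid_morphism inr2.
Proof. by split=> // x y; rewrite -[RHS]/(tmul _ _) tmulT mulr1. Qed.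

HB.instance Definition _ := GRing.isLinear.Build K H (tensor2 hH) _ inr2
  inr2_linear.
HB.instance Definition _ := GRing.isMonoidMorphism.Build H (tensor2 hH) inr2
  inr2_monoid.

Lemma inlr2M x y : inl2 x * inr2 y = tens x y.
Proof. by rewrite -[LHS]/(tmul _ _) tmulT mulr1 mul1r. Qed.

Lemma comm_inlr2 x y : GRing.comm (inl2 x) (inr2 y).
Proof.
by rewrite /GRing.comm inlr2M -[RHS]/(tmul _ _) tmulT mulr1 mul1r.
Qed.

End HopfSquare.

(** * The convolution algebra *)

Section TliftComp.
Context {K : fieldType}.

Lemma lin_linear (U V : lmodType K) (f : {linear U -> V}) : linear f.
Proof. exact: linearP. Qed.

Lemma bilin_comp (U V V' W W' : lmodType K) (f : V' -> W' -> U)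
    (g : V -> V') (h : W -> W') :
  bilin f -> linear g -> linear h -> bilin (fun v w => f (g v) (h w)).
Proof.
by move=> [f1 f2] lg lh; split=> x; [exact: (lin_comp (f1 _)) |
  exact: (lin_comp (f2 (h x)))].
Qed.

Lemma tlift_tmap (U V V' W W' : lmodType K) (f : V' -> W' -> U)
    (g : V -> V') (h : W -> W') t :
  bilin f -> linear g -> linear h ->
  tlift f (tmap g h t) = tlift (fun v w => f (g v) (h w)) t.
Proof.
move=> bf lg lh; move: t; apply: tensor_ext => [||v w].
- by apply: lin_comp; [exact: lin_tlift | exact: lin_tmap].
- exact/lin_tlift/bilin_comp.
- by rewrite tmapT // !tliftT //; exact: bilin_comp.
Qed.

Lemma lin_of_tlift (U U' V W : lmodType K) (f : V -> W -> U) (g : U -> U') t :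
  linear g -> bilin f -> g (tlift f t) = tlift (fun v w => g (f v w)) t.
Proof.
move=> lg bf; have bgf : bilin (fun v w => g (f v w)).
  by case: bf => b1 b2; split=> x;
    [exact: (lin_comp lg (b1 x)) | exact: (lin_comp lg (b2 x))].
move: t; apply: tensor_ext => [||v w].
- by apply: lin_comp => //; exact: lin_tlift.
- exact: lin_tlift.
- by rewrite !tliftT.
Qed.

Lemma bilin_mul (V W : lmodType K) (A : algType K) (f : V -> A) (g : W -> A) :
  linear f -> linear g -> bilin (fun v w => f v * g w).
Proof. by move=> lf lg; split=> x; [exact: lin_mull | exact: lin_mulr]. Qed.

Lemma tlift_add (U V W : lmodType K) (f g : V -> W -> U) t :
  bilin f -> bilin g ->
  tlift (fun v w => f v w + g v w) t = tlift f t + tlift g t.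
Proof.
move=> bf bg; move: t; apply: tensor_ext => [||v w].
- by apply: lin_tlift; case: bf bg => ? ? [? ?]; split=> x; apply: lin_add.
- by apply: lin_add; exact: lin_tlift.
- by rewrite !tliftT //; case: bf bg => ? ? [? ?]; split=> x; apply: lin_add.
Qed.

Lemma tlift_scale (U V W : lmodType K) (f : V -> W -> U) (a : K) t :
  bilin f -> tlift (fun v w => a *: f v w) t = a *: tlift f t.
Proof.
by move=> bf; rewrite (lin_of_tlift _ (lin_scale a (@lin_id _ _)) bf).
Qed.

End TliftComp.

Section Convolution.
Context {K : fieldType} {H : hopfData K}.

Definition convol {A : algType K} (f g : H -> A) : H -> A :=
  fun x => tlift (fun a b : H => f a * g b) (hcop H x).
Definition convol1 {A : algType K} : H -> A := fun x => (hcounit H x)%:A.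

Section Target.
Context {A : algType K}.
Implicit Types f g h : H -> A.

Lemma lin_convol f g : linear f -> linear g -> linear (convol f g).
Proof.
move=> lf lg; apply: lin_comp (lin_linear _).
exact/lin_tlift/bilin_mul.
Qed.

Lemma lin_convol1 : linear (@convol1 A).
Proof. exact/lin_scalel/linearP. Qed.

Hypothesis hH : graded_conn_cocomm_hopf H.

Lemma convolA f g h : linear f -> linear g -> linear h ->
  convol f (convol g h) = convol (convol f g) h.
Proof.
move=> lf lg lh; apply/funext => x.
(* [M2] and [M1] multiply the three values along the two bracketings of a triple tensor; they agree
   through [tassoc] because [A] is associative, and coassociativity does the rest. *)
pose M2 (t : tensor H (tensor H H)) :=
  tlift (fun a s => f a * tlift (fun b c => g b * h c) s) t.
pose M1 (t : tensor (tensor H H) H) :=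
  tlift (fun s c => tlift (fun a b => f a * g b) s * h c) t.
have lgh : linear (tlift (fun b c : H => g b * h c)).
  exact/lin_tlift/bilin_mul.
have lfg : linear (tlift (fun b c : H => f b * g c)).
  exact/lin_tlift/bilin_mul.
have lM2 : linear M2 by exact/lin_tlift/bilin_mul.
have lM1 : linear M1 by exact/lin_tlift/bilin_mul.
have -> : convol f (convol g h) x = M2 (tmap id (hcop H) (hcop H x)).
  by rewrite /M2 tlift_tmap //; [exact: bilin_mul | exact: lin_linear].
have -> : convol (convol f g) h x = M1 (tmap (hcop H) id (hcop H x)).
  by rewrite /M1 tlift_tmap //; [exact: bilin_mul | exact: lin_linear].
rewrite -(cop_assoc hH); move: (tmap _ _ _); apply: tensor_ext => //.
  exact: (lin_comp lM2 (@lin_tassoc _ _ _ _)).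
move=> s c; move: s; apply: tensor_ext => [||a b].
- apply: (lin_comp lM2); apply: (lin_comp (@lin_tassoc _ _ _ _)).
  exact: tens_linear_l.
- by apply: (lin_comp lM1); exact: tens_linear_l.
- rewrite tassocT /M2 /M1 !tliftT ?mulrA //; exact: bilin_mul.
Qed.

Lemma convol1l f : linear f -> convol convol1 f = f.
Proof.
move=> lf; apply/funext => x; rewrite -[RHS](congr1 f (cop_counit_l hH x)).
rewrite lin_of_tlift //; last first.
  by split=> y; [exact: lin_scale | exact/lin_scalel/linearP].
congr (tlift _ _); apply/funext => a; apply/funext => b.
by rewrite mulr_algl (linZ lf).
Qed.

Lemma convol1r f : linear f -> convol f convol1 = f.
Proof.
move=> lf; apply/funext => x; rewrite -[RHS](congr1 f (cop_counit_r hH x)).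
rewrite lin_of_tlift //; last first.
  by split=> y; [exact/lin_scalel/linearP | exact: lin_scale].
congr (tlift _ _); apply/funext => a; apply/funext => b.
by rewrite mulr_algr (linZ lf).
Qed.

Lemma convol_proj f g n x : linear f -> linear g ->
  convol f g (hproj H n x) =
  \sum_(i < n.+1) convol (f \o hproj H i) (g \o hproj H (n - i)) x.
Proof.
move=> lf lg; have bfg := bilin_mul lf lg.
rewrite /convol (cop_graded hH) (lin_sum (lin_tlift bfg)).
by apply: eq_bigr => i _; rewrite tlift_tmap //; exact: lin_linear.
Qed.

Lemma convolDl f g h : linear f -> linear g -> linear h ->
  convol (f + g) h = convol f h + convol g h.
Proof.
move=> lf lg lh; apply/funext => x.
rewrite -[RHS]/(convol f h x + convol g h x) /convol -tlift_add;
  try exact: bilin_mul.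
by congr (tlift _ _); apply/funext => a; apply/funext => b; exact: mulrDl.
Qed.

Lemma convolDr f g h : linear f -> linear g -> linear h ->
  convol f (g + h) = convol f g + convol f h.
Proof.
move=> lf lg lh; apply/funext => x.
rewrite -[RHS]/(convol f g x + convol f h x) /convol -tlift_add;
  try exact: bilin_mul.
by congr (tlift _ _); apply/funext => a; apply/funext => b; exact: mulrDr.
Qed.

Lemma convolZl (c : K) f g : linear f -> linear g ->
  convol (c *: f) g = c *: convol f g.
Proof.
move=> lf lg; apply/funext => x.
rewrite -[RHS]/(c *: convol f g x) /convol -tlift_scale; last exact: bilin_mul.
congr (tlift _ _); apply/funext => a; apply/funext => b.
exact/esym/scalerAl.
Qed.

Lemma convolZr (c : K) f g : linear f -> linear g ->
  convol f (c *: g) = c *: convol f g.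
Proof.
move=> lf lg; apply/funext => x.
rewrite -[RHS]/(c *: convol f g x) /convol -tlift_scale; last exact: bilin_mul.
congr (tlift _ _); apply/funext => a; apply/funext => b.
exact/esym/scalerAr.
Qed.

(** Cocommutativity enters here: swapping the tensor factors of the coproduct exchanges f and g. It
    makes the two images of the convolution algebra of H in Hom(H, H (x) H) commute, as the theory
    of Log requires. *)
Lemma convol_comm f g : linear f -> linear g ->
  (forall x y, GRing.comm (f x) (g y)) -> convol f g = convol g f.
Proof.
move=> lf lg fg; apply/funext => x; rewrite /convol -{1}(cop_comm hH).
move: (hcop H x); apply: tensor_ext => [||a b].
- apply: lin_comp (@lin_tswap _ _ _); exact/lin_tlift/bilin_mul.
- exact/lin_tlift/bilin_mul.
- by rewrite tswapT !tliftT; [exact: fg | exact: bilin_mul | exact: bilin_mul].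
Qed.

End Target.

Section HomAlgebra.
Context (hH : graded_conn_cocomm_hopf H) (A : algType K).

Definition linear_pred : {pred H -> A} := fun f => `[< linear f >].

Fact linear_pred_submod : submod_closed linear_pred.
Proof.
split; first exact/asboolP/lin_cst0.
move=> a f g /asboolP lf /asboolP lg; apply/asboolP.
exact: (lin_add (lin_scale a lf) lg).
Qed.

HB.instance Definition _ :=
  GRing.isSubmodClosed.Build K (H -> A) linear_pred linear_pred_submod.

(* The parameter [hH] makes the convolution product on linear maps
   associative. *)
Record convHom (hH' : graded_conn_cocomm_hopf H) := ConvHom {
  hom_fun :> H -> A;
  _ : hom_fun \in linear_pred
}.
Local Notation hom := (convHom hH).
HB.instance Definition _ := [isSub of hom for (@hom_fun hH)].
HB.instance Definition _ := [Choice of hom by <:].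
HB.instance Definition _ := [SubChoice_isSubLmodule of hom by <:].

Lemma lin_hom (f : hom) : linear f. Proof. by case: f => f p; apply/asboolP;
  exact: p. Qed.

Definition mkhom (f : H -> A) (lf : linear f) : hom :=
  ConvHom hH (introT (asboolP _) lf).

Lemma homP (f g : hom) : f =1 g -> f = g.
Proof. by move=> /funext fg; exact: val_inj. Qed.

Definition hom_mul (f g : hom) : hom :=
  mkhom (lin_convol (lin_hom f) (lin_hom g)).
Definition hom_one : hom := mkhom lin_convol1.

Fact hom_mulA : associative hom_mul.
Proof. by move=> f g h; apply: val_inj; apply: convolA => //;
  exact: lin_hom. Qed.

Fact hom_mul1 : left_id hom_one hom_mul.
Proof. by move=> f; apply: val_inj; apply: convol1l => //; exact: lin_hom. Qed.

Fact hom_mulr1 : right_id hom_one hom_mul.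
Proof. by move=> f; apply: val_inj; apply: convol1r => //; exact: lin_hom. Qed.

Fact hom_mulDl : left_distributive hom_mul +%R.
Proof. by move=> f g h; apply: val_inj; apply: convolDl => //;
  exact: lin_hom. Qed.

Fact hom_mulDr : right_distributive hom_mul +%R.
Proof. by move=> f g h; apply: val_inj; apply: convolDr => //;
  exact: lin_hom. Qed.

Fact hom_one_neq0 : hom_one != 0.
Proof.
apply/eqP => /(congr1 (fun f : hom => f 1)) /eqP.
by rewrite /= /convol1 (counit_one hH) scale1r oner_eq0.
Qed.

HB.instance Definition _ := GRing.Zmodule_isNzRing.Build hom
  hom_mulA hom_mul1 hom_mulr1 hom_mulDl hom_mulDr hom_one_neq0.
Fact hom_scaleAl (c : K) (f g : hom) : c *: (f * g) = (c *: f) * g.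
Proof. by apply: val_inj; apply/esym/convolZl; exact: lin_hom. Qed.

HB.instance Definition _ := GRing.Lmodule_isLalgebra.Build K hom hom_scaleAl.
Fact hom_scaleAr (c : K) (f g : hom) : c *: (f * g) = f * (c *: g).
Proof. by apply: val_inj; apply/esym/convolZr; exact: lin_hom. Qed.

HB.instance Definition _ := GRing.Lalgebra_isAlgebra.Build K hom hom_scaleAr.

Lemma homM (f g : hom) x : (f * g) x = convol f g x. Proof. by []. Qed.

Lemma hom1 x : (1 : hom) x = (hcounit H x)%:A. Proof. by []. Qed.

Lemma hom_sum I (r : seq I) (P : pred I) (F : I -> hom) x :
  (\sum_(i <- r | P i) F i) x = \sum_(i <- r | P i) F i x.
Proof. by elim/big_rec2: _ => // i u v _ <-. Qed.
End HomAlgebra.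
End Convolution.

Section FiniteSupportSums.
Local Open Scope classical_set_scope.

Lemma fsum_setT (V : zmodType) (F : nat -> V) N :
  (forall k, (N <= k)%N -> F k = 0) ->
  \sum_(k \in [set: nat]) F k = \sum_(k < N) F k.
Proof.
move=> F0; rewrite (@fsbigE _ _ _ _ _ (iota 0 N)) ?iota_uniq //.
  rewrite -(big_mkord xpredT) /index_iota subn0.
  by apply: eq_bigl => i; rewrite in_setT.
by move=> k _; rewrite mem_iota /= add0n -leqNgt => /F0.
Qed.

Lemma fsum_pos (V : zmodType) (F : nat -> V) N : F 0%N = 0 ->
  (forall k, (N <= k)%N -> F k = 0) ->
  \sum_(k \in [set k | (0 < k)%N]) F k = \sum_(k < N) F k.
Proof.
move=> F00 F0; rewrite -(fsum_setT F0); apply: fsbig_widen => // -[|k] //=.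
by case.
Qed.

End FiniteSupportSums.

(** * The logarithm of the identity in the convolution algebra *)

Section LogIdentity.
Context {K : fieldType}.
Hypothesis charK : [pchar K] =i pred0.
Context {H : hopfData K} (hH : graded_conn_cocomm_hopf H).

Section Post.
Context {A B : algType K} (phi : {lrmorphism A -> B}).

Fact post_proof (f : convHom A hH) : linear (fun x => phi (f x)).
Proof. exact: (lin_comp (lin_linear phi) (lin_hom f)). Qed.

Definition post (f : convHom A hH) : convHom B hH := mkhom hH (post_proof f).

Fact post_linear : linear post.
Proof.
by move=> a f g; apply: homP => x; exact: linearP.
Qed.

Fact post_monoid : monoid_morphism post.
Proof.
split=> [|f g]; apply: homP => x.
  by rewrite -[LHS]/(phi _) !hom1; exact: rmorph_alg.
rewrite -[LHS]/(phi (convol f g x)) /convol lin_of_tlift.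
- rewrite homM /convol; congr (tlift _ _).
  by apply/funext => a; apply/funext => b; exact: rmorphM.
- exact: lin_linear.
- by apply: bilin_mul; exact: lin_hom.
Qed.

HB.instance Definition _ := GRing.isLinear.Build K _ _ _ post post_linear.
HB.instance Definition _ := GRing.isMonoidMorphism.Build _ _ post post_monoid.

End Post.

Lemma proj_eventually x : exists N, forall n, (N <= n)%N -> hproj H n x = 0.
Proof.
have /finite_seqP[s hs] := proj_finite hH x.
exists (\max_(i <- s) i).+1 => n nN; apply/eqP/negP => /negP px.
have : [set` s]%classic n by rewrite -hs.
by move=> /= ns; move: nN; rewrite ltnNge leq_bigmax_seq.
Qed.

Lemma counit_alg (c : K) : hcounit H c%:A = c.
Proof. by rewrite linearZ /= (counit_one hH) -[LHS]/(_ * 1) mulr1. Qed.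

(** Connectedness makes the degree 0 component a scalar, and the counit, which vanishes in positive
    degrees, reads off this scalar. Thus p_0 is the unit of convolution. *)
Lemma proj0E x : hproj H 0%N x = (hcounit H x)%:A.
Proof.
have [c hc] := proj_connected hH x.
suff -> : hcounit H x = c by [].
have -> : hcounit H x = hcounit H (hproj H 0%N x).
  have [N hN] := proj_eventually x.
  rewrite {1}(proj_sum hH x) (@fsum_setT _ _ N.+1) => [|k /ltnW /hN //].
  rewrite linear_sum big_ord_recl /= big1 ?addr0 // => i _.
  exact: (counit_graded hH).
by rewrite hc counit_alg.
Qed.

(** The identity of H cut into its homogeneous components; the components of its [Log] are the
    Eulerian idempotents. *)
Definition projs : ser (convHom H hH) := fun n => mkhom hH (lin_linear (hproj H
  n)).

Lemma projs_glike :
  glike (post (cop2 hH)) (post (inl2 hH)) (post (inr2 hH)) projs.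
Proof.
split; first by apply: homP => x; exact: proj0E.
apply/funext => n; apply: homP => x.
rewrite -[LHS]/(hcop H (hproj H n x)) (cop_graded hH) serM.
have hs I (r : seq I) (P : pred I) (F : I -> convHom (tensor2 hH) hH) y :
    (\sum_(i <- r | P i) F i) y = \sum_(i <- r | P i) F i y.
  by elim/big_rec2: _ => // i u v _ <-.
rewrite hom_sum; apply: eq_bigr => i _; rewrite homM /convol /tmap.
congr (tlift _ _); apply/funext => a; apply/funext => b.
by rewrite -[RHS]/(inl2 hH _ * inr2 hH _) inlr2M.
Qed.

Lemma post_comm (f g : convHom H hH) :
  GRing.comm (post (inl2 hH) f) (post (inr2 hH) g).
Proof.
apply: val_inj; apply: convol_comm; [exact: hH | exact: lin_hom | exact: lin_hom
  |].
by move=> x y; exact: comm_inlr2.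
Qed.

Lemma Log_projs_prim n x :
  hcop H (Log projs n x) =
  tens (Log projs n x) (1 : H) + tens (1 : H) (Log projs n x).
Proof.
have [_] := prim_Log charK post_comm projs_glike.
by move=> /(congr1 (@^~ n)) /(congr1 (fun f : convHom _ hH => f x)).
Qed.

Lemma lin_convX (f : H -> H) k : linear f -> linear (convX f k).
Proof.
move=> lf; elim: k => [|k IH]; first exact: lin_convol1.
exact: (lin_convol lf IH).
Qed.

Lemma lin_sub_conv1 : linear (fun y : H => y - conv1 H y).
Proof. by apply: lin_add => //; apply: lin_opp; exact: lin_convol1. Qed.

(** Translates convolution powers of Id minus the unit into powers of a series without constant
    term. The latter have order at least k, which makes the sum defining [conv_log_id] finite in
    each degree. *)
Lemma convX_projs k n x :
  convX (fun y : H => y - conv1 H y) k (hproj H n x) = ((projs - 1) ^+ k) n x.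
Proof.
elim: k n x => [|k IH] n x.
  rewrite expr0 ser1 /= /conv1; case: n => [|n].
    by rewrite proj0E counit_alg.
  by rewrite (counit_graded hH) // scale0r.
rewrite exprS serM -[LHS]/(convol _ _ _) (convol_proj hH); last first.
  exact/lin_convX/lin_sub_conv1.
  exact: lin_sub_conv1.
have hs I (r : seq I) (P : pred I) (F : I -> convHom H hH) y :
    (\sum_(i <- r | P i) F i) y = \sum_(i <- r | P i) F i y.
  by elim/big_rec2: _ => // i u v _ <-.
rewrite hom_sum; apply: eq_bigr => i _; rewrite homM.
congr (convol _ _ x); apply/funext => y; last exact: IH.
rewrite [LHS]/= -[RHS]/(hproj H i y - (1 : ser (convHom H hH)) i y) ser1 /conv1.
case: (nat_of_ord i) => [|j].
  by rewrite proj0E counit_alg.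
by rewrite (counit_graded hH) // scale0r.
Qed.

Lemma conv_log_idE n x : conv_log_id H (hproj H n x) = Log projs n x.
Proof.
have p0 : (projs - 1) 0%N = 0.
  by rewrite serB (proj1 projs_glike) subrr.
rewrite /conv_log_id (@fsum_pos _ _ n.+1).
- rewrite /Log (scompE _ p0 (ltnSn n)).
  rewrite hom_sum; apply: eq_bigr => -[k /= _] _; rewrite convX_projs.
  rewrite -[RHS]/(logc k *: ((projs - 1) ^+ k) n x) /logc.
  by case: k => [|k] //=; rewrite invr0 mulr0.
- by rewrite invr0 mulr0 scale0r.
- by move=> k nk; rewrite convX_projs ord_geX // scaler0.
Qed.

Lemma conv_log_id_prim n x : let y := conv_log_id H (hproj H n x) in
  hcop H y = tens y (1 : H) + tens (1 : H) y.
Proof. by rewrite /= conv_log_idE Log_projs_prim. Qed.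

End LogIdentity.

(** * The tensor algebra *)

Section GradedTensor.
Context {K : fieldType} {A : algType K} (p : nat -> A -> A) (x : A).
Hypothesis lp : forall n, linear (p n).
Hypothesis px : forall n a, p n (x * a) = if n is m.+1 then x * p m a else 0.

(** Projection onto total degree n. Multiplication by x (x) 1 + 1 (x) x raises the total degree by
    one, so compatibility of the coproduct with the grading follows by induction on words. *)
Definition graded_tmap n (t : tensor A A) : tensor A A :=
  \sum_(i < n.+1) tmap (p i) (p (n - i)%N) t.

Lemma lin_graded_tmap n : linear (graded_tmap n).
Proof. by apply: lin_bigsum => i; exact: lin_tmap. Qed.

Lemma graded_tmapT n a b :
  graded_tmap n (tens a b) = \sum_(i < n.+1) tens (p i a) (p (n - i)%N b).
Proof. by apply: eq_bigr => i _; exact: tmapT. Qed.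

(* The coproduct of [y] when [y] is primitive. *)
Definition coprod (y : A) : tensor A A := tens y 1 + tens 1 y.

Lemma coprod_mulT y a b :
  tmul (coprod y) (tens a b) = tens (y * a) b + tens a (y * b).
Proof. by rewrite tmulDl !tmulT !mul1r. Qed.

Lemma graded_tmap_coprod n t : graded_tmap n (tmul (coprod x) t) =
  if n is m.+1 then tmul (coprod x) (graded_tmap m t) else 0.
Proof.
move: t; apply: tensor_ext => [||a b].
- exact: (lin_comp (lin_graded_tmap n) (lin_tmulr _)).
- case: n => [|n]; first exact: lin_cst0.
  exact: (lin_comp (lin_tmulr _) (lin_graded_tmap n)).
rewrite coprod_mulT (linD (lin_graded_tmap n)) !graded_tmapT.
case: n => [|n].
  rewrite !big_ord1 !px (lin0 (tens_linear_r _)) (lin0 (tens_linear_l _)).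
  by rewrite addr0.
rewrite graded_tmapT (lin_sum (lin_tmulr _)).
rewrite [RHS](eq_bigr (fun i : 'I_n.+1 => tens (x * p i a) (p (n - i)%N b) +
  tens (p i a) (x * p (n - i)%N b))); last by move=> i _; exact: coprod_mulT.
rewrite [RHS]big_split; congr (_ + _).
  rewrite big_ord_recl px (lin0 (tens_linear_l _)) add0r.
  by apply: eq_bigr => i _; rewrite px.
rewrite big_ord_recr /= subnn px (lin0 (tens_linear_r _)) addr0.
by apply: eq_bigr => i _; rewrite subSn ?px // -ltnS.
Qed.

End GradedTensor.

Section FreeAlgebra.
Context {K : fieldType} {X : choiceType}.
Local Notation T := (tensor_alg K X).
Implicit Types (x : X) (w : seq X) (a b u v : T).

Definition tletter x : T := letter K x.
Definition tword w : T := word K w.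

Lemma mulUU (k l : {fmonom X}) :
  (<< k >> : free_alg K X) * << l >> = << FMonom (k ++ l) >>.
Proof.
rewrite -[LHS]/((<< k >> : {malg K[{fmonom X}]}) * << l >>).
by rewrite malgM_def fgmulUU mulr1 -fmmulE.
Qed.

Lemma wordE w : word K w = << FMonom w >>.
Proof.
elim: w => [|x w IH]; first by rewrite /word big_nil -fmoneE.
by rewrite /word big_cons -/(word K w) IH /letter fmuE mulUU.
Qed.

Lemma wordU (k : {fmonom X}) : << k >> = tword k.
Proof. by rewrite /tword wordE; case: k. Qed.

Lemma word_nil : tword [::] = 1. Proof. by rewrite /tword /word big_nil. Qed.

Lemma word_cons x w : tword (x :: w) = tletter x * tword w.
Proof. by rewrite /tword /word big_cons. Qed.

Lemma word_cat w w' : tword (w ++ w') = tword w * tword w'.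
Proof. by rewrite /tword /word big_cat. Qed.

Lemma word_seq1 x : tword [:: x] = tletter x.
Proof. by rewrite word_cons word_nil mulr1. Qed.

Lemma word_rcons w x : tword (rcons w x) = tword w * tletter x.
Proof. by rewrite -cats1 word_cat word_seq1. Qed.

Lemma word_ext (V : lmodType K) (f g : T -> V) : linear f -> linear g ->
  (forall w, f (tword w) = g (tword w)) -> f =1 g.
Proof.
by move=> lf lg fg; apply: malg_ext => // k; rewrite wordU.
Qed.

Lemma proj_word n w :
  hproj T n (tword w) = if size w == n then tword w else 0.
Proof. by rewrite /tword wordE; exact: mliftU. Qed.

Lemma cop_word w : hcop T (tword w) = word_cop K w.
Proof. by rewrite /tword wordE; exact: mliftU. Qed.

Lemma counit_word w : hcounit T (tword w) = (size w == 0%N)%:R.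
Proof. by rewrite /tword wordE; exact: mliftU. Qed.

Lemma anti_word w : hanti T (tword w) = (-1) ^+ size w *: tword (rev w).
Proof. by rewrite /tword wordE; exact: mliftU. Qed.

Definition dl x (t : tensor T T) : tensor T T := tmul (coprod (tletter x)) t.

Lemma dlT x a b :
  dl x (tens a b) = tens (tletter x * a) b + tens a (tletter x * b).
Proof. exact: coprod_mulT. Qed.

Lemma lin_dl x : linear (dl x). Proof. exact: lin_tmulr. Qed.

Lemma cop_cons x w : hcop T (tword (x :: w)) = dl x (hcop T (tword w)).
Proof. by rewrite !cop_word. Qed.

Lemma cop_nil : hcop T (tword [::]) = tens (1 : T) (1 : T).
Proof. by rewrite cop_word. Qed.

Lemma T_cop_mul u v : hcop T (u * v) = tmul (hcop T u) (hcop T v).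
Proof.
move: u; apply: word_ext => [||w].
- exact: (lin_comp (lin_linear (hcop T)) (lin_mulr v (@lin_id _ _))).
- exact: (lin_comp (lin_tmull _) (lin_linear (hcop T))).
move: v; apply: word_ext => [||w'].
- exact: (lin_comp (lin_linear (hcop T)) (lin_mull (tword w) (@lin_id _ _))).
- exact: (lin_comp (lin_tmulr _) (lin_linear (hcop T))).
elim: w => [|x w IH]; first by rewrite cop_nil tmul1 word_nil mul1r.
by rewrite cop_cons word_cons -mulrA -word_cat -word_cons cop_cons word_cat IH
  /dl tmulA.
Qed.

Lemma cop_letterE x : hcop T (tletter x) = coprod (tletter x).
Proof. by rewrite -word_seq1 cop_cons cop_nil dlT !mulr1 word_seq1. Qed.

Lemma counit_lmul x a : hcounit T (tletter x * a) = 0.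
Proof.
move: a; apply: word_ext => [||w]; last by rewrite -word_cons counit_word.
  exact: (lin_comp (lin_linear (hcounit T)) (lin_mull _ (@lin_id _ _))).
exact: lin_cst0.
Qed.

Lemma anti_lmul x a : hanti T (tletter x * a) = - (hanti T a * tletter x).
Proof.
move: a; apply: word_ext => [||w].
- exact: (lin_comp (lin_linear (hanti T)) (lin_mull _ (@lin_id _ _))).
- exact: (lin_opp (lin_mulr _ (lin_linear (hanti T)))).
rewrite -word_cons !anti_word rev_cons word_rcons -scalerAl -scaleNr /=.
by rewrite exprS mulN1r.
Qed.

Lemma anti_rmul x a : hanti T (a * tletter x) = - (tletter x * hanti T a).
Proof.
move: a; apply: word_ext => [||w].
- exact: (lin_comp (lin_linear (hanti T)) (lin_mulr _ (@lin_id _ _))).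
- exact: (lin_opp (lin_mull _ (lin_linear (hanti T)))).
rewrite -word_rcons !anti_word rev_rcons word_cons -scalerAr -scaleNr
  size_rcons.
by rewrite exprS mulN1r.
Qed.

Lemma proj_lmul x n a : hproj T n (tletter x * a) =
  if n is m.+1 then tletter x * hproj T m a else 0.
Proof.
move: a; apply: word_ext => [||w].
- exact: (lin_comp (lin_linear (hproj T n)) (lin_mull _ (@lin_id _ _))).
- case: n => [|n]; first exact: lin_cst0.
  exact: (lin_mull _ (lin_linear (hproj T n))).
rewrite -word_cons proj_word; case: n => // n; rewrite eqSS proj_word word_cons.
by case: ifP => //; rewrite mulr0.
Qed.

Lemma T_cop_assoc a :
  tassoc (tmap (hcop T) id (hcop T a)) = tmap id (hcop T) (hcop T a).
Proof.
pose L (t : tensor T T) := tassoc (tmap (hcop T) (@id T) t).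
pose R (t : tensor T T) := tmap (@id T) (hcop T) t.
have lc : linear (hcop T) by exact: lin_linear.
have lL : linear L by exact: (lin_comp (@lin_tassoc _ _ _ _) (lin_tmap lc
  (@lin_id _ _))).
have lR : linear R by exact: (lin_tmap (@lin_id _ _) lc).
pose M x := @GRing.mul T (tletter x).
have lM x : linear (M x) by exact/lin_mull/lin_id.
(* [D x] is multiplication by x (x) 1 (x) 1 + 1 (x) x (x) 1 + 1 (x) 1 (x) x. Both iterated
   coproducts turn left multiplication by the letter x into [D x], so they agree by induction on
   words. *)
pose D x (t : tensor T (tensor T T)) := tmap (M x) id t + tmap id (dl x) t.
have lD x : linear (D x).
  by apply: lin_add; apply: lin_tmap => //; exact: lin_dl.
have copM x b : hcop T (M x b) = dl x (hcop T b).
  by rewrite /M T_cop_mul cop_letterE.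
have LD x t : L (dl x t) = D x (L t).
  move: t; apply: tensor_ext => [||b c].
  - exact: (lin_comp lL (@lin_dl x)).
  - exact: (lin_comp (@lD x) lL).
  rewrite dlT (linD lL) /L !tmapT // -/(M x b) copM.
  move: (hcop T b); apply: tensor_ext => [||d e].
  - apply: lin_add; last by apply: lin_comp (@lin_tassoc _ _ _ _) _;
      exact: tens_linear_l.
    apply: (lin_comp (@lin_tassoc _ _ _ _)).
    by apply: lin_tensl; exact: lin_dl.
  - apply: (lin_comp (@lD x)); apply: (lin_comp (@lin_tassoc _ _ _ _)).
    exact: tens_linear_l.
  rewrite dlT (linD (tens_linear_l _)) (linD (@lin_tassoc _ _ _ _)) !tassocT.
  rewrite /D !tmapT //; try exact: lin_dl.
  by rewrite dlT (linD (tens_linear_r _)) -addrA.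
have RD x t : R (dl x t) = D x (R t).
  move: t; apply: tensor_ext => [||b c].
  - exact: (lin_comp lR (@lin_dl x)).
  - exact: (lin_comp (@lD x) lR).
  rewrite dlT (linD lR) /R !tmapT // -/(M x c) copM /D !tmapT //; exact: lin_dl.
rewrite -/(L (hcop T a)) -/(R (hcop T a)); move: a; apply: word_ext => [||w].
- exact: (lin_comp lL lc).
- exact: (lin_comp lR lc).
elim: w => [|x w IH]; last by rewrite cop_cons LD RD IH.
rewrite cop_nil /L /R !tmapT //.
by rewrite -word_nil cop_nil tassocT word_nil.
Qed.

Lemma T_cop_comm a : tswap (hcop T a) = hcop T a.
Proof.
move: a; apply: word_ext => [||w].
- exact: (lin_comp (@lin_tswap _ _ _) (lin_linear (hcop T))).
- exact: lin_linear.
elim: w => [|x w IH]; first by rewrite cop_nil tswapT.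
rewrite cop_cons -{2}IH; move: (hcop T _); apply: tensor_ext => [||b c].
- exact: (lin_comp (@lin_tswap _ _ _) (@lin_dl x)).
- exact: (lin_comp (@lin_dl x) (@lin_tswap _ _ _)).
by rewrite dlT (linD (@lin_tswap _ _ _)) !tswapT dlT addrC.
Qed.

Lemma T_cop_graded n a : hcop T (hproj T n a) =
  \sum_(i < n.+1) tmap (hproj T i) (hproj T (n - i)%N) (hcop T a).
Proof.
have lp m : linear (hproj T m) by exact: lin_linear.
rewrite -/(graded_tmap (hproj T) n (hcop T a)); move: a;
  apply: word_ext => [||w].
- exact: (lin_comp (lin_linear (hcop T)) (lp n)).
- exact: (lin_comp (lin_graded_tmap lp n) (lin_linear (hcop T))).
elim: w n => [|x w IH] n; last first.
  rewrite cop_cons (graded_tmap_coprod lp (@proj_lmul x)) word_cons proj_lmul.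
  case: n => [|n]; first exact: linear0.
  by rewrite T_cop_mul cop_letterE IH.
rewrite cop_nil proj_word (graded_tmapT lp).
rewrite (eq_bigr (fun i : 'I_n.+1 =>
  tens (if 0%N == i then tword [::] else 0 : T)
    (if 0%N == (n - i)%N then tword [::] else 0 : T))); last first.
  by move=> i _; rewrite -word_nil !proj_word.
case: n => [|n]; first by rewrite big_ord1 cop_nil word_nil.
rewrite big1 => [|[[|i] /= _] _]; first exact: linear0.
  exact: (lin0 (tens_linear_r _)).
exact: (lin0 (tens_linear_l _)).
Qed.

Lemma T_cop_counit_l a :
  tlift (fun b c : T => hcounit T b *: c : T) (hcop T a) = a.
Proof.
have bf : bilin (fun b c : T => hcounit T b *: c : T).
  by split=> y; [exact: lin_scale | exact/lin_scalel/linearP].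
move: a; apply: word_ext => [||w]; last 1 first.
  elim: w => [|x w IH]; first by rewrite cop_nil tliftT // -word_nil counit_word
    scale1r.
  rewrite cop_cons word_cons -{2}IH; move: (hcop T _).
  apply: tensor_ext => [||b c].
  - exact: (lin_comp (lin_tlift bf) (@lin_dl x)).
  - exact: (lin_mull _ (lin_tlift bf)).
  rewrite dlT (linD (lin_tlift bf)) !tliftT // counit_lmul scale0r add0r.
  by rewrite scalerAr.
- exact: (lin_comp (lin_tlift bf) (lin_linear (hcop T))).
- exact: lin_id.
Qed.

Lemma T_cop_counit_r a :
  tlift (fun b c : T => hcounit T c *: b : T) (hcop T a) = a.
Proof.
have bf : bilin (fun b c : T => hcounit T b *: c : T).
  by split=> y; [exact: lin_scale | exact/lin_scalel/linearP].
have bf' : bilin (fun b c : T => hcounit T c *: b : T) 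
  by case: bf => f1 f2; split=> y; [exact: f2 | exact: f1].
rewrite -[RHS]T_cop_counit_l -{2}T_cop_comm; move: (hcop T a).
apply: tensor_ext => [||b c]; first exact: lin_tlift.
  exact: (lin_comp (lin_tlift bf) (@lin_tswap _ _ _)).
by rewrite tswapT !tliftT.
Qed.

(** With x the first letter, each pure tensor b (x) c in the coproduct of the rest of the word
    contributes S(x b) c + S(b) x c, which is 0 since S(x b) = - S(b) x. *)
Lemma T_anti_l : conv (hanti T) id = conv1 T.
Proof.
have bf : bilin (fun b c : T => hanti T b * c) by apply: bilin_mul => //;
  exact: lin_linear.
apply/funext; apply: word_ext => [||[|x w]].
- exact: (lin_comp (lin_tlift bf) (lin_linear (hcop T))).
- exact: lin_convol1.
- by rewrite /conv /conv1 cop_nil tliftT // -word_nil anti_word counit_word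
    !scale1r word_nil mulr1.
rewrite /conv /conv1 counit_word scale0r cop_cons; move: (hcop T _).
apply: tensor_ext => [||b c].
- exact: (lin_comp (lin_tlift bf) (@lin_dl x)).
- exact: lin_cst0.
by rewrite dlT (linD (lin_tlift bf)) !tliftT // anti_lmul mulNr mulrA addNr.
Qed.

Definition dr x (t : tensor T T) := tmul t (coprod (tletter x)).
Lemma drT x a b : dr x (tens a b) = tens (a * tletter x) b + tens a (b * tletter
  x).
Proof. by rewrite /dr tmulDr !tmulT !mulr1. Qed.

Lemma lin_dr x : linear (dr x). Proof. exact: lin_tmull. Qed.

Lemma cop_rcons x w : hcop T (tword (rcons w x)) = dr x (hcop T (tword w)).
Proof. by rewrite word_rcons T_cop_mul cop_letterE. Qed.

(** For id * S the cancellation takes place next to the last letter, since S(c x) = - x S(c): words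
    are therefore peeled from the right. *)
Lemma T_anti_r : conv id (hanti T) = conv1 T.
Proof.
have bf : bilin (fun b c : T => b * hanti T c) by apply: bilin_mul => //;
  exact: lin_linear.
apply/funext; apply: word_ext => [||w].
- exact: (lin_comp (lin_tlift bf) (lin_linear (hcop T))).
- exact: lin_convol1.
case/lastP: w => [|w x].
  by rewrite /conv /conv1 cop_nil tliftT // -word_nil anti_word counit_word
    !scale1r word_nil mulr1.
rewrite /conv /conv1 counit_word size_rcons scale0r cop_rcons; move: (hcop T _).
apply: tensor_ext => [||b c].
- exact: (lin_comp (lin_tlift bf) (@lin_dr x)).
- exact: lin_cst0.
by rewrite drT (linD (lin_tlift bf)) !tliftT // anti_rmul mulrN mulrA addrN.
Qed.

Lemma T_proj_eventually a : exists N,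
  (forall n, (N <= n)%N -> hproj T n a = 0) /\ a = \sum_(n < N) hproj T n a.
Proof.
pose N := (\max_(k <- msupp a) size (k : seq X)).+1.
have aN (k : {fmonom X}) : k \in msupp a -> (size k < N)%N.
  move=> ka.
  exact: (@leq_bigmax_seq _ _ xpredT (fun k : {fmonom X} => size k) k ka isT).
exists N; split=> [n nN|].
  rewrite [LHS]big_seq big1 // => k ka; case: eqP => [e|_];
    last by rewrite scaler0.
  by have := aN k ka; rewrite e ltnNge nN.
rewrite {1}[a](monalgE (a : {malg K[{fmonom X}]})) exchange_big /=.
rewrite big_seq [RHS]big_seq; apply: eq_bigr => k /aN kN.
rewrite (bigD1 (Ordinal kN)) //= eqxx big1 => [|i ik].
  by rewrite addr0; exact: malgUZ.
by rewrite ifN ?scaler0 //; apply: contraNneq ik => e; apply/eqP/val_inj.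
Qed.

Lemma tensor_alg_hopf : graded_conn_cocomm_hopf T.
Proof.
have lp m : linear (hproj T m) by exact: lin_linear.
have le : linear (hcounit T) by exact: lin_linear.
split.
- move=> m n; apply: word_ext => [||w]; first exact: (lin_comp (lp m) (lp n)).
    by case: (m == n) => //; exact: lin_cst0.
  rewrite proj_word; case: eqP => [<-|_]; last by rewrite linear0; case: eqP.
  by rewrite proj_word eq_sym.
- move=> a; have [N [hN _]] := T_proj_eventually a.
  apply: sub_finite_set (finite_II N) => n /=; apply: contraNT.
  by rewrite -leqNgt => /hN ->.
- by move=> a; have [N [hN aE]] := T_proj_eventually a; rewrite (fsum_setT hN).
- by rewrite -word_nil proj_word.
- move=> m n a b; move: a; apply: word_ext => [||w].
  + exact: (lin_comp (lp _) (lin_mulr _ (lp m))).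
  + exact: (lin_mulr _ (lp m)).
  move: b; apply: word_ext => [||w'].
  + exact: (lin_comp (lp _) (lin_mull _ (lp n))).
  + exact: (lin_mull _ (lp n)).
  rewrite !proj_word; case: eqP => em; last by rewrite mul0r linear0.
  case: eqP => en; last by rewrite mulr0 linear0.
  by rewrite -word_cat proj_word size_cat em en eqxx.
- move=> a; exists (hcounit T a); move: a; apply: word_ext => [||w].
  + exact: lp.
  + exact/lin_scalel.
  rewrite proj_word counit_word; case: w => [|x w]; last by rewrite scale0r.
  by rewrite scale1r word_nil.
- by rewrite -word_nil cop_nil word_nil.
- exact: T_cop_mul.
- by rewrite -word_nil counit_word.
- move=> a b; move: a; apply: word_ext => [||w].
  + exact: (lin_comp le (lin_mulr b (@lin_id _ _))).
  + exact: (@lin_mulr _ _ K^o (hcounit T b) _ le).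
  move: b; apply: word_ext => [||w'].
  + exact: (lin_comp le (lin_mull _ (@lin_id _ _))).
  + exact: (@lin_mull _ _ K^o _ _ le).
  rewrite -word_cat !counit_word size_cat.
  by case: w w' => [|x w] [|x' w']; rewrite /= ?mulr1 ?mul0r ?mulr0.
- exact: T_cop_assoc.
- exact: T_cop_counit_l.
- exact: T_cop_counit_r.
- exact: T_cop_comm.
- exact: T_cop_graded.
- move=> n a n0; move: a; apply: word_ext => [||w];
    first exact: (lin_comp le (lp n)).
    exact: lin_cst0.
  rewrite proj_word; case: eqP => e; last exact: linear0.
  by rewrite counit_word e -[n]prednK.
- move=> n; apply: word_ext => [||w].
  + exact: (lin_comp (lp n) (lin_comp (lin_linear (hanti T)) (lp n))).
  + exact: (lin_comp (lin_linear (hanti T)) (lp n)).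
  rewrite proj_word; case: eqP => e; last by rewrite !linear0.
  by rewrite anti_word linearZ /= proj_word size_rev e eqxx.
- exact: T_anti_l.
- exact: T_anti_r.
Qed.

End FreeAlgebra.

(** * Group-like and primitive series *)

Section Hopf.
Context {K : fieldType} {H : hopfData K} (hH : graded_conn_cocomm_hopf H).
Implicit Types (x y u v : H).

Let lp n : linear (hproj H n) := lin_linear (hproj H n).
Let lc : linear (hcop H) := lin_linear (hcop H).
Let lS : linear (hanti H) := lin_linear (hanti H).

Lemma degree_opE x N : (forall n, (N <= n)%N -> hproj H n x = 0) ->
  degree_op H x = \sum_(n < N) hproj H n x *+ n.
Proof. by move=> hN; apply: fsum_setT => n /hN ->; rewrite mul0rn. Qed.

Lemma lin_degree_op : linear (degree_op H).
Proof.
move=> a x y; have [N hN] := proj_eventually hH x.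
have [M hM] := proj_eventually hH y.
have hx n : (N + M <= n)%N -> hproj H n x = 0.
  by move=> nm; apply: hN; apply: leq_trans nm; exact: leq_addr.
have hy n : (N + M <= n)%N -> hproj H n y = 0.
  by move=> nm; apply: hM; apply: leq_trans nm; exact: leq_addl.
rewrite (degree_opE hx) (degree_opE hy) (@degree_opE _ (N + M)); last first.
  by move=> n nm; rewrite lp hx // hy // scaler0 addr0.
rewrite scaler_sumr -big_split; apply: eq_bigr => i _.
by rewrite lp mulrnDl scalerMnr.
Qed.

Lemma degree_proj n x : degree_op H (hproj H n x) = hproj H n x *+ n.
Proof.
rewrite (@degree_opE _ n.+1) => [|m nm]; last first.
  by rewrite (proj_proj hH) gtn_eqF.
rewrite big_ord_recr big1 => [|[i ni] _]; last first.
  by rewrite (proj_proj hH) /= ltn_eqF // mul0rn.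
by rewrite /= add0r (proj_proj hH) eqxx.
Qed.

Lemma anti1 : hanti H 1 = 1.
Proof.
have := congr1 (fun f => f 1) (anti_l hH); rewrite /conv /conv1 (cop_one hH).
rewrite tliftT; last by apply: bilin_mul => //; exact: lin_id.
by rewrite mulr1 (counit_one hH) scale1r.
Qed.

Lemma degree1 : degree_op H 1 = 0.
Proof. by rewrite -(proj_one hH) degree_proj mulr0n. Qed.

Lemma lin_dynkin : linear (dynkin_op H).
Proof. exact: (lin_convol lS lin_degree_op). Qed.

Lemma dynkin1 : dynkin_op H 1 = 0.
Proof.
rewrite /dynkin_op /conv (cop_one hH) tliftT; last first.
  exact: (bilin_mul lS lin_degree_op).
by rewrite degree1 mulr0.
Qed.

Definition primel x := hcop H x = coprod x.

(** The counit axiom applied to the coproduct of x reads x = counit(x) 1 + x. *)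
Lemma counit_primel x : primel x -> hcounit H x = 0.
Proof.
move=> px; have := cop_counit_l hH x; rewrite px.
have bf : bilin (fun a b : H => hcounit H a *: b : H).
  by split=> y; [exact: lin_scale | exact/lin_scalel/lin_linear].
rewrite (linD (lin_tlift bf)) !tliftT // (counit_one hH) scale1r.
move=> /(canRL (addrK _)); rewrite subrr => /(congr1 (hcounit H)).
by rewrite (counit_alg hH) linear0.
Qed.

Lemma primel_bracket x y : primel x -> primel y -> primel (x * y - y * x).
Proof.
move=> px py; rewrite /primel (linB lc) !(cop_mul hH) px py.
rewrite -[LHS]/((inl2 hH x + inr2 hH x) * (inl2 hH y + inr2 hH y) -
  (inl2 hH y + inr2 hH y) * (inl2 hH x + inr2 hH x)).
rewrite -[RHS]/(inl2 hH _ + inr2 hH _) !rmorphB !rmorphM /=.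
rewrite !mulrDl !mulrDr -[inr2 hH x * inl2 hH y]comm_inlr2.
rewrite -[inr2 hH y * inl2 hH x]comm_inlr2.
apply/eqP; rewrite subr_eq addrACA.
apply/eqP; rewrite [RHS]addrACA; congr (_ + _); first by rewrite addrA subrK.
by rewrite [X in _ = _ + X]addrC addrA subrK addrC.
Qed.

Lemma conv_primel (A : algType K) (f g : H -> A) x : linear f -> linear g ->
  primel x -> convol f g x = f x * g 1 + f 1 * g x.
Proof.
move=> lf lg px; rewrite /convol px (linD (lin_tlift (bilin_mul lf lg))).
by rewrite !tliftT //; exact: bilin_mul.
Qed.

(** On a primitive x, S * Y is S(x) Y(1) + S(1) Y(x), and Y(1) = 0. *)
Lemma dynkin_primel n x : primel x -> hproj H n x = x ->
  dynkin_op H x = x *+ n.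
Proof.
move=> px xn; rewrite -[LHS]/(convol _ _ x).
rewrite (conv_primel lS lin_degree_op) //.
by rewrite degree1 mulr0 add0r anti1 mul1r -{1}xn degree_proj xn.
Qed.

Lemma grouplike_at0 (g : ser H) : grouplike H g -> g 0%N = 1.
Proof. by move=> [hg eg _]; rewrite -(hg 0%N) (proj0E hH) eg scale1r. Qed.

Lemma hat_tensE (f g : ser H) n :
  hat_tens f g n = (smap (inl2 hH) f * smap (inr2 hH) g) n.
Proof. by apply: eq_bigr => i _; rewrite /smap inlr2M. Qed.

Lemma grouplikeP (g : ser H) : grouplike H g <->
  hat H g /\ glike (cop2 hH) (inl2 hH) (inr2 hH) g.
Proof.
split=> [gl|[hg [g0 gd]]].
  split; first by case: gl.
  split; first exact: grouplike_at0.
  case: gl => hg _ gd; apply/funext => n; rewrite -hat_tensE -gd //.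
split=> //; first by rewrite g0 (counit_one hH).
by apply/funext => n; rewrite hat_tensE -gd.
Qed.

Lemma hat_oneE : hat_one H = (1 : ser H).
Proof. by apply/funext => -[|n]. Qed.

Lemma hat_tens_one (h : ser H) n :
  hat_tens h (hat_one H) n + hat_tens (hat_one H) h n = coprod (h n).
Proof. by rewrite hat_oneE !hat_tensE !smap1 mulr1 mul1r. Qed.

Lemma primitiveP (h : ser H) : primitive H h <->
  hat H h /\ prim (cop2 hH) (inl2 hH) (inr2 hH) h.
Proof.
have pn : (hat_cop h = (fun n => hat_tens h (hat_one H) n + hat_tens (hat_one H)
  h n))
    <-> forall n, primel (h n).
  split=> [hd n|hd]; first by rewrite /primel -hat_tens_one -[RHS](congr1 (@^~
    n) hd).
  by apply/funext => n; rewrite hat_tens_one; exact: hd.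
split=> [[hh /pn hd]|[hh [h0 hd]]]; split=> //.
  split; last by apply/funext => n; exact: hd.
  by rewrite -(hh 0%N) (proj0E hH) counit_primel // scale0r.
by apply/pn => n; exact: (congr1 (@^~ n) hd).
Qed.

Lemma primitive_primel (h : ser H) n : primitive H h -> primel (h n).
Proof. by move=> /primitiveP[_ [_ /(congr1 (@^~ n))]]. Qed.

Lemma grouplike_cop (g : ser H) n : grouplike H g ->
  hcop H (g n) = \sum_(i < n.+1) tens (g i) (g (n - i)%N).
Proof. by case=> _ _ /(congr1 (@^~ n)). Qed.

(** On a group-like series convolution becomes the Cauchy product. This turns S * Y into S(g) Y(g),
    and words in the p_n into products of components of g. *)
Lemma convol_grouplike (A : algType K) (f f' : H -> A) (g : ser H) n :
  linear f -> linear f' -> grouplike H g ->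
  convol f f' (g n) = \sum_(i < n.+1) f (g i) * f' (g (n - i)%N).
Proof.
move=> lf lf' gg; rewrite /convol (grouplike_cop n gg).
rewrite (lin_sum (lin_tlift (bilin_mul lf lf'))).
by apply: eq_bigr => i _; rewrite tliftT //; exact: bilin_mul.
Qed.

Lemma hatM (f g : ser H) : hat H f -> hat H g -> hat H (f * g).
Proof.
move=> hf hg n; rewrite serM linear_sum; apply: eq_bigr => i _ /=.
have := proj_mul hH i (n - i) (f i) (g (n - i)%N).
by rewrite subnKC; [rewrite hf hg | rewrite -ltnS].
Qed.

Lemma hat1 : hat H (1 : ser H).
Proof. by move=> [|n]; rewrite ser1; [exact: proj_one hH | exact: linear0]. Qed.

Lemma hatD (f g : ser H) : hat H f -> hat H g -> hat H (f + g).
Proof. by move=> hf hg n; rewrite serD linearD /= hf hg. Qed.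

Lemma hatN (f : ser H) : hat H f -> hat H (- f).
Proof. by move=> hf n; rewrite -[(- f) n]/(- (f n)) linearN /= hf. Qed.

Lemma hatX (f : ser H) k : hat H f -> hat H (f ^+ k).
Proof. by move=> hf; elim: k => [|k IH]; [exact: hat1 | rewrite exprS;
  exact: hatM]. Qed.

Lemma hat_scomp (c : ser K^o) (u : ser H) : u 0%N = 0 -> hat H u ->
  hat H (scomp c u).
Proof.
move=> u0 hu n; rewrite (scompE _ u0 (ltnSn n)) linear_sum;
  apply: eq_bigr => k _.
by rewrite linearZ /= (hatX k hu).
Qed.

Lemma hat_der (f : ser H) : hat H f -> hat H (der f).
Proof. by move=> hf n; rewrite /der raddfMn /= hf. Qed.

Lemma hat_gam (h : ser H) : hat H h -> hat H (gam h).
Proof.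
move=> hh n; rewrite /gam linear_sum; apply: eq_bigr => -[k /= _] _.
elim: k n => [|k IH] n; first exact: hat1.
rewrite gamkS linearZ linear_sum /=; congr (_ *: _); apply: eq_bigr => i _.
have := proj_mul hH i (n - i) (gamk h k i) (h (n - i)%N).
by rewrite subnKC ?IH ?hh // ltnW.
Qed.

Lemma hat_powE (u : ser H) k : hat_pow u k = u ^+ k.
Proof. by elim: k => [|k IH]; rewrite ?exprS ?expr0 -?hat_oneE //= IH. Qed.

Lemma hat_logE (g : ser H) : g 0%N = 1 -> hat_log H g = Log g.
Proof.
move=> g0; have u0 := subr1_at0 g0; apply/funext => n.
rewrite /hat_log (@fsum_pos _ _ n.+1).
- rewrite /Log (scompE _ u0 (ltnSn n)); apply: eq_bigr => -[k /= _] _.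
  rewrite hat_oneE -[fun m => g m - _]/(g - 1) hat_powE /logc.
  by case: k => [|k] //=; rewrite invr0 mulr0.
- by rewrite invr0 mulr0 scale0r.
- move=> k nk; rewrite hat_oneE -[fun m => g m - _]/(g - 1) hat_powE.
  by rewrite ord_geX // scaler0.
Qed.

Lemma hat_expE (h : ser H) : h 0%N = 0 -> hat_exp H h = Exp h.
Proof.
move=> h0; apply/funext => n; rewrite /hat_exp (@fsum_setT _ _ n.+1).
  by rewrite /Exp (scompE _ h0 (ltnSn n)); apply: eq_bigr => k _;
    rewrite hat_powE.
by move=> k nk; rewrite hat_powE ord_geX // scaler0.
Qed.

Section CharZero.
Hypothesis charK : [pchar K] =i pred0.

Let i12 := comm_inlr2 hH.

Lemma grouplike_Exp (h : ser H) : primitive H h -> grouplike H (Exp h).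
Proof.
move=> /primitiveP[hh ph]; apply/grouplikeP; split; last exact: glike_Exp.
by apply: hat_scomp => //; case: ph.
Qed.

Lemma primitive_Log (g : ser H) : grouplike H g -> primitive H (Log g).
Proof.
move=> /grouplikeP[hg pg]; apply/primitiveP; split; last exact: prim_Log.
apply: hat_scomp; first by apply: subr1_at0; case: pg.
by apply: hatD => //; apply: hatN; exact: hat1.
Qed.

Lemma grouplike_gam (h : ser H) : primitive H h -> grouplike H (gam h).
Proof.
move=> /primitiveP[hh ph]; apply/grouplikeP; split; last exact: glike_gam.
exact: hat_gam.
Qed.

Lemma hat_dynkinE (g : ser H) : grouplike H g ->
  hat_dynkin H g = ((fun n => hanti H (g n)) : ser H) * der g.
Proof.
move=> gg; apply/funext => n; rewrite /hat_dynkin.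
rewrite -[LHS]/(convol _ _ (g n)) convol_grouplike //;
  last exact: lin_degree_op.
by apply: eq_bigr => i _; case: gg => hg _ _;
  rewrite -{1}(hg (n - i)%N) degree_proj hg.
Qed.

Lemma dynkin_ode (g : ser H) : grouplike H g -> g * hat_dynkin H g = der g.
Proof.
(* The series S(g) is a right inverse of g, because id * S is the unit of convolution. *)
move=> gg; rewrite hat_dynkinE // mulrA [X in X * _](_ : _ = 1) ?mul1r //.
apply/funext => n; rewrite serM -(@convol_grouplike _ id (hanti H)) //.
rewrite -[LHS]/(conv _ _ _) (anti_r hH) /conv1.
have [hg _ _] := gg; case: n => [|n]; last first.
  by rewrite -(hg n.+1) (counit_graded hH) // scale0r.
by rewrite -(proj0E hH) (hg 0%N) grouplike_at0.
Qed.

Lemma primitive_dynkin (g : ser H) : grouplike H g ->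
  primitive H (hat_dynkin H g).
Proof.
move=> gg; have d0 : hat_dynkin H g 0%N = 0.
  rewrite hat_dynkinE // serM0 /der mulr0n mulr0 //.
have /grouplikeP[hg pg] := gg; apply/primitiveP; split; last first.
  by apply: (prim_ode i12 d0) pg; rewrite dynkin_ode.
rewrite hat_dynkinE //; apply: hatM; last exact: hat_der.
by move=> n; rewrite -{1}(hg n) (anti_graded hH) hg.
Qed.

Lemma gam_dynkin (g : ser H) : grouplike H g -> gam (hat_dynkin H g) = g.
Proof.
move=> gg; have /primitiveP[_ [d0 _]] := primitive_dynkin gg.
apply: (ode_unique charK d0); first by rewrite gam0 grouplike_at0.
  exact: der_gam.
by rewrite dynkin_ode.
Qed.

Lemma dynkin_gam (h : ser H) : primitive H h -> hat_dynkin H (gam h) = h.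
Proof.
move=> ph; have /primitiveP[_ [h0 _]] := ph; have gg := grouplike_gam ph.
apply: (@ser_lreg _ _ (gam h)); first exact: gam0.
by rewrite dynkin_ode // der_gam.
Qed.

End CharZero.
End Hopf.

(** * The sum over compositions in the formula for Gamma *)

Section Gamma.
Context {K : fieldType} {R : algType K} (h : ser R) (N : nat).
Implicit Types k m : nat.

(** The bound [N] on the parts is kept apart from the sum [m], so that removing the last part of a
    composition stays within the same finite type. *)
Definition comp_pred k m (i : {ffun 'I_k -> 'I_N.+1}) :=
  [forall j, (0 < i j)%N] && (\sum_j i j == m)%N.

Definition comp_term k (i : {ffun 'I_k -> 'I_N.+1}) : R :=
  (\prod_(j < k) (\sum_(l < k | (l <= j)%N) i l)%N%:R : K)^-1 *:
  \prod_(j < k) h (i j).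

Definition comp_rcons k (p : {ffun 'I_k -> 'I_N.+1} * 'I_N.+1) :
    {ffun 'I_k.+1 -> 'I_N.+1} :=
  [ffun j => if unlift ord_max j is Some j' then p.1 j' else p.2].

Definition comp_belast k (f : {ffun 'I_k.+1 -> 'I_N.+1}) :
    {ffun 'I_k -> 'I_N.+1} * 'I_N.+1 :=
  ([ffun j => f (widen_ord (leqnSn k) j)], f ord_max).

Lemma widen_lift k (j : 'I_k) : widen_ord (leqnSn k) j = lift ord_max j.
Proof. by apply/val_inj; rewrite /= /bump leqNgt ltn_ord. Qed.

Lemma comp_rcons_widen k p (j : 'I_k) :
  comp_rcons p (widen_ord (leqnSn k) j) = p.1 j.
Proof. by rewrite ffunE widen_lift liftK. Qed.

Lemma comp_rcons_max k (p : {ffun 'I_k -> 'I_N.+1} * 'I_N.+1) :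
  comp_rcons p ord_max = p.2.
Proof. by rewrite ffunE unlift_none. Qed.

Lemma comp_rcons_bij k : bijective (@comp_rcons k).
Proof.
exists (@comp_belast k) => [[f a]|f].
  rewrite /comp_belast comp_rcons_max; congr pair.
  by apply/ffunP => j; rewrite ffunE comp_rcons_widen.
apply/ffunP => j; rewrite ffunE; case: unliftP => [j' ->|-> //].
by rewrite /= ffunE widen_lift.
Qed.

Lemma comp_pred_rcons k m f a : comp_pred m (@comp_rcons k (f, a)) =
  [&& (0 < a)%N, (a <= m)%N & comp_pred (m - a) f].
Proof.
rewrite /comp_pred; have -> : [forall j, (0 < comp_rcons (f, a) j)%N] =
          (0 < a)%N && [forall j, (0 < f j)%N].
  apply/forallP/andP => [pos|[a0 /forallP f0] j].
    split; first by have := pos ord_max; rewrite comp_rcons_max.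
    apply/forallP => j; have := pos (widen_ord (leqnSn k) j).
    by rewrite comp_rcons_widen.
  by rewrite ffunE; case: unlift.
rewrite big_ord_recr /= comp_rcons_max.
under eq_bigr do rewrite comp_rcons_widen.
rewrite -andbA; congr (_ && _); rewrite andbCA; congr (_ && _).
case: leqP => [am|ma]; first by rewrite -{1}(subnK am) eqn_add2r.
by apply/negP => /eqP e; move: ma; rewrite -e ltnNge leq_addl.
Qed.

(** The last partial sum is the whole sum, and the earlier ones do not involve the last part. *)
Lemma comp_term_rcons k f a : comp_term (@comp_rcons k (f, a)) =
  (\sum_j f j + a)%N%:R^-1 *: (comp_term f * h a).
Proof.
rewrite /comp_term !big_ord_recr /= !comp_rcons_max invfM [_^-1 * _]mulrC.
rewrite -scalerAl scalerA; congr (_ *: (_ * _)); last first.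
  by apply: eq_bigr => j _; rewrite comp_rcons_widen.
congr (_^-1 * _^-1).
  rewrite big_mkcond big_ord_recr /= leqnn comp_rcons_max; congr (_ + _)%N%:R.
  by apply: eq_bigr => j _; rewrite ltnW // comp_rcons_widen.
apply: eq_bigr => j _; rewrite big_mkcond big_ord_recr /= leqNgt ltn_ord addn0.
rewrite -big_mkcond /=; congr _%:R; apply: eq_bigr => l _.
by rewrite comp_rcons_widen.
Qed.

Lemma sum_comp k m : (m <= N)%N ->
  \sum_(i : {ffun 'I_k -> 'I_N.+1} | comp_pred m i) comp_term i = gamk h k m.
Proof.
elim: k m => [|k IH] m mN.
  have f0 (f : {ffun 'I_0 -> 'I_N.+1}) : f = [ffun=> ord0].
    by apply/ffunP => -[].
  have p0 f : @comp_pred 0 m f = (m == 0)%N.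
    by rewrite /comp_pred big_ord0 eq_sym; case: forallP => // -[] [].
  rewrite (eq_bigl (fun _ => m == 0%N)) //.
  rewrite big_mkcond (bigD1 [ffun=> ord0]) //= big1 => [|f /eqP []//].
  rewrite addr0 /gamk; case: eqP => // _.
  by rewrite /comp_term !big_ord0 invr1 scale1r.
rewrite (reindex _ (onW_bij _ (comp_rcons_bij k))) /= gamkS.
rewrite (eq_bigr (fun p : {ffun 'I_k -> 'I_N.+1} * 'I_N.+1 => m%:R^-1 *:
  (comp_term p.1 * h p.2))); last first.
  move=> [f a]; rewrite comp_pred_rcons => /and3P[_ am /andP[_ /eqP fm]].
  by rewrite comp_term_rcons /= fm subnK.
rewrite -scaler_sumr; congr (_ *: _).
rewrite (eq_bigl (fun p : {ffun 'I_k -> 'I_N.+1} * 'I_N.+1 => [&& (0 < p.2)%N,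
  (p.2 <= m)%N & comp_pred (m - p.2) p.1]));
  last by move=> [f a]; rewrite comp_pred_rcons.
transitivity (\sum_(a < N.+1 | (0 < a <= m)%N)
    \sum_(f : {ffun 'I_k -> 'I_N.+1} | comp_pred (m - a) f) comp_term f * h a).
  rewrite (exchange_big_dep predT) //= pair_big_dep /=.
  by apply: eq_bigl => -[f a]; rewrite /= -andbA.
under eq_bigr => a _ do rewrite -mulr_suml IH ?(leq_trans (leq_subr _ _)) //.
rewrite -(big_mkord (fun a => (0 < a <= m)%N) (fun a => gamk h k (m - a)%N * h
  a)).
rewrite (big_cat_nat (n := m.+1)) //= [X in _ + X]big1_seq ?addr0; last first.
  move=> a; rewrite mem_index_iota => /andP[/andP[_ am] /andP[ma _]].
  by move: am; rewrite leqNgt ma.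
rewrite big_mkcond big_nat_recl //= add0r big_mkord.
(* The left side is indexed by the last part, which is i + 1, and the recursion of [gamk] by the
   remaining sum m - (i + 1). *)
rewrite [RHS](reindex_inj rev_ord_inj) /=; apply: eq_bigr => i _.
by rewrite ltn_ord subKn.
Qed.

End Gamma.

Lemma hat_GammaE (K : fieldType) (H : hopfData K) (h : ser H) :
  hat_Gamma H h = gam h.
Proof.
by apply/funext => n; apply: eq_bigr => k _; exact: (sum_comp h k (leqnn n)).
Qed.

(** The identity (S * Y)(u x) = [(S * Y)(u), x] + (S * id)(u) x for primitive x, stated with an
    arbitrary tensor t in place of the coproduct of u. *)
Lemma tlift_derivation (K : fieldType) (A : algType K) (S Y : A ->
  A) (x : A) t :
  linear S -> linear Y -> (forall a, S (a * x) = - (x * S a)) ->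
  (forall a, Y (a * x) = Y a * x + a * x) ->
  tlift (fun a b : A => S a * Y b) (tmul t (coprod x)) =
  tlift (fun a b : A => S a * Y b) t * x - x * tlift (fun a b : A => S a * Y b)
    t
  + tlift (fun a b : A => S a * b) t * x.
Proof.
move=> lS lY Sx Yx; have b1 := bilin_mul lS lY.
have b2 := bilin_mul lS (@lin_id _ A).
move: t; apply: tensor_ext => [||a b].
- exact: (lin_comp (lin_tlift b1) (lin_tmull _)).
- apply: lin_add; last exact/lin_mulr/lin_tlift.
  apply: lin_add; first exact/lin_mulr/lin_tlift.
  exact/lin_opp/lin_mull/lin_tlift.
rewrite tmulDr !tmulT !mulr1 (linD (lin_tlift b1)) !tliftT // Sx Yx.
by rewrite mulNr mulrDr !mulrA addrA [- _ + _]addrC.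
Qed.

(** * Lie elements of the tensor algebra and the Dynkin operator *)

Section FreeLie.
Context {K : fieldType} {X : choiceType}.
Local Notation T := (tensor_alg K X).
Local Notation hT := (@tensor_alg_hopf K X).
Implicit Types (x : X) (w : seq X) (a b u v : T).

(** The easy half of Friedrichs' criterion. The converse in degree n > 0 comes from the Dynkin
    operator, whose values are Lie elements and which multiplies primitives by n. *)
Lemma lie_primel u : lie_elt u -> @primel K T u.
Proof.
have lc : linear (hcop T) := lin_linear (hcop T).
have lcop : linear (@coprod K T).
  by apply: lin_add; [exact: tens_linear_l | exact: tens_linear_r].
elim=> {u} [x||u v _ pu _ pv|a u _ pu|u v _ pu _ pv].
- exact: cop_letterE.
- by rewrite /primel (lin0 lc) (lin0 lcop).
- by rewrite /primel (linD lc) (linD lcop) pu pv.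
- by rewrite /primel (linZ lc) (linZ lcop) pu.
- exact: (primel_bracket hT).
Qed.

Lemma degree_word w : degree_op T (tword w) = tword w *+ size w.
Proof.
have {1}-> : tword w = hproj T (size w) (tword w) by rewrite proj_word eqxx.
by rewrite (degree_proj hT) proj_word eqxx.
Qed.

Lemma degree_rmul x a : degree_op T (a * tletter x) =
  degree_op T a * tletter x + a * tletter x.
Proof.
have ld := lin_degree_op hT; move: a; apply: word_ext => [||w].
- exact: (lin_comp ld (lin_mulr _ (@lin_id _ _))).
- by apply: lin_add; apply: lin_mulr.
by rewrite -word_rcons !degree_word size_rcons word_rcons mulrS addrC mulrnAl.
Qed.

(** The recursion of the left-to-right iterated bracketing; the counit term starts it on words of
    length one. *)
Lemma dynkin_rmul x u : dynkin_op T (u * tletter x) =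
  dynkin_op T u * tletter x - tletter x * dynkin_op T u +
  hcounit T u *: tletter x.
Proof.
have ld := lin_degree_op hT; have lS := lin_linear (hanti T).
have <- : conv (hanti T) id u * tletter x = hcounit T u *: tletter x.
  have e := congr1 (fun f => f u) (anti_l hT).
  exact: (etrans (congr1 (fun y => y * tletter x) e) (mulr_algl _ _)).
rewrite /dynkin_op /conv T_cop_mul cop_letterE.
exact: (tlift_derivation _ lS ld (@anti_rmul _ _ x) (degree_rmul x)).
Qed.

Lemma lie_sum (I : eqType) (r : seq I) (F : I -> free_alg K X) :
  (forall i, lie_elt (F i)) -> lie_elt (\sum_(i <- r) F i).
Proof.
move=> lF; elim/big_rec: _ => [|i u _ lu]; first exact: lie_0.
exact: lie_add.
Qed.

Lemma dynkin_word_lie w : lie_elt (dynkin_op T (tword w)).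
Proof.
elim/last_ind: w => [|w x IH].
  by rewrite word_nil (dynkin1 hT); exact: lie_0.
rewrite word_rcons dynkin_rmul; apply: lie_add; last exact/lie_scale/lie_letter.
by apply: lie_bracket => //; exact: lie_letter.
Qed.

Lemma dynkin_lie u : lie_elt (dynkin_op T u).
Proof.
rewrite (monalgE (u : {malg K[{fmonom X}]})) (lin_sum (lin_dynkin hT)).
apply: lie_sum => k.
rewrite malgUZ (wordU k) (linZ (lin_dynkin hT)).
by apply: lie_scale; exact: dynkin_word_lie.
Qed.

End FreeLie.

(** * The action of the descent algebra *)

Section DescentWords.
Context {K : fieldType}.
Local Notation D := {malg K[{fmonom nat}]}.
Implicit Types (P Q : D) (w : seq nat) (H : hopfData K).

Definition desc_word H w : H -> H :=
  foldr (fun n f => conv (hproj H n) f) (conv1 H) w.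

Arguments desc_word : clear implicits.

Lemma lin_desc_word H w : linear (desc_word H w).
Proof.
elim: w => [|n w IH]; first exact: lin_convol1.
exact: (lin_convol (lin_linear (hproj H n)) IH).
Qed.

Lemma descent_evalE H P x :
  descent_eval H P x = mlift (fun w : {fmonom nat} => desc_word H w x) P.
Proof. by []. Qed.

Lemma lin_descent_eval H P : linear (descent_eval H P).
Proof. by apply: lin_bigsum => w; apply: lin_scale; exact: lin_desc_word. Qed.

Definition homog n P := forall w : {fmonom nat}, w \in msupp P -> sumn w = n.

Lemma homog0 n : homog n 0. Proof. by move=> w; rewrite msupp0. Qed.

Lemma homogD n P Q : homog n P -> homog n Q -> homog n (P + Q).
Proof.
move=> hP hQ w /(fsubsetP (msuppD_le _ _)); rewrite in_fsetU.
by case/orP => [/hP | /hQ].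
Qed.

Lemma homogZ n c P : homog n P -> homog n (c *: P).
Proof. by move=> hP w /(fsubsetP (msuppZ_le _ _)) /hP. Qed.

Lemma homog_sum n I (r : seq I) (p : pred I) (F : I -> D) :
  (forall i, p i -> homog n (F i)) -> homog n (\sum_(i <- r | p i) F i).
Proof.
move=> hF; elim/big_rec: _ => [|i P pi hP]; first exact: homog0.
by apply: homogD => //; exact: hF.
Qed.

Lemma homogU (w : {fmonom nat}) : homog (sumn w) << w >>.
Proof. by move=> w'; rewrite msuppU1 in_fset1 => /eqP ->. Qed.

Definition lmul n P : D := mlift (fun w : {fmonom nat} => << FMonom (n :: w) >>)
  P.

Lemma homog_lmul m n P : homog n P -> homog (m + n)%N (lmul m P).
Proof.
move=> hP; rewrite /lmul /mlift big_seq; apply: homog_sum => w /hP <-.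
by apply: homogZ; exact: (@homogU (FMonom (m :: w))).
Qed.

Lemma descent_eval_lmul H n P x :
  descent_eval H (lmul n P) x = conv (hproj H n) (descent_eval H P) x.
Proof.
have lp : linear (hproj H n) := lin_linear (hproj H n).
rewrite descent_evalE /lmul (lin_sum (@mlift_linear _ _ _ _)).
rewrite /conv; set t := hcop H x.
have -> : tlift (fun a b : H => hproj H n a * descent_eval H P b) t =
  \sum_(w <- msupp P) mcoeff w P *:
    tlift (fun a b : H => hproj H n a * desc_word H w b) t.
  move: t; apply: tensor_ext => [||a b].
  - by apply/lin_tlift/bilin_mul => //; exact: lin_descent_eval.
  - apply: lin_bigsum => w; apply: lin_scale; apply/lin_tlift/bilin_mul => //.
    exact: lin_desc_word.
  rewrite tliftT; last by apply: bilin_mul => //; exact: lin_descent_eval.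
  rewrite mulr_sumr; apply: eq_bigr => w _.
  rewrite tliftT ?scalerAr //; apply: bilin_mul => //; exact: lin_desc_word.
apply: eq_bigr => w _; rewrite (linZ (@mlift_linear _ _ _ _)) mliftU.
by [].
Qed.

Lemma descent_evalD H P Q x :
  descent_eval H (P + Q) x = descent_eval H P x + descent_eval H Q x.
Proof. exact: (linD (@mlift_linear _ _ _ _)). Qed.

Lemma descent_evalZ H c P x : descent_eval H (c *: P) x = c *: descent_eval H P
  x.
Proof. exact: (linZ (@mlift_linear _ _ _ _)). Qed.

Lemma descent_eval_sum H I (r : seq I) (p : pred I) (F : I -> D) x :
  descent_eval H (\sum_(i <- r | p i) F i) x =
  \sum_(i <- r | p i) descent_eval H (F i) x.
Proof. exact: (lin_sum (@mlift_linear _ _ _ _)). Qed.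

Lemma descent_eval0 H x : descent_eval H 0 x = 0.
Proof. exact: (lin0 (@mlift_linear _ _ _ _)). Qed.

Lemma descent_evalU H (w : {fmonom nat}) x : descent_eval H << w >> x =
  desc_word H w x.
Proof. exact: mliftU. Qed.

Section Graded.
Context {H : hopfData K} (hH : graded_conn_cocomm_hopf H).
Let lp n : linear (hproj H n) := lin_linear (hproj H n).

Lemma desc_word_proj w x : hproj H (sumn w) (desc_word H w x) = desc_word H w x.
Proof.
elim: w x => [|n w IH] x /=.
  by rewrite /conv1 linearZ /= (proj_one hH).
have lF := @lin_desc_word H w.
rewrite /conv (lin_of_tlift _ (lp _) (bilin_mul (lp n) lF)).
congr (tlift _ _); apply/funext => a; apply/funext => b.
by have := proj_mul hH n (sumn w) a (desc_word H w b); rewrite IH.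
Qed.

Lemma descent_eval_proj n P x : homog n P ->
  hproj H n (descent_eval H P x) = descent_eval H P x.
Proof.
move=> hP; rewrite /descent_eval (lin_sum (lp n)).
rewrite big_seq [RHS]big_seq; apply: eq_bigr => w /hP <-.
by rewrite (linZ (lp _)); congr (_ *: _); exact: desc_word_proj.
Qed.

(** Convolution with p_m selects the term of index m in the Cauchy product, which is present only if
    m <= n. *)
Lemma desc_word_grouplike (g : ser H) w n : grouplike H g ->
  desc_word H w (g n) = if (sumn w == n)%N then \prod_(i <- w) g i else 0.
Proof.
move=> gg; have [hg _ _] := gg.
elim: w n => [|m w IH] n /=.
  rewrite big_nil /conv1; case: n => [|n].
    by rewrite (grouplike_at0 hH gg) (counit_one hH) scale1r.
  by rewrite -(hg n.+1) (counit_graded hH) // scale0r.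
rewrite -[LHS]/(convol _ (desc_word H w) (g n)).
rewrite (convol_grouplike _ (lp m) (@lin_desc_word H w) gg) big_cons.
have pg i : hproj H m (g i) = if m == i then g i else 0.
  by rewrite -(hg i) (proj_proj hH) hg.
have [mn|nm] := leqP m n; last first.
  rewrite big1 => [|[i /= ni] _]; last first.
    by rewrite pg gtn_eqF ?mul0r // (leq_ltn_trans _ nm).
  by rewrite gtn_eqF // (leq_trans nm) // leq_addr.
rewrite (bigD1 (Ordinal (mn : (m < n.+1)%N))) //= big1 => [|i im]; last first.
  by rewrite pg ifN ?mul0r //; apply: contraNneq im => e; apply/eqP/val_inj.
rewrite addr0 pg eqxx IH -{2}(subnKC mn) eqn_add2l.
by case: ifP => // _; rewrite mulr0.
Qed.

End Graded.

(** Substitution of g_i for p_i in the weight n part of P. The restriction on the weight is built in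
    because the polynomial chosen in [descent_act] may be inhomogeneous, while words of another
    weight vanish on g_n. *)
Definition pact {A : algType K} P n (g : ser A) : A :=
  mlift (fun w : {fmonom nat} => if (sumn w == n)%N then \prod_(i <- (w : seq
    nat)) g i else 0) P.

Lemma descent_eval_grouplike H (hH : graded_conn_cocomm_hopf H) P (g : ser H) n
  :
  grouplike H g -> descent_eval H P (g n) = pact P n g.
Proof.
by move=> gg; apply: eq_bigr => w _; rewrite -(desc_word_grouplike hH).
Qed.

Lemma smap_pact (A B : algType K) (phi : {lrmorphism A -> B}) P n (g : ser A) :
  phi (pact P n g) = pact P n (smap phi g).
Proof.
have lphi : linear phi := lin_linear phi.
rewrite /pact /mlift (lin_sum lphi); apply: eq_bigr => w _; rewrite (linZ lphi).
by congr (_ *: _); case: ifP => _; [exact: rmorph_prod | exact: linear0].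
Qed.

Lemma prod_causal (A : algType K) w (g g' : ser A) :
  (forall i, (i <= sumn w)%N -> g i = g' i) ->
  \prod_(i <- w) g i = \prod_(i <- w) g' i.
Proof.
move=> gg'; apply: eq_big_seq => i iw; apply: gg'.
elim: w iw => //= m s IH; rewrite inE => /orP[/eqP ->|/IH];
  first exact: leq_addr.
by move/leq_trans; apply; exact: leq_addl.
Qed.

Lemma pact_causal (A : algType K) P n (g g' : ser A) :
  (forall i, (i <= n)%N -> g i = g' i) -> pact P n g = pact P n g'.
Proof.
move=> gg'; apply: eq_bigr => w _; congr (_ *: _); case: eqP => // wn.
by apply: prod_causal; rewrite wn.
Qed.

(** As p_0 is the unit of convolution, every word that becomes n after deletion of its zeros acts as
    p_n. Accordingly [pcoef] adds up the coefficients of all these words. *)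
Definition single_word w n := [seq i <- w | (i != 0)%N] == [:: n].

Lemma single_word_sum w n : single_word w n -> sumn w = n.
Proof.
move=> /eqP e; have -> : sumn w = sumn [seq i <- w | (i != 0)%N].
  by elim: w {e} => //= -[|m] w /= ->.
by rewrite e /= addn0.
Qed.

Definition pcoef P n : K := mlift (fun w : {fmonom nat} => (single_word w n)%:R
  : K^o) P.

Lemma word_nonzero0 w : ([seq i <- w | (i != 0)%N] == [::]) = (sumn w == 0)%N.
Proof. by elim: w => //= -[|m] w IH /=. Qed.

(** A word of weight n whose only nonzero letter is n contributes the component of degree n, as the
    components of degree 0 are 1; any other word of weight n involves only components of degree
    below n, where g and g' agree. *)
Lemma pact_top (A : algType K) P n (g g' : ser A) : (0 < n)%N ->
  g 0%N = 1 -> g' 0%N = 1 -> (forall i, (i < n)%N -> g i = g' i) ->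
  pact P n g - pact P n g' = pcoef P n *: (g n - g' n).
Proof.
move=> n0 g0 g0' gg'; rewrite /pact /mlift -sumrB scaler_suml.
apply: eq_bigr => w _; rewrite -scalerBr -scalerA; congr (_ *: _).
case: eqP => [|wn]; last first.
  case: (boolP (single_word w n)) => [/single_word_sum //|_].
  by rewrite subrr scale0r.
elim: (w : seq nat) => [|m {}w IH] /= wn.
  by move: n0; rewrite -wn.
rewrite /single_word /= !big_cons; case: m wn => [|m] /= wn.
  by rewrite g0 g0' !mul1r IH.
rewrite eqseq_cons word_nonzero0.
have [mn|mn] := eqVneq m.+1 n.
  have w0 : sumn w = 0%N by apply: (@addnI m.+1); rewrite addn0 wn mn.
  have p1 (f : ser A) : f 0%N = 1 -> \prod_(i <- w) f i = 1.
    move=> f0; elim: w w0 {IH wn} => [|j w IH] /=; first by rewrite big_nil.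
    by move/eqP; rewrite addn_eq0 big_cons => /andP[/eqP -> /eqP /IH ->];
      rewrite f0 mulr1.
  by rewrite w0 !p1 // eqxx !mulr1 mn scale1r.
have mn' : (m.+1 < n)%N by rewrite ltn_neqAle mn -wn leq_addr.
rewrite gg' // (prod_causal (g' := g')) ?subrr ?scale0r // => i iw.
by apply: gg'; apply: leq_ltn_trans iw _; rewrite -wn addSn ltnS leq_addl.
Qed.

End DescentWords.

Arguments desc_word {K} H w x.

(** * The Dynkin and Eulerian operators as polynomials in the projections *)

Section DescentHopf.
Context {K : fieldType}.
Local Notation D := {malg K[{fmonom nat}]}.
Implicit Types (P Q : D) (w : seq nat).

Section Primitive.
Context {H : hopfData K} (hH : graded_conn_cocomm_hopf H).
Let lp n : linear (hproj H n) := lin_linear (hproj H n).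

Lemma proj_at1 n : hproj H n 1 = if n == 0%N then 1 else 0.
Proof.
by rewrite -(proj_one hH) (proj_proj hH); case: (n == 0%N).
Qed.

Lemma desc_word_at1 w : desc_word H w 1 = (sumn w == 0%N)%:R.
Proof.
elim: w => [|n w IH]; first by rewrite /= /conv1 (counit_one hH) scale1r.
rewrite -[LHS]/(convol (hproj H n) (desc_word H w) 1) /convol (cop_one hH).
rewrite tliftT; last exact: (bilin_mul (lp n) (@lin_desc_word K H w)).
rewrite IH proj_at1 /= addn_eq0; case: (n == 0%N); last by rewrite mul0r.
by rewrite mul1r.
Qed.

(** In a convolution product at a primitive element, all factors but one are evaluated at 1, where
    p_m vanishes for m > 0; so a word with two nonzero letters acts as 0. *)
Lemma desc_word_primel n w x : (0 < n)%N -> primel x -> hproj H n x = x ->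
  desc_word H w x = (single_word w n)%:R *: x.
Proof.
move=> n0 px xn; elim: w => [|m w IH].
  by rewrite /= /conv1 (counit_primel hH px) !scale0r.
rewrite -[LHS]/(convol (hproj H m) (desc_word H w) x).
rewrite (conv_primel (lp m) (@lin_desc_word K H w) px).
rewrite desc_word_at1 proj_at1 IH -{1}xn (proj_proj hH) xn /single_word /=.
case: m => [|m] /=.
  by rewrite [(0 == n)%N]eq_sym gtn_eqF // mul0r add0r mul1r.
rewrite mul0r addr0 eqseq_cons word_nonzero0.
by case: (m.+1 == n); [case: (sumn w == 0%N);
  rewrite ?mulr1 ?mulr0 ?scale1r ?scale0r | rewrite mul0r scale0r].
Qed.

Lemma descent_eval_primel n P x : (0 < n)%N -> primel x -> hproj H n x = x ->
  descent_eval H P x = pcoef P n *: x.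
Proof.
move=> n0 px xn; rewrite /pcoef /mlift scaler_suml; apply: eq_bigr => w _.
by rewrite -scalerA -(desc_word_primel _ n0 px xn).
Qed.

Lemma conv_id_dynkin : conv id (dynkin_op H) = degree_op H.
Proof.
have ld := lin_degree_op hH; have lS := lin_linear (hanti H).
rewrite -[LHS]/(convol id (convol (hanti H) (degree_op H))).
rewrite (convolA hH (@lin_id _ _) lS ld).
by rewrite -[convol id _]/(conv id (hanti H)) (anti_r hH) (convol1l hH ld).
Qed.

Lemma proj0_convol (f : H -> H) : linear f -> convol (hproj H 0%N) f = f.
Proof.
move=> lf; rewrite -[RHS](convol1l hH lf); congr (convol _ f).
by apply/funext => x; exact: proj0E.
Qed.

(** The identity id * (S * Y) = Y, solved for its term with p_0, which is D itself. The antipode is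
    thereby eliminated, and the recursion expresses D_n as a polynomial in the projections. *)
Lemma dynkin_rec n x : dynkin_op H (hproj H n x) =
  hproj H n x *+ n -
  \sum_(i < n) convol (hproj H i.+1) (dynkin_op H \o hproj H (n - i.+1)) x.
Proof.
have lD := lin_dynkin hH.
rewrite -(degree_proj hH) -conv_id_dynkin -[conv _ _ _]/(convol _ _ _).
rewrite (convol_proj hH _ _ (@lin_id _ _) lD) big_ord_recl subn0 proj0_convol.
  by rewrite addrK.
exact: (lin_comp lD (lp n)).
Qed.

(** Id minus the unit of convolution is 0 in degree 0 and agrees with the identity in positive
    degrees, so the first factor runs over the p_i with i > 0. *)
Lemma convX_rec k n x :
  convX (fun y : H => y - conv1 H y) k.+1 (hproj H n x) =
  \sum_(i < n) convol (hproj H i.+1)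
    (convX (fun y : H => y - conv1 H y) k \o hproj H (n - i.+1)) x.
Proof.
have l1 := lin_sub_conv1 (H := H); have lk := lin_convX k l1.
rewrite -[LHS]/(convol _ _ _) (convol_proj hH _ _ l1 lk) big_ord_recl.
have z y : hproj H 0%N y - conv1 H (hproj H 0%N y) = 0.
  by rewrite /conv1 (proj0E hH) (counit_alg hH) subrr.
rewrite [X in X + _](_ : _ = 0) ?add0r; last first.
  transitivity (convol (fun _ => 0) (convX (fun y : H => y - conv1 H y) k \o
    hproj H (n - 0)) x).
    by congr (convol _ _ x); apply/funext => y; exact: z.
  rewrite /convol; move: (hcop H x); apply: tensor_ext => [||a b].
  - apply/lin_tlift/bilin_mul; first exact: lin_cst0.
    exact: (lin_comp lk (lp _)).
  - exact: lin_cst0.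
  rewrite tliftT ?mul0r //; apply: bilin_mul; first exact: lin_cst0.
  exact: (lin_comp lk (lp _)).
apply: eq_bigr => i _; congr (convol _ _ x); apply/funext => y /=.
by rewrite /conv1 (counit_graded hH) // scale0r subr0.
Qed.

Lemma conv_log_id_sum n x : conv_log_id H (hproj H n x) =
  \sum_(k < n.+1) logc k *: convX (fun y : H => y - conv1 H y) k (hproj H n x).
Proof.
rewrite /conv_log_id (@fsum_pos _ _ n.+1).
- by apply: eq_bigr => -[[|k] /= _] _; rewrite ?invr0 ?mulr0.
- by rewrite invr0 mulr0 scale0r.
- move=> k nk; rewrite (convX_projs hH) ord_geX ?scaler0 //.
  by rewrite serB (proj1 (projs_glike hH)) subrr.
Qed.

Lemma convX_grouplike (g : ser H) k n : grouplike H g ->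
  convX (fun y : H => y - conv1 H y) k (g n) = ((g - 1) ^+ k) n.
Proof.
move=> gg; have [hg _ _] := gg; have l1 := lin_sub_conv1 (H := H).
have eg m : conv1 H (g m) = (1 : ser H) m.
  rewrite /conv1; case: m => [|m]; last by rewrite -(hg m.+1) (counit_graded hH)
    // scale0r.
  by rewrite (grouplike_at0 hH gg) (counit_one hH) scale1r.
elim: k n => [|k IH] n; first exact: eg.
rewrite exprS serM -[LHS]/(convol _ _ _).
rewrite (convol_grouplike _ l1 (lin_convX k l1) gg); apply: eq_bigr => i _.
by rewrite IH eg.
Qed.

Lemma conv_log_id_grouplike (g : ser H) n : grouplike H g ->
  conv_log_id H (g n) = hat_log H g n.
Proof.
move=> gg; have [hg _ _] := gg; have g0 := grouplike_at0 hH gg.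
rewrite (hat_logE g0) /Log (scompE _ (subr1_at0 g0) (ltnSn n)).
rewrite -{1}(hg n) conv_log_id_sum; apply: eq_bigr => k _.
by rewrite hg convX_grouplike.
Qed.

(** Id minus the unit vanishes at 1, so at a primitive element every power other than the first is
    0. *)
Lemma convX_primel k x : primel x ->
  convX (fun y : H => y - conv1 H y) k x = (k == 1%N)%:R *: x.
Proof.
move=> px; have ex := counit_primel hH px; have l1 := lin_sub_conv1 (H := H).
case: k => [|k]; first by rewrite /= /conv1 ex !scale0r.
rewrite -[LHS]/(convol _ (convX _ k) x) (conv_primel l1 (lin_convX k l1) px).
have -> : (1 : H) - conv1 H 1 = 0 by rewrite /conv1 (counit_one hH) scale1r
  subrr.
rewrite mul0r addr0 /conv1 ex scale0r subr0.
case: k => [|k] /=; first by rewrite /conv1 (counit_one hH) !scale1r mulr1.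
rewrite /conv (cop_one hH) tliftT; last exact: (bilin_mul l1 (lin_convX k l1)).
by rewrite /conv1 (counit_one hH) scale1r subrr mul0r mulr0 scale0r.
Qed.

Lemma conv_log_id_primel n x : (0 < n)%N -> primel x -> hproj H n x = x ->
  conv_log_id H x = x.
Proof.
move=> n0 px xn; rewrite -{1}xn conv_log_id_sum xn.
under eq_bigr do rewrite convX_primel //.
case: n n0 {xn} => // n _; rewrite big_ord_recl scale0r big_ord_recl big1.
  by rewrite add0r addr0 /logc /= scale1r divr1 scale1r.
by move=> i _; rewrite scale0r scaler0.
Qed.

End Primitive.

(** One polynomial for all H: on T(X) it shows that the operator belongs to the descent algebra, on
    an arbitrary H it computes the action of that operator. *)
Definition realizes n P (f : forall H : hopfData K, H -> H) :=
  homog n P /\ forall H, graded_conn_cocomm_hopf H ->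
    forall x : H, descent_eval H P x = f H (hproj H n x).

Lemma realizes_convX k n :
  exists P, realizes n P (fun H => convX (fun y : H => y - conv1 H y) k).
Proof.
elim: k n => [|k IH] n.
  case: n => [|n].
    exists << FMonom [::] >>; split; first exact: (@homogU _ (FMonom [::])).
    move=> H hH x; rewrite descent_evalU /= /conv1.
    by rewrite (proj0E hH) (counit_alg hH).
  exists 0; split; first exact: homog0.
  by move=> H hH x; rewrite descent_eval0 /= /conv1 (counit_graded hH) //
    scale0r.
have [P hP] := choice IH.
exists (\sum_(i < n) lmul i.+1 (P (n - i.+1)%N)); split.
  apply: homog_sum => i _; rewrite -{1}(subnKC (ltn_ord i)).
  by apply: homog_lmul; case: (hP (n - i.+1)%N).
move=> H hH x; rewrite descent_eval_sum convX_rec //; apply: eq_bigr => i _.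
rewrite descent_eval_lmul; congr (convol _ _ x); apply/funext => y.
by have [_ ->] := hP (n - i.+1)%N.
Qed.

Lemma realizes_log n : exists P, realizes n P (fun H => conv_log_id H).
Proof.
have [P hP] := choice (fun k => realizes_convX k n).
exists (\sum_(k < n.+1) logc k *: P k); split.
  by apply: homog_sum => k _; apply: homogZ; case: (hP k).
move=> H hH x; rewrite descent_eval_sum conv_log_id_sum //.
by apply: eq_bigr => k _; rewrite descent_evalZ; have [_ ->] := hP k.
Qed.

Lemma realizes_dynkin n : exists P, realizes n P (fun H => dynkin_op H).
Proof.
elim/ltn_ind: n => n IH.
have /choice[P hP] : forall i : 'I_n, exists P,
    realizes (n - i.+1) P (fun H => dynkin_op H).
  by move=> i; apply: IH; rewrite ltn_subrL /= (leq_ltn_trans _ (ltn_ord i)).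
exists (n%:R *: lmul n << FMonom [::] >> - \sum_(i < n) lmul i.+1 (P i)); split.
  apply: homogD.
    apply: homogZ; rewrite -{1}[n]addn0; apply: homog_lmul.
    exact: (@homogU _ (FMonom [::])).
  rewrite -scaleN1r; apply: homogZ; apply: homog_sum => i _.
  by rewrite -{1}(subnKC (ltn_ord i)); apply: homog_lmul; case: (hP i).
move=> H hH x; rewrite -scaleN1r descent_evalD !descent_evalZ scaleN1r.
rewrite descent_eval_lmul [X in _ - X]descent_eval_sum dynkin_rec //.
rewrite scaler_nat; congr (_ *+ n - _).
  have -> : descent_eval H << FMonom [::] >> = convol1.
    by apply/funext => y; exact: descent_evalU.
  by rewrite -[LHS]/(convol _ _ _) (convol1r hH) //; exact: lin_linear.
apply: eq_bigr => i _; rewrite descent_eval_lmul; congr (convol _ _ x).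
by apply/funext => y; have [_ ->] := hP i.
Qed.

End DescentHopf.

(** * The generic primitive series and its evaluation *)

Section Evaluation.
Context {K : fieldType}.
Local Notation F := (tensor_alg K nat).

(* The letter [i] is the generic primitive element of degree [i.+1]. *)
Definition qgen : ser F := fun n => if n is i.+1 then tletter i else 0.

Section Eval.
Context {A : algType K} (k : ser A).

Definition ev : F -> A := mlift (fun w : {fmonom nat} => \prod_(i <- (w : seq
  nat)) k i.+1).

Fact ev_linear : linear ev. Proof. exact: mlift_linear. Qed.

Lemma ev_word w : ev (tword w) = \prod_(i <- w) k i.+1.
Proof. by rewrite /ev /tword wordE mliftU. Qed.

Fact ev_monoid : monoid_morphism ev.
Proof.
split; first by rewrite -word_nil ev_word big_nil.
move=> u v; move: u; apply: word_ext => [||w].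
- exact: (lin_comp ev_linear (lin_mulr v (@lin_id _ _))).
- exact: (lin_mulr _ ev_linear).
move: v; apply: word_ext => [||w'].
- exact: (lin_comp ev_linear (lin_mull (tword w) (@lin_id _ _))).
- exact: (lin_mull _ ev_linear).
by rewrite -word_cat !ev_word big_cat.
Qed.

HB.instance Definition _ := GRing.isLinear.Build K F A _ ev ev_linear.
HB.instance Definition _ := GRing.isMonoidMorphism.Build F A ev ev_monoid.

Lemma ev1 : ev 1 = 1. Proof. exact: rmorph1. Qed.

Lemma evM u v : ev (u * v) = ev u * ev v. Proof. exact: rmorphM. Qed.

Lemma ev_letter i : ev (tletter i) = k i.+1.
Proof. by rewrite -word_seq1 ev_word big_seq1. Qed.

Lemma smap_ev : k 0%N = 0 -> smap ev qgen = k.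
Proof.
move=> k0; apply/funext => -[|n]; first by rewrite /smap linear0 k0.
exact: ev_letter.
Qed.

End Eval.

Lemma cop_ev (H : hopfData K) (hH : graded_conn_cocomm_hopf H) (k : ser H) :
  (forall n, primel (k n)) ->
  forall u, hcop H (ev k u) = tmap (ev k) (ev k) (hcop F u).
Proof.
move=> pk; have lk := ev_linear k; have lc := lin_linear (hcop H).
have lkk := lin_tmap lk lk.
apply: word_ext => [||w].
- exact: (lin_comp lc lk).
- exact: (lin_comp lkk (lin_linear (hcop F))).
elim: w => [|i w IH].
  by rewrite word_nil ev1 (cop_one hH) (cop_one (@tensor_alg_hopf K nat))
    tmapT // ev1.
rewrite cop_cons word_cons evM ev_letter (cop_mul hH) pk IH.
move: (hcop F _); apply: tensor_ext => [||a b].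
- exact: (lin_comp (lin_tmulr _) lkk).
- exact: (lin_comp lkk (@lin_dl _ _ i)).
rewrite dlT (linD lkk) !tmapT // coprod_mulT.
by rewrite !evM !ev_letter.
Qed.

End Evaluation.

(** * Free generators of a Lie subalgebra of T(X) and transfer to arbitrary H *)

Section Generic.
Context {K : fieldType} {X : choiceType} (e : nat -> X) (d : X -> nat).
Hypothesis ed : cancel e d.
Local Notation F := (tensor_alg K nat).
Local Notation T := (tensor_alg K X).

Fixpoint ad_letter m (y : T) : T :=
  if m is m'.+1 then ad_letter m' y * tletter (e 0%N) - tletter (e 0%N) *
    ad_letter m' y
  else y.

(* [ell n = [..[[y_n, x], x].., x]], of degree [n], with the letters [x = e 0]
   and [y_n = e n]; these elements are free generators of a free subalgebra. *)
Definition ell : ser T := fun n => if n is m.+1 then ad_letter m (tletter (e n))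
  else 0.

Lemma ell_lie n : lie_elt (ell n).
Proof.
case: n => [|n]; first exact: lie_0.
rewrite /ell; elim: {1}n => [|m IH] /=; first exact: lie_letter.
by apply: lie_bracket => //; exact: lie_letter.
Qed.

Lemma proj_letter x : hproj T 1%N (tletter x) = tletter x.
Proof. by rewrite -word_seq1 proj_word. Qed.

Lemma proj_ad m y : hproj T 1%N y = y ->
  hproj T m.+1 (ad_letter m y) = ad_letter m y.
Proof.
move=> y1; elim: m => [//|m IH]; have hT := @tensor_alg_hopf K X.
have := proj_mul hT m.+1 1 (ad_letter m y) (tletter (e 0%N)).
have := proj_mul hT 1 m.+1 (tletter (e 0%N)) (ad_letter m y).
rewrite IH proj_letter addn1 add1n => p1 p2.
by rewrite [ad_letter m.+1 y]/= (linB (lin_linear (hproj T m.+2))) p1 p2.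
Qed.

Lemma hat_ell : hat T ell.
Proof. by move=> [|n]; [exact: linear0 | exact/proj_ad/proj_letter]. Qed.

Lemma primitive_ell : primitive T ell.
Proof.
split; first exact: hat_ell.
apply/funext => n; rewrite (hat_tens_one (@tensor_alg_hopf K X)).
exact: lie_primel (ell_lie n).
Qed.

(* Reads a word as a product of blocks [y_n x ... x] of length [n]; [j] is the
   number of letters [x] still expected in the current block. *)
Fixpoint read_blocks (w : seq X) (j : nat) : F :=
  match w, j with
  | [::], 0%N => 1
  | [::], _.+1 => 0
  | c :: w', 0%N => if d c is i.+1 then tletter i * read_blocks w' i else 0
  | c :: w', j'.+1 => if d c == 0%N then read_blocks w' j' else 0
  end.

Definition retr j : T -> F := mlift (fun w : {fmonom X} => read_blocks w j).

Lemma lin_retr j : linear (retr j). Proof. exact: mlift_linear. Qed.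

Lemma retr_word j w : retr j (tword w) = read_blocks w j.
Proof. by rewrite /retr /tword wordE mliftU. Qed.

Lemma retr_x0 u : retr 0 (tletter (e 0%N) * u) = 0.
Proof.
move: u; apply: word_ext => [||w].
- exact: (lin_comp (lin_retr 0) (lin_mull _ (@lin_id _ _))).
- exact: lin_cst0.
by rewrite -word_cons retr_word /= ed.
Qed.

Lemma retr_xS j u : retr j.+1 (tletter (e 0%N) * u) = retr j u.
Proof.
move: u; apply: word_ext => [||w].
- exact: (lin_comp (lin_retr _) (lin_mull _ (@lin_id _ _))).
- exact: lin_retr.
by rewrite -word_cons !retr_word /= ed.
Qed.

Lemma retr_y n u : retr 0 (tletter (e n.+1) * u) = tletter n * retr n u.
Proof.
move: u; apply: word_ext => [||w].
- exact: (lin_comp (lin_retr 0) (lin_mull _ (@lin_id _ _))).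
- exact: (lin_mull _ (lin_retr n)).
by rewrite -word_cons !retr_word /= ed.
Qed.

(** Of the expanded iterated bracket only y x ... x survives: the other terms begin with x, and no
    sequence of blocks does. *)
Lemma retr_ad m (y u : T) :
  retr 0 (ad_letter m y * u) = retr 0 (y * (tletter (e 0%N) ^+ m * u)).
Proof.
elim: m u => [|m IH] u; first by rewrite expr0 mul1r.
have -> : ad_letter m.+1 y * u =
    ad_letter m y * (tletter (e 0%N) * u) - tletter (e 0%N) * (ad_letter m y *
      u).
  by rewrite [ad_letter m.+1 y]/= mulrBl !mulrA.
rewrite (linB (lin_retr 0)) [X in _ - X]retr_x0 subr0 [LHS]IH exprSr.
by congr (retr 0 (y * _)); rewrite mulrA.
Qed.

Lemma retr_xn n u : retr n (tletter (e 0%N) ^+ n * u) = retr 0 u.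
Proof.
elim: n => [|n IH]; first by rewrite expr0 mul1r.
by rewrite exprS -mulrA [LHS]retr_xS.
Qed.

Lemma retr1 : retr 0 1 = 1. Proof. by rewrite -word_nil retr_word. Qed.

(** Freeness of the elements [ell n], in the form of a linear left inverse of the evaluation at
    them. *)
Lemma retrK u : retr 0 (ev ell u) = u.
Proof.
move: u; apply: word_ext => [||w].
- exact: (lin_comp (lin_retr 0) (ev_linear ell)).
- exact: lin_id.
elim: w => [|i w IH]; first by rewrite word_nil ev1 retr1.
rewrite word_cons evM ev_letter [LHS](retr_ad i (tletter (e i.+1))).
by rewrite [LHS]retr_y [X in _ * X]retr_xn IH.
Qed.

Hypothesis charK : [pchar K] =i pred0.
Local Notation hT := (@tensor_alg_hopf K X).

Lemma pact_ev (A : algType K) P n (k : ser A) : k 0%N = 0 ->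
  pact P n (gam k) = ev k (pact P n (gam qgen)).
Proof. by move=> k0; rewrite smap_pact smap_gam smap_ev. Qed.

Lemma pact_ell P n : descent_eval T P (gam ell n) = ev ell (pact P n (gam
  qgen)).
Proof.
have gg : grouplike T (gam ell).
  exact: (grouplike_gam hT charK primitive_ell).
by rewrite (descent_eval_grouplike hT P n gg) pact_ev.
Qed.

(** Both operators are applied to the group-like series [gam ell] of T(X), and the injectivity of
    [ev ell] is used. *)
Lemma descent_eval_unique (P P' : {malg K[{fmonom nat}]}) :
  descent_eval T P = descent_eval T P' ->
  forall n, pact P n (gam (qgen : ser F)) = pact P' n (gam qgen).
Proof.
move=> PP' n; apply: (can_inj retrK).
by apply: etrans (pact_ell P' n); rewrite -[LHS]pact_ell PP'.
Qed.

Lemma pact_grouplike (P : {malg K[{fmonom nat}]})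
    (H : hopfData K) (hH : graded_conn_cocomm_hopf H) (g : ser H) n :
  grouplike H g -> pact P n g = ev (hat_dynkin H g) (pact P n (gam qgen)).
Proof.
move=> gg; have /(primitiveP hH)[_ [d0 _]] := primitive_dynkin hH gg.
by rewrite -[RHS](pact_ev P n d0) (gam_dynkin hH charK gg).
Qed.

Lemma descent_eval_transfer (P P' : {malg K[{fmonom nat}]})
    (H : hopfData K) (hH : graded_conn_cocomm_hopf H) (g : ser H) n :
  descent_eval T P = descent_eval T P' -> grouplike H g ->
  descent_eval H P (g n) = descent_eval H P' (g n).
Proof.
move=> PP' gg; rewrite !(descent_eval_grouplike hH _ _ gg).
rewrite [LHS](pact_grouplike P hH n gg) [RHS](pact_grouplike P' hH n gg).
by rewrite (descent_eval_unique PP' n).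
Qed.

(** The generic polynomial Q is primitive: its image under [ev ell] is the value of P on a
    homogeneous element of T(X), hence a Lie element, and primitivity is pulled back along the
    injective [ev ell]. Evaluation at the primitive series D(g) then respects coproducts. *)
Lemma pact_primel (P : {malg K[{fmonom nat}]}) n
    (H : hopfData K) (hH : graded_conn_cocomm_hopf H) (g : ser H) :
  (forall u, hproj T n u = u -> lie_elt (descent_eval T P u)) ->
  grouplike H g -> primel (pact P n g).
Proof.
move=> lieP gg; set Q := pact P n (gam (qgen : ser F)).
have pQ : primel Q.
  have lre (V : lmodType K) (f : T -> F) : linear f ->
    linear (fun u => f (ev ell u)).
    by move=> lf; exact: (lin_comp lf (ev_linear ell)).
  have pell : @primel K T (ev ell Q).
    rewrite -pact_ell; apply/lie_primel/lieP.
    by have [] := grouplike_gam hT charK primitive_ell.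
  have cQ := cop_ev hT (fun m => lie_primel (ell_lie m)) Q.
  have l0 := lin_retr 0; have le := ev_linear ell.
  (* The pullback needs injectivity of [ev ell] on the tensor square as well, which the tensor
     square of its linear left inverse provides. *)
  have tK t : tmap (retr 0) (retr 0) (tmap (ev ell) (ev ell) t) = t.
    move: t; apply: tensor_ext => [||a b].
    - exact: (lin_comp (lin_tmap l0 l0) (lin_tmap le le)).
    - exact: lin_id.
    rewrite (tmapT le le) (tmapT l0 l0).
    by rewrite [X in tens X _]retrK [X in tens _ X]retrK.
  rewrite /primel -[LHS]tK -cQ pell /coprod (linD (lin_tmap l0 l0)).
  rewrite [X in X + _](tmapT l0 l0) [X in _ + X](tmapT l0 l0).
  by congr (tens _ _ + tens _ _); [exact: retrK | exact: retr1 | exact: retr1 |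
    exact: retrK].
have pd := primitive_dynkin hH gg.
have lk := ev_linear (hat_dynkin H g).
rewrite (pact_grouplike P hH n gg) -/Q.
rewrite /primel (cop_ev hH (fun m => primitive_primel hH m pd)) pQ.
rewrite /coprod (linD (lin_tmap lk lk)).
by rewrite [X in X + _](tmapT lk lk) [X in _ + X](tmapT lk lk) ev1.
Qed.

End Generic.

(** * Triangular systems *)

Local Open Scope classical_set_scope.

Section GammaCausal.
Context {K : fieldType} {A : algType K}.
Hypothesis charK : [pchar K] =i pred0.
Implicit Types h : ser A.

Lemma gam_causal h h' n : (forall i, (i <= n)%N -> h i = h' i) ->
  gam h n = gam h' n.
Proof.
move=> hh'; apply: eq_bigr => -[k /= _] _.
elim: k n hh' => [//|k IH] n hh'; rewrite !gamkS; congr (_ *: _).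
apply: eq_bigr => i _; rewrite hh' ?leq_subr // (IH i) // => j ji.
by apply: hh'; rewrite ltnW // (leq_ltn_trans ji).
Qed.

(** In n Gamma_n(h) = h_n + (products), the products involve only components of h below degree n.
    The factor 1/n is undone in the construction of [approx]. *)
Lemma gam_top h h' n : (0 < n)%N -> h 0%N = 0 -> h' 0%N = 0 ->
  (forall i, (i < n)%N -> h i = h' i) ->
  gam h n - gam h' n = n%:R^-1 *: (h n - h' n).
Proof.
case: n => // n _ h0 h0' hh'; apply: (@mulrn_lmod_inj _ charK _ _ _ n.+1) => //.
rewrite -[RHS]scaler_nat scalerA divff ?natK // scale1r mulrnBl.
have dg (f : ser A) : f 0%N = 0 -> gam f n.+1 *+ n.+1 =
    f n.+1 + \sum_(i < n.+1) gam f i.+1 * f (n - i)%N.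
  move=> f0; have := congr1 (@^~ n.+1) (der_gam charK f0).
  by rewrite /der serM big_ord_recl gam0 mul1r subn0.
rewrite !dg // [X in _ - (_ + X)](_ : _ = \sum_(i < n.+1) gam h i.+1 * h (n -
  i)%N).
  by rewrite opprD addrACA subrr addr0.
apply: eq_bigr => i _; rewrite hh' ?ltnS ?leq_subr //.
(* For i = n the first factors have degree n + 1 and may differ, but they are multiplied by the
   vanishing constant term. *)
have [ni|ni] := leqP n i; first by rewrite (eqnP ni) h0' !mulr0.
by congr (_ * _); apply: gam_causal => j ji; rewrite hh' // (leq_ltn_trans ji).
Qed.

End GammaCausal.

Section TriangularSeries.
Context {K : fieldType} {H : hopfData K} (hH : graded_conn_cocomm_hopf H).
Hypothesis charK : [pchar K] =i pred0.
Let lp n : linear (hproj H n) := lin_linear (hproj H n).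

Lemma lin_coprod : linear (@coprod K H).
Proof. by apply: lin_add; [exact: tens_linear_l | exact: tens_linear_r]. Qed.

Lemma primelD (x y : H) : primel x -> primel y -> primel (x + y).
Proof. by move=> px py; rewrite /primel linearD (linD lin_coprod) /= px py. Qed.

Lemma primelZ c (x : H) : primel x -> primel (c *: x).
Proof. by move=> px; rewrite /primel linearZ (linZ lin_coprod) /= px. Qed.

Lemma primel0 : primel (0 : H).
Proof. by rewrite /primel linear0 (lin0 lin_coprod). Qed.

Lemma primelB (x y : H) : primel x -> primel y -> primel (x - y).
Proof. by move=> px py; rewrite -scaleN1r; apply: primelD => //;
  exact: primelZ. Qed.

Lemma primitive_intro (h : ser H) : hat H h -> (forall n, primel (h n)) ->
  primitive H h.
Proof.
by move=> hh ph; split=> //; apply/funext => n; rewrite (hat_tens_one hH);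
  exact: ph.
Qed.

Lemma hat_prod (g : ser H) (w : seq nat) : hat H g ->
  hproj H (sumn w) (\prod_(i <- w) g i) = \prod_(i <- w) g i.
Proof.
move=> hg; elim: w => [|n w IH]; first by rewrite big_nil (proj_one hH).
have := proj_mul hH n (sumn w) (g n) (\prod_(i <- w) g i).
by rewrite big_cons IH hg.
Qed.

Lemma pact_proj P n (g : ser H) : hat H g ->
  hproj H n (pact P n g) = pact P n g.
Proof.
move=> hg; rewrite /pact /mlift (lin_sum (lp n)); apply: eq_bigr => w _.
rewrite (linZ (lp n)); congr (_ *: _).
by case: eqP => [<-|_]; [exact: hat_prod | exact: linear0].
Qed.

Variable P : nat -> {malg K[{fmonom nat}]}.
Hypothesis P_top : forall n, (0 < n)%N -> pcoef (P n) n = 1.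
Hypothesis P_prim : forall n (g : ser H), (0 < n)%N -> grouplike H g ->
  primel (pact (P n) n g).

Definition triangular (g : nat -> H) : nat -> H :=
  fun n => if n == 0%N then 0 else pact (P n) n (g : ser H).

Lemma triangular_primitive g : grouplike H g -> primitive H (triangular g).
Proof.
move=> gg; have [hg _ _] := gg; apply: primitive_intro => -[|n].
- exact: linear0.
- exact: pact_proj.
- exact: primel0.
- exact: P_prim.
Qed.

Lemma triangular_inj g g' : grouplike H g -> grouplike H g' ->
  triangular g = triangular g' -> g = g'.
Proof.
move=> gg gg' e; have g0 := grouplike_at0 hH gg; have g0' :=
  grouplike_at0 hH gg'.
apply/funext; elim/ltn_ind => -[|n] IH; first by rewrite g0 g0'.
have := @pact_top _ H (P n.+1) n.+1 g g' isT g0 g0' IH.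
rewrite P_top // scale1r => /esym/eqP; rewrite -subr_eq0 => /eqP.
have /(congr1 (@^~ n.+1)) /= := e; rewrite /triangular /= => ->.
by rewrite subrr subr0 => /eqP; rewrite subr_eq0 => /eqP.
Qed.

Definition single n (v : H) : ser H := fun m => if m == n then v else 0.

Lemma primitive_single (k : ser H) n v : primitive H k -> primel v ->
  hproj H n v = v -> primitive H (k + single n v : ser H).
Proof.
move=> pk pv vn; apply: primitive_intro => [|m].
  apply: hatD; first by case: pk.
  by move=> m; rewrite /single; case: eqP => [->|_] //; exact: linear0.
rewrite serD; apply: primelD; first exact: primitive_primel pk.
by rewrite /single; case: eqP => _ //; exact: primel0.
Qed.

Section Surjective.
Variable h : ser H.
Hypothesis ph : primitive H h.

(* [approx n] is a primitive series whose image by [triangular \o gam] agrees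
   with [h] up to degree [n]. *)
Fixpoint approx n : ser H :=
  if n is m.+1 then
    approx m + single n (n%:R *: (h n - pact (P n) n (gam (approx m))))
  else 0.

(** The correction is primitive because [P_prim] applies to the group-like series Gamma of the
    preceding approximation, and it is homogeneous by [pact_proj]. *)
Lemma approx_primitive n : primitive H (approx n).
Proof.
elim: n => [|n IH].
  by apply: primitive_intro => [m|m]; [exact: linear0 | exact: primel0].
have gg := grouplike_gam hH charK IH; have [hg _ _] := gg.
have [hh _] := ph.
apply: primitive_single => //.
  apply/primelZ/primelB; first exact: primitive_primel ph.
  exact: P_prim.
by rewrite (linZ (lp _)) (linB (lp _)) hh pact_proj.
Qed.

Lemma approx_stable n i : (i <= n)%N -> approx n i = approx i i.
Proof.
elim: n => [|n IH]; first by rewrite leqn0 => /eqP ->.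
rewrite leq_eqVlt => /orP[/eqP -> //|]; rewrite ltnS => ni.
by rewrite [approx n.+1]/= serD /single ltn_eqF ?ltnS // addr0 IH.
Qed.

Definition limit : ser H := fun n => approx n n.

Lemma limit_primitive : primitive H limit.
Proof.
apply: primitive_intro => n; rewrite /limit.
  by have [hn _] := approx_primitive n; exact: hn.
exact: primitive_primel (approx_primitive n).
Qed.

Lemma triangular_limit : triangular (gam limit) = h.
Proof.
apply/funext => -[|n]; rewrite /triangular /=.
  by have /(primitiveP hH)[_ [-> _]] := ph.
have at0 m : approx m 0%N = 0.
  by have /(primitiveP hH)[_ [-> _]] := approx_primitive m.
rewrite (@pact_causal _ _ _ _ _ (gam (approx n.+1))); last first.
  move=> i ni; apply: gam_causal => j ji.
  by rewrite /limit -(approx_stable (leq_trans ji ni)).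
have below i : (i < n.+1)%N -> approx n.+1 i = approx n i.
  by rewrite ltnS => ni; rewrite !approx_stable // (leq_trans ni).
have := @pact_top _ H (P n.+1) n.+1 (gam (approx n.+1)) (gam (approx n))
  isT (gam0 _) (gam0 _).
rewrite P_top // scale1r gam_top //; last first.
rewrite [approx n.+1]/= serD /single eqxx addrAC subrr add0r.
(* The factor n + 1 in [approx] cancels the inverse from [gam_top], so the value in degree n + 1 is
   shifted by exactly the missing amount. *)
rewrite scalerA mulVf ?natK // scale1r => /(_ _)/subIr; apply.
move=> i ni; apply: gam_causal => j ji; apply: below.
exact: leq_ltn_trans ji ni.
Qed.

End Surjective.

Lemma triangular_bij : set_bij (grouplike H) (primitive H) triangular.
Proof.
split.
- exact: triangular_primitive.
- by move=> g g' /set_mem gg /set_mem gg'; exact: triangular_inj.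
- move=> h ph; exists (gam (limit h)); last exact: triangular_limit.
  exact/(grouplike_gam hH charK)/limit_primitive.
Qed.

End TriangularSeries.

(** * Lie idempotents *)

Section LieIdempotents.
Context {K : fieldType} (X : choiceType).
Hypothesis charK : [pchar K] =i pred0.
Local Notation T := (tensor_alg K X).
Local Notation hT := (@tensor_alg_hopf K X).

Lemma lie_idempotent_intro n (f : T -> T) (P : {malg K[{fmonom nat}]}) :
  homog n P -> descent_eval T P = f -> (forall u, lie_elt (f u)) ->
  (forall u, primel u -> hproj T n u = u -> f u = u) -> lie_idempotent n f.
Proof.
move=> hP Pf lf ff; have fn u : hproj T n (f u) = f u.
  by rewrite -Pf (descent_eval_proj hT).
split.
- by exists P.
- by move=> u _; apply: ff => //; exact/lie_primel.
- apply/seteqP; split=> [_ [u _ <-]|u [lu nu]]; first by split.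
  by exists u => //; apply: ff => //; exact/lie_primel.
Qed.

Lemma dynkin_fix n (u : T) : (0 < n)%N -> primel u -> hproj T n u = u ->
  n%:R^-1 *: dynkin_op T u = u.
Proof.
case: n => // n _ pu nu; rewrite (dynkin_primel hT pu nu) -scaler_nat scalerA.
by rewrite mulVf ?natK // scale1r.
Qed.

Lemma dynkin_lie_idempotent : lie_idempotent_series (dynkin_series K X).
Proof.
move=> n n0; have [P [hP eP]] := @realizes_dynkin K n.
apply: (@lie_idempotent_intro n _ (n%:R^-1 *: P)).
- exact: homogZ.
- by apply/funext => u; rewrite descent_evalZ (eP T hT).
- by move=> u; apply: lie_scale; exact: dynkin_lie.
- by move=> u pu nu; rewrite /dynkin_series nu dynkin_fix.
Qed.

Lemma eulerian_lie_idempotent : lie_idempotent_series (eulerian_series K X).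
Proof.
move=> n n0; have [P [hP eP]] := @realizes_log K n.
have eP' : descent_eval T P = eulerian_series K X n.
  by apply/funext => u; rewrite (eP T hT).
apply: (@lie_idempotent_intro n _ P) => // [u|u pu nu].
  have pu : primel (eulerian_series K X n u).
    exact: (conv_log_id_prim charK hT).
  have nu : hproj T n (eulerian_series K X n u) = eulerian_series K X n u.
    by rewrite -eP' (descent_eval_proj hT).
  (* A primitive element of degree n is the image of itself under D/n, hence a Lie element. *)
  rewrite -(dynkin_fix n0 pu nu); apply: lie_scale; exact: dynkin_lie.
by rewrite /eulerian_series nu (conv_log_id_primel hT n0 pu nu).
Qed.

Section Letters.
Context (e : nat -> X) (d : X -> nat).
Hypothesis ed : cancel e d.

Lemma ell_neq0 n : ell (K := K) e n.+1 != 0.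
Proof.
have h : retr d 0 (ell e n.+1) = tletter n :> tensor_alg K nat.
  by rewrite -ev_letter retrK.
apply/eqP => l0; move: h; rewrite l0 (lin0 (lin_retr d 0)) => /esym/eqP.
rewrite -[_ == _]/(<< fmu n >> == 0 :> {malg K[{fmonom nat}]}).
by rewrite monalgU_eq0 oner_eq0.
Qed.

(** P acts on primitive elements of degree n as the scalar [pcoef P n], while f fixes [ell e n], a
    nonzero Lie element of degree n. *)
Lemma lie_idempotent_top n (f : T -> T) P : (0 < n)%N -> lie_idempotent n f ->
  descent_eval T P = f -> pcoef P n = 1.
Proof.
case: n => // n _ [_ ff fL] Pf.
have lu := @ell_lie K X e n.+1; have nu := @hat_ell K X e n.+1.
have [v nv fv] : (f @` [set u | hproj T n.+1 u = u]) (ell e n.+1).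
  by rewrite fL.
have fu : f (ell e n.+1) = ell e n.+1 by rewrite -fv ff.
have := descent_eval_primel hT P (isT : (0 < n.+1)%N) (lie_primel lu) nu.
rewrite Pf fu => /eqP; rewrite -{1}[ell _ _]scale1r -subr_eq0 -scalerBl.
by rewrite scaler_eq0 (negPf (ell_neq0 n)) orbF subr_eq0 => /eqP.
Qed.

Context {H : hopfData K} (hH : graded_conn_cocomm_hopf H).

Lemma series_act_bij (gamma : nat -> T -> T) : lie_idempotent_series gamma ->
  set_bij (grouplike H) (primitive H) (series_act H gamma).
Proof.
move=> lg.
(* The same choice as in [descent_act], so that [series_act] is the evaluation of these polynomials
   by definition. *)
pose P n := xget (0 : {malg K[{fmonom nat}]}) [set P | gamma n = descent_eval T
  P].
have PE n : (0 < n)%N -> descent_eval T (P n) = gamma n.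
  move=> n0; have [[Q _ Qg] _ _] := lg n n0.
  by have := @xgetPex _ 0 [set P | gamma n = descent_eval T P] (ex_intro _ Q
    Qg).
have Ptop n : (0 < n)%N -> pcoef (P n) n = 1.
  by move=> n0; apply: (lie_idempotent_top n0 (lg n n0)); exact: PE.
have Pprim n (g : ser H) : (0 < n)%N -> grouplike H g ->
  primel (pact (P n) n g).
  move=> n0 gg; apply: (pact_primel ed charK hH) gg => u nu.
  rewrite PE //; have [_ _ fL] := lg n n0.
  suff : (gamma n @` [set u | hproj T n u = u]) (gamma n u) by rewrite fL =>
    -[].
  by exists u.
have eg g : grouplike H g -> triangular P g = series_act H gamma g.
  move=> gg; apply/funext => n; rewrite /triangular /series_act.
  by case: eqP => // _; rewrite -(descent_eval_grouplike hH).
apply: eq_set_bijRL (triangular_bij hH charK Ptop Pprim) => g /set_mem.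
exact: eg.
Qed.

(** The polynomial chosen in [descent_act] and the explicit P may differ, but they define the same
    operator on T(X) and therefore agree on group-like series of H. *)
Lemma series_act_realized (gamma : nat -> T -> T) n
    (f : forall H : hopfData K, H -> H) P (g : ser H) :
  (0 < n)%N -> realizes n P f -> (forall u, gamma n u = f T (hproj T n u)) ->
  grouplike H g -> series_act H gamma g n = f H (g n).
Proof.
move=> n0 [hP eP] gf gg; have [hg _ _] := gg.
have Pg : gamma n = descent_eval T P.
  by apply/funext => u; rewrite gf (eP T hT).
rewrite /series_act gtn_eqF // /descent_act -[in RHS](hg n) -(eP H hH).
have e0 := @xgetPex _ 0 [set P | gamma n = descent_eval T P] (ex_intro _ P Pg).
exact: (descent_eval_transfer ed charK hH n (etrans (esym e0) Pg) gg).
Qed.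

End Letters.
End LieIdempotents.

Lemma nat_letters (X : choiceType) : ([set: X] #= [set: nat])%card ->
  exists (e : nat -> X) (d : X -> nat), cancel e d.
Proof.
move=> /card_set_bijP[d [_ dI dS]].
have /choice[e ed] : forall n, exists x, d x = n.
  by move=> n; have [x _ <-] := dS n I; exists x.
by exists e, d.
Qed.

Lemma inverse_bij_intro (A B : Type) (P : set A) (Q : set B)
    (f : A -> B) (g : B -> A) :
  (forall x, P x -> Q (f x)) -> (forall y, Q y -> P (g y)) ->
  (forall x, P x -> g (f x) = x) -> (forall y, Q y -> f (g y) = y) ->
  inverse_bij P Q f g.
Proof.
move=> fPQ gQP fK gK; split=> //; split=> //.
- by move=> x y /set_mem Px /set_mem Py e; rewrite -(fK x) // e fK.
- by move=> y Qy; exists (g y); [exact: gQP | exact: gK].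
Qed.

Theorem theorem2p1 (K : fieldType) (charK : [pchar K] =i pred0)
    (X : choiceType) (hX : ([set: X] #= [set: nat])%card)
    (H : hopfData K) (hH : graded_conn_cocomm_hopf H) :
  [/\ forall gamma : nat -> tensor_alg K X -> tensor_alg K X,
        lie_idempotent_series gamma ->
        set_bij (grouplike H) (primitive H) (series_act H gamma),
      [/\ lie_idempotent_series (eulerian_series K X),
          forall g, grouplike H g ->
            series_act H (eulerian_series K X) g = hat_log H g
        & inverse_bij (grouplike H) (primitive H)
            (hat_log H) (hat_exp H)]
    & [/\ lie_idempotent_series (dynkin_series K X),
          forall g, grouplike H g -> forall n, (0 < n)%N ->
            series_act H (dynkin_series K X) g n = n%:R^-1 *: hat_dynkin H g n
        & inverse_bij (grouplike H) (primitive H)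
            (hat_dynkin H) (hat_Gamma H)]].
Proof.
have [e [d ed]] := nat_letters hX.
split; first by move=> gamma lg; exact (series_act_bij charK ed hH lg).
  split; first exact: eulerian_lie_idempotent.
    move=> g gg; apply/funext => -[|n].
      by rewrite (hat_logE (grouplike_at0 hH gg)) Log0.
    have [P hP] := @realizes_log K n.+1.
    rewrite -(conv_log_id_grouplike hH n.+1 gg).
    exact: (series_act_realized charK ed hH (ltn0Sn n) hP).
  have prim0 (h : ser H) : primitive H h -> h 0%N = 0.
    by move=> /(primitiveP hH)[_ []].
  apply: inverse_bij_intro => [g gg|h ph|g gg|h ph].
  - by rewrite (hat_logE (grouplike_at0 hH gg)); exact: primitive_Log.
  - by rewrite (hat_expE (prim0 h ph)); exact: grouplike_Exp.
  - by rewrite (hat_logE (grouplike_at0 hH gg)) hat_expE ?Log0 // LogK //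
      (grouplike_at0 hH gg).
  - by rewrite (hat_expE (prim0 h ph)) hat_logE ?Exp0 // ExpK // prim0.
split; first exact: dynkin_lie_idempotent.
  move=> g gg n n0; have [P [hP eP]] := @realizes_dynkin K n.
  apply: (series_act_realized charK ed hH n0 (P := n%:R^-1 *: P)
    (f := fun H x => n%:R^-1 *: dynkin_op H x)) => //.
  split; first exact: homogZ.
  by move=> H' hH' x; rewrite descent_evalZ (eP H' hH').
apply: inverse_bij_intro => [g gg|h ph|g gg|h ph].
- exact: primitive_dynkin.
- by rewrite hat_GammaE; exact: grouplike_gam.
- by rewrite hat_GammaE; exact: gam_dynkin.
- by rewrite hat_GammaE; exact: dynkin_gam.
Qed.
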